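(* Let $\Omega\subset\mathbb{R}^n$ be a bounded $C^1$ domain and let $p:\Omega\to(1,\infty)$ be continuous with $p^-:=\inf_{\Omega}p>1$ (the case $\sup_\Omega p=+\infty$ is allowed). Let $\varphi\in W^{1,p^-,p(\cdot)}(\Omega)$ satisfy $\int_\Omega\frac{|\nabla\varphi|^{p(x)}}{p(x)}\,dx<\infty$, and let $S\subset W^{1,p^-,p(\cdot)}(\Omega)$ be a vector subspace consisting of functions with compact support in $\Omega$. Then the Dirichlet integral $$F:\overline{S}^{p^-,p(\cdot)}\to[0,\infty],\qquad F(u)=\int_\Omega\frac{|\nabla(u-\varphi)|^{p(x)}}{p(x)}\,dx,$$ has a unique minimizer $u\in\overline{S}^{p^-,p(\cdot)}$.
   Context: $L^{p(\cdot)}(\Omega)$ is the space of measurable $u$ (modulo a.e. equality) with $\int_\Omega|\lambda u(x)|^{p(x)}dx<\infty$ for some $\lambda>0$. Define $W^{1,p^-,p(\cdot)}(\Omega)=\{u\in L^{p^-}(\Omega):\nabla u\in(L^{p(\cdot)}(\Omega))^n\}$ (weak gradient), with the convex modular $$\rho_{p^-,p}(u)=\int_\Omega|u|^{p^-}dx+\int_\Omega\frac{|\nabla u|^{p(x)}}{p(x)}\,dx\in[0,\infty],$$ where $|\nabla u|$ is the Euclidean norm of the gradient. The modular topology of $\rho_{p^-,p}$ on $W^{1,p^-,p(\cdot)}(\Omega)$: a set $A$ is open iff for every $u\in A$ there is $\varepsilon>0$ with $\{v:\rho_{p^-,p}(v-u)<\varepsilon\}\subset A$; equivalently, a set $C$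 is closed iff $u_j\in C$, $\rho_{p^-,p}(u_j-u)\to0$ imply $u\in C$. $\overline{S}^{p^-,p(\cdot)}$ denotes the closure of $S$ in this topology (the intersection of all closed sets containing $S$). *)

(* Defs.v *)
From HB Require Import structures.
From mathcomp Require Import all_boot all_order all_algebra.
From mathcomp Require Import all_classical all_reals all_analysis.

Set Implicit Arguments.
Unset Strict Implicit.
Unset Printing Implicit Defensive.

Import Order.TTheory GRing.Theory Num.Theory.
Import numFieldNormedType.Exports.

Local Open Scope classical_set_scope.
Local Open Scope ring_scope.

(* R^n is ['rV[R]_n].  Its sigma-algebra is generated by the coordinates, as the
   library does for tuples; it is the Borel sigma-algebra. *)
Section measurable_rV.
Variables (R : realType) (n : nat).

Let coors : 'I_n -> 'rV[R]_n -> measurableTypeR R := fun i v => v ord0 i.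

Let rV_set0 : g_sigma_preimage coors set0.
Proof. exact: sigma_algebra0. Qed.

Let rV_setC A : g_sigma_preimage coors A -> g_sigma_preimage coors (~` A).
Proof. exact: sigma_algebraC. Qed.

Let rV_bigcup (F : (set 'rV[R]_n)^nat) :
  (forall i, g_sigma_preimage coors (F i)) ->
  g_sigma_preimage coors (\bigcup_i (F i)).
Proof. exact: sigma_algebra_bigcup. Qed.

HB.instance Definition _ := @isMeasurable.Build default_measure_display
  'rV[R]_n (g_sigma_preimage coors) rV_set0 rV_setC rV_bigcup.

Lemma measurable_coord (i : 'I_n) :
  measurable_fun [set: 'rV[R]_n] (fun v => v ord0 i : measurableTypeR R).
Proof.
move=> _ Y mY; rewrite setTI; apply: sub_sigma_algebra => /=.
rewrite -bigcup_seq/=; exists i => /=; first by rewrite mem_index_enum.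
by exists Y => //; rewrite setTI.
Qed.

Lemma measurable_fun_rV d (T : measurableType d) (f : T -> 'rV[R]_n) :
  (forall i, measurable_fun [set: T] (fun t => f t ord0 i : measurableTypeR R)) ->
  measurable_fun [set: T] f.
Proof.
move=> mf; apply: (@measurability _ _ _ _ _ _ 
  (\big[setU/set0]_(i < n) preimage_set_system setT (coors i) measurable)) => //.
move=> _ [B + <-]; rewrite -bigcup_seq => -[i _ [C mC <-]].
rewrite !setTI; have := mf i measurableT C mC.
by rewrite setTI.
Qed.

End measurable_rV.

Section lebesgue_rV.
Variable R : realType.

Definition cons_rV n (z : measurableTypeR R * 'rV[R]_n) : 'rV[R]_n.+1 :=
  row_mx (const_mx z.1 : 'rV_1) z.2.

(* Lebesgue measure on R^n as an n-fold product. *)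
Fixpoint lebesgue_rV n : set 'rV[R]_n -> \bar R :=
  match n with
  | 0 => dirac (0 : 'rV[R]_0)
  | n'.+1 => pushforward (lebesgue_measure \x lebesgue_rV (n := n'))%E
                         (@cons_rV n')
  end.

Let uncons_rV n (v : 'rV[R]_n.+1) : measurableTypeR R * 'rV[R]_n :=
  (v ord0 ord0, rsubmx (v : 'rV_(1 + n))).

Let cons_rVK n : cancel (@cons_rV n) (@uncons_rV n).
Proof.
move=> [x v]; rewrite /uncons_rV /cons_rV/= row_mxKr; congr pair.
have -> : (ord0 : 'I_(1 + n)) = lshift n (ord0 : 'I_1) by exact: val_inj.
by rewrite (@row_mxEl _ 1 1 n) mxE.
Qed.

Let measurable_cons_rV n : measurable_fun setT (@cons_rV n).
Proof.
apply: measurable_fun_rV => i; rewrite /cons_rV.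
have [j ->|j ->] := @split_ordP 1 n i.
  rewrite [X in measurable_fun _ X](_ : _ = fst)//.
  by apply/funext => -[x v]; rewrite /= (@row_mxEl _ 1 1 n) mxE.
rewrite [X in measurable_fun _ X](_ : _ = (fun v : 'rV[R]_n => v ord0 j) \o snd).
  by apply: measurableT_comp; [exact: measurable_coord|exact: measurable_snd].
by apply/funext => -[x v]; rewrite /= (@row_mxEr _ 1 1 n).
Qed.

Let measurable_uncons_rV n : measurable_fun setT (@uncons_rV n).
Proof.
apply/measurable_fun_pairP; split => /=; first exact: measurable_coord.
apply: measurable_fun_rV => i /=.
rewrite [X in measurable_fun _ X](_ : _ = fun v : 'rV[R]_n.+1 => v ord0 (rshift 1 i)).
  exact: measurable_coord.
by apply/funext => v; rewrite mxE.
Qed.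

Let product_rV n (m : {sigma_finite_measure set 'rV[R]_n -> \bar R}) :
  let mu := pushforward (@lebesgue_measure R \x m)%E (@cons_rV n) in
  [/\ mu set0 = 0%E, (forall A, 0 <= mu A)%E, semi_sigma_additive mu &
      sigma_finite setT mu].
Proof.
move=> mu.
pose M := [the {measure set _ -> \bar R} of (@lebesgue_measure R \x m)%E].
rewrite (_ : mu = pushforward M (@cons_rV n))// {mu}.
split.
- by rewrite /pushforward preimage_set0 measure0.
- by move=> A; rewrite /pushforward; exact: measure_ge0.
- move=> G mG tG mUG; rewrite /pushforward preimage_bigcup.
  apply: measure_semi_sigma_additive.
  + by move=> k; rewrite -[X in measurable X]setTI; exact: measurable_cons_rV.
  + apply/trivIsetP => /= i j _ _ ij; rewrite -preimage_setI.
    by move/trivIsetP : tG => /(_ _ _ _ _ ij) ->//; rewrite preimage_set0.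
  + rewrite -preimage_bigcup -[X in measurable X]setTI.
    exact: measurable_cons_rV.
- have /sigma_finiteP[F [TF ndF Foo]] := sigma_finiteT (@lebesgue_measure R).
  have /sigma_finiteP[G [TG ndG Goo]] := sigma_finiteT m.
  exists (fun k => @uncons_rV n @^-1` (F k `*` G k)).
    rewrite -preimage_bigcup -[LHS](@preimage_setT _ _ (@uncons_rV n)).
    congr (_ @^-1` _); rewrite -setXTT TF TG predeqE => -[x y]; split.
      move=> [/= [i _ Fix] [j _ Gjy]]; exists (maxn i j) => //; split.
      - by move: x Fix; exact/subsetPset/ndF/leq_maxl.
      - by move: y Gjy; exact/subsetPset/ndG/leq_maxr.
    by move=> [i _ []/= ? ?]; split; exists i.
  move=> k; have [mF Fk] := Foo k; have [mG Gk] := Goo k; split.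
    rewrite -[X in measurable X]setTI.
    by apply: measurable_uncons_rV => //; exact: measurableX.
  rewrite /pushforward -comp_preimage (_ : _ \o _ = id); last first.
    by apply/funext => z /=; rewrite cons_rVK.
  by rewrite preimage_id /M/= product_measure1E// lte_mul_pinfty// ge0_fin_numE.
Qed.

Let lebesgue_rV_measure n :
  [/\ @lebesgue_rV n set0 = 0%E, (forall A, 0 <= @lebesgue_rV n A)%E,
      semi_sigma_additive (@lebesgue_rV n) &
      sigma_finite setT (@lebesgue_rV n)].
Proof.
elim: n => [|n [m0 mge0 madd mfin]].
  split=> /=; [exact: measure0|by move=> A; exact: measure_ge0
              |exact: measure_semi_sigma_additive|].
  apply: fin_num_fun_sigma_finite; first by rewrite measure0 ltry.
  exact: fin_num_measure.
pose ism := isMeasure.Build _ _ _ (@lebesgue_rV n) m0 mge0 madd.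
pose m0' : {measure set 'rV[R]_n -> \bar R} := HB.pack (@lebesgue_rV n) ism.
pose issf := Measure_isSigmaFinite.Build _ _ _ m0' mfin.
pose m : {sigma_finite_measure set 'rV[R]_n -> \bar R} :=
  HB.pack (@lebesgue_rV n) ism issf.
exact: (product_rV m).
Qed.

Let lebesgue_rV0 n : @lebesgue_rV n set0 = 0%E.
Proof. by have [] := lebesgue_rV_measure n. Qed.
Let lebesgue_rV_ge0 n A : (0 <= @lebesgue_rV n A)%E.
Proof. by have [_ h _ _] := lebesgue_rV_measure n; exact: h. Qed.
Let lebesgue_rV_sigma_additive n : semi_sigma_additive (@lebesgue_rV n).
Proof. by have [] := lebesgue_rV_measure n. Qed.
Let lebesgue_rV_sigma_finite n : sigma_finite setT (@lebesgue_rV n).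
Proof. by have [] := lebesgue_rV_measure n. Qed.

HB.instance Definition _ n := isMeasure.Build _ _ _ (@lebesgue_rV n)
  (@lebesgue_rV0 n) (@lebesgue_rV_ge0 n) (@lebesgue_rV_sigma_additive n).
HB.instance Definition _ n := Measure_isSigmaFinite.Build _ _ _
  (@lebesgue_rV n) (@lebesgue_rV_sigma_finite n).

End lebesgue_rV.
Arguments lebesgue_rV {R n}.

Section calculus.
Variables (R : realType) (n : nat).
Implicit Types (f : 'rV[R]_n -> R) (Omega : set 'rV[R]_n).

Definition partial (i : 'I_n) f : 'rV[R]_n -> R :=
  fun x => 'D_(delta_mx ord0 i) f x.

Definition C1_fun f :=
  forall i : 'I_n, (forall x, derivable f x (delta_mx ord0 i)) /\
                   continuous (partial i f).

Definition smooth_fun f :=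
  forall s : seq 'I_n, C1_fun (foldr partial f s).

Definition test_fun Omega f :=
  [/\ smooth_fun f, compact (closure [set x | f x != 0]) &
      closure [set x | f x != 0] `<=` Omega].

(* The norm of the library on ['rV[R]_n] is the sup norm. *)
Definition euclid_norm (v : 'rV[R]_n) : R :=
  Num.sqrt (\sum_(i < n) v ord0 i ^+ 2).

End calculus.

(* Near each boundary point and up to the choice and orientation of the
   coordinate axis i, Omega is the region strictly above the graph of a C^1
   function of the n - 1 other coordinates, which [col' i x] collects. *)
Definition C1_boundary (R : realType) (n : nat) (Omega : set 'rV[R]_n) :=
  forall x0, closure Omega x0 -> ~ Omega x0 ->
    exists (i : 'I_n) (s : bool) (gamma : 'rV[R]_n.-1 -> R),
      C1_fun gamma /\
      \forall x \near x0, Omega x <-> gamma (col' i x) < (-1) ^+ s * x ord0 i.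

Definition bounded_C1_domain (R : realType) (n : nat) (Omega : set 'rV[R]_n) :=
  [/\ Omega !=set0, open Omega, connected Omega, bounded_set Omega &
      C1_boundary Omega].

Section sobolev.
Variables (R : realType) (n : nat) (Omega : set 'rV[R]_n).
Implicit Types (u v : 'rV[R]_n -> R) (G : 'rV[R]_n -> 'rV[R]_n).
Implicit Types (p : 'rV[R]_n -> R) (A C S : set ('rV[R]_n -> R)).
Local Notation mu := (@lebesgue_rV R n).

(* A function on Omega is represented by a Borel function u on R^n, of which
   only the values in Omega matter; u and v represent the same class when
   [eq_on u v]. *)
Definition eq_on u v := ae_eq mu Omega u v.

Definition L1loc u :=
  measurable_fun Omega u /\
  forall K, compact K -> K `<=` Omega -> mu.-integrable K (EFin \o u).

Definition Lq (q : R) u :=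
  measurable_fun Omega u /\ (\int[mu]_(x in Omega) (`|u x| `^ q)%:E < +oo)%E.

Definition Lvar p u :=
  measurable_fun Omega u /\
  exists2 lambda : R, 0 < lambda &
    (\int[mu]_(x in Omega) (`|lambda * u x| `^ p x)%:E < +oo)%E.

Definition is_weak_gradient u G :=
  [/\ L1loc u, (forall i, L1loc (fun x => G x ord0 i)) &
      forall (i : 'I_n) psi, test_fun Omega psi ->
        \int[mu]_(x in Omega) (u x * partial i psi x) =
        - \int[mu]_(x in Omega) (G x ord0 i * psi x)].

(* The weak gradient of u, unique up to a null set when it exists. *)
Definition wgrad u : 'rV[R]_n -> 'rV[R]_n :=
  xget (fun=> 0) [set G | is_weak_gradient u G].

Definition pminus p : R := inf [set p x | x in Omega].

(* W^{1,p^-,p(.)}(Omega) *)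
Definition sobolev p : set ('rV[R]_n -> R) :=
  [set u | [/\ Lq (pminus p) u, (exists G, is_weak_gradient u G) &
               forall i, Lvar p (fun x => wgrad u x ord0 i)]].

Definition dirichlet p u : \bar R :=
  (\int[mu]_(x in Omega) (euclid_norm (wgrad u x) `^ p x / p x)%:E)%E.

Definition modular p u : \bar R :=
  (\int[mu]_(x in Omega) (`|u x| `^ pminus p)%:E + dirichlet p u)%E.

(* Modular balls do not separate representatives of one class, so open and
   closed sets of functions in this sense are unions of classes. *)
Definition modular_open p A :=
  A `<=` sobolev p /\
  forall u, A u -> exists2 eps : R, 0 < eps &
    forall v, sobolev p v -> (modular p (v \- u)%R < eps%:E)%E -> A v.

Definition modular_closed p C :=
  C `<=` sobolev p /\ modular_open p (sobolev p `\` C).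

Definition modular_closure p S : set ('rV[R]_n -> R) :=
  smallest (modular_closed p) S.

(* A vector subspace of the space of classes, given as a union of classes. *)
Definition sobolev_subspace p S :=
  [/\ S `<=` sobolev p,
      forall u v, S u -> sobolev p v -> eq_on u v -> S v,
      S (cst 0),
      forall u v, S u -> S v -> S (u \+ v) &
      forall (a : R) u, S u -> S (fun x => a * u x)].

Definition compactly_supported u :=
  exists K, [/\ compact K, K `<=` Omega &
                ae_eq mu (Omega `\` K) u (cst 0)].

Definition is_minimizer (F : ('rV[R]_n -> R) -> \bar R) A u :=
  A u /\ forall v, A v -> (F u <= F v)%E.

End sobolev.

(* Main.v *)
Require Import Defs.
From HB Require Import structures.
From mathcomp Require Import all_boot all_order all_algebra.
From mathcomp Require Import all_classical all_reals all_analysis.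
From mathcomp Require Import measurable_realfun ring lra.

(* Write q for p^-.  The powers t ^ r with r >= q are convex uniformly in r: if
   s, t, m, d are the Euclidean norms of a, b, (a + b)/2, (a - b)/2, then
   d^r <= K ((s^r + t^r)/2 - m^r) + e (s^r + t^r)/2 with K depending on q and e
   only.  Hence the energy of grad (u_j - u_k)/2 tends to 0 along a minimizing
   sequence; no such claim is made for grad (u_j - u_k), as sup p may be infinite.
   Since Omega has finite measure, a small energy forces a small L^q norm of the
   gradient.  Modular limits are therefore W^{1,q} limits, the Poincaré inequality
   of the functions of S passes to the modular closure, and u_j / 2 is Cauchy in
   W^{1,q}.  Along a subsequence u_j / 2 and its gradient converge a.e., and by
   Fatou the limit w is also a modular limit.  The closure is a vector space, so it
   contains 2w, at which F is minimal by Fatou again.  For two minimizers u, v the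
   convexity inequality kills the energy of grad (u - v)/2, and Poincaré yields
   u = v. *)

Set Implicit Arguments.
Unset Strict Implicit.
Unset Printing Implicit Defensive.

Import Order.TTheory GRing.Theory Num.Theory.
Import numFieldNormedType.Exports.

Local Open Scope classical_set_scope.
Local Open Scope ring_scope.

(** * Uniform convexity of the powers *)

(** Two obstacles shape the proof. First, the closure is an intersection of modular closed sets, not
    a set of limits of sequences from [S]: whatever is claimed of its elements is proved by
    exhibiting a modular closed set that contains [S]. Each claim must therefore be put in a form
    that survives modular limits, and scaling is used only with factors of absolute value at most 1.
    Second, the elements of [S] are mere Sobolev functions, and they are not approximated by smooth
    ones to obtain the Poincaré inequality. As u has compact support, its weak gradient can be
    tested with a cutoff times a primitive that is not compactly supported itself; this represents u
    almost everywhere as the integral along rays of its cut off first partial derivative. Hence the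
    explicit class of smooth functions, stable under derivatives and primitives, whose bumps also
    yield the fundamental lemma and the uniqueness of weak gradients. The uniformity in the exponent
    comes from ln y <= y - 1 alone: the convexity gap that it yields grows with the exponent. *)

Section powR_inequalities.
Variable R : realType.
Implicit Types a d e h m p q s t x y : R.

(** Here x^p = x exp((p - 1) ln x) >= x (1 + (p - 1) ln x), and ln y <= y - 1 at y = 1 / sqrt x
    gives x ln x >= 2x - 2 sqrt x, which is the second factor. The square is the excess over the
    tangent at 1; its weight p - 1 makes the excess uniform over p >= q. *)
Lemma powR_ge_tangent x p : 0 <= x -> 1 <= p ->
  x + (p - 1) * (x - 1 + (Num.sqrt x - 1) ^+ 2) <= x `^ p.
Proof.
rewrite le_eqVlt => /predU1P[<- p1|x0 p1].
  by rewrite powR0 ?sqrtr0; [rewrite sub0r expr2; lra|lra].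
have sx0 : 0 < Num.sqrt x by rewrite sqrtr_gt0.
have xE : Num.sqrt x ^+ 2 = x by rewrite sqr_sqrtr // ltW.
have lnx : 1 - (Num.sqrt x)^-1 <= ln x / 2.
  have -> : ln x = ln (Num.sqrt x) *+ 2 by rewrite -lnXn // xE.
  rewrite -[X in _ <= X / _]mulr_natr -mulrA divff ?pnatr_eq0 // mulr1.
  have := @le_ln1Dx R ((Num.sqrt x)^-1 - 1).
  rewrite addrCA subrr addr0 lnV ?posrE //.
  have h : 0 < (Num.sqrt x)^-1 by rewrite invr_gt0.
  by move=> H; have := H ltac:(lra); lra.
have h1 : x - 1 + (Num.sqrt x - 1) ^+ 2 <= x * ln x.
  have : 2 * x * (1 - (Num.sqrt x)^-1) <= x * ln x.
    have : 0 < x by []. nra.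
  apply: le_trans; move: sx0 xE; set r := Num.sqrt x => r0 <-.
  rewrite le_eqVlt; apply/orP; left; apply/eqP; field.
  by rewrite gt_eqF.
have h2 : x * (1 + (p - 1) * ln x) <= x `^ p.
  rewrite [in leRHS](_ : p = 1 + (p - 1)); last by ring.
  rewrite powRD; last by rewrite (gt_eqF x0) implybT.
  rewrite powRr1 ?(ltW x0) // ler_wpM2l ?(ltW x0) //.
  rewrite /powR (gt_eqF x0); exact: expR_ge1Dx.
apply: le_trans h2; nra.
Qed.

Lemma powR_ge_linear x y p : 0 <= x -> 0 < y -> 1 <= p ->
  y `^ p + p * y `^ (p - 1) * (x - y) <= x `^ p.
Proof.
move=> x0 y0 p1.
have xy0 : 0 <= x / y by rewrite divr_ge0 // ltW.
have := powR_ge_tangent xy0 p1; have := sqr_ge0 (Num.sqrt (x / y) - 1).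
set S := _ ^+ 2 => S0 h.
have {}h : 1 + p * (x / y - 1) <= (x / y) `^ p by nra.
have yp0 : 0 < y `^ p by rewrite powR_gt0.
have : y `^ p * (1 + p * (x / y - 1)) <= y `^ p * (x / y) `^ p by rewrite ler_pM2l.
rewrite -powRM ?(ltW y0) // mulrCA divff ?gt_eqF // mulr1; apply: le_trans.
rewrite -(@mulr_powRB1 _ y p) ?(ltW y0) //; last lra.
rewrite le_eqVlt; apply/orP; left; apply/eqP; field.
by rewrite gt_eqF.
Qed.

(** With M the mean, s = M (1 + h) and t = M (1 - h): the linear terms of the tangent bounds at 1 +
    h and 1 - h cancel and the quadratic excess is left. Only that of 1 + h is kept, whence 1/12 as
    half of the 1/6 below. *)
Lemma powR_midpoint_gap s t p q : 0 <= s -> 0 <= t -> 1 <= q -> q <= p ->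
  0 < s + t ->
  ((s + t) / 2) `^ p * (1 + (q - 1) / 12 * ((s - t) / (s + t)) ^+ 2) <=
  (s `^ p + t `^ p) / 2.
Proof.
move=> s0 t0 q1 qp st0.
set M := (s + t) / 2; set h := (s - t) / (s + t).
have M0 : 0 < M by rewrite /M; lra.
have sE : s = M * (1 + h) by rewrite /M /h; field; rewrite gt_eqF.
have tE : t = M * (1 - h) by rewrite /M /h; field; rewrite gt_eqF.
have h1 : 0 <= 1 + h by rewrite -(pmulr_rge0 _ M0) -sE.
have h2 : 0 <= 1 - h by rewrite -(pmulr_rge0 _ M0) -tE.
clearbody M h.
rewrite [in leRHS]sE [in leRHS]tE !powRM ?(ltW M0) //.
rewrite -mulrDr -[in leRHS]mulrA ler_pM2l ?powR_gt0 //.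
have a1 := powR_ge_tangent h1 (le_trans q1 qp).
have a2 := powR_ge_tangent h2 (le_trans q1 qp).
have r0 : 0 <= Num.sqrt (1 + h) by rewrite sqrtr_ge0.
have rE : Num.sqrt (1 + h) ^+ 2 = 1 + h by rewrite sqr_sqrtr.
have s2 := sqr_ge0 (Num.sqrt (1 - h) - 1).
move: (_ `^ p) (_ `^ p) a1 a2 => A B a1 a2.
(* h = (r - 1)(r + 1) with r = sqrt (1 + h) <= sqrt 2, so that (r + 1)^2 <= 6. *)
suff k : h ^+ 2 / 6 <= (Num.sqrt (1 + h) - 1) ^+ 2.
  have p0 : 0 <= q - 1 by lra.
  have p1 : 0 <= p - q by lra.
  have : 0 <= (p - q) * (Num.sqrt (1 + h) - 1) ^+ 2 by rewrite mulr_ge0 ?sqr_ge0.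
  have : 0 <= (p - 1) * (Num.sqrt (1 - h) - 1) ^+ 2 by rewrite mulr_ge0 ?sqr_ge0 //; lra.
  have : (q - 1) * (h ^+ 2 / 6) <= (q - 1) * (Num.sqrt (1 + h) - 1) ^+ 2 by rewrite ler_wpM2l.
  lra.
move: r0 rE; set r := Num.sqrt _ => r0 rE.
have -> : h = r ^+ 2 - 1 by lra.
have : r ^+ 2 <= 2 by lra.
move=> r2.
have -> : (r ^+ 2 - 1) ^+ 2 = (r - 1) ^+ 2 * (r + 1) ^+ 2 by ring.
have rr : (r + 1) ^+ 2 <= 6.
  have : r <= 3/2 by rewrite leNgt; apply/negP => rl; nra.
  nra.
have := sqr_ge0 (r - 1); nra.
Qed.

Lemma powR_midpoint s t p : 0 <= s -> 0 <= t -> 1 <= p ->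
  ((s + t) / 2) `^ p <= (s `^ p + t `^ p) / 2.
Proof.
move=> s0 t0 p1; have [st0|] := ltP 0 (s + t).
  by have := powR_midpoint_gap s0 t0 (lexx 1) p1 st0; rewrite subrr !mul0r addr0 mulr1.
move=> st0; have [-> ->] : s = 0 /\ t = 0 by split; lra.
by rewrite addr0 mul0r powR0 ?addr0 ?mul0r //; lra.
Qed.

(* The unit balls of the powers p >= q are uniformly convex in p; the
   parallelogram identity of the Euclidean norm is all that is used of it. *)
Lemma powR_uniform_convexity q e : 1 < q -> 0 < e <= 1 ->
  exists2 K, 0 <= K & forall p s t m d, q <= p ->
    0 <= s -> 0 <= t -> 0 <= m -> 0 <= d ->
    m ^+ 2 + d ^+ 2 = (s ^+ 2 + t ^+ 2) / 2 ->
    m <= (s + t) / 2 -> d <= (s + t) / 2 ->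
    d `^ p <= K * ((s `^ p + t `^ p) / 2 - m `^ p) + e * ((s `^ p + t `^ p) / 2).
Proof.
(* [c] is the relative gap of [powR_midpoint_gap] at h^2 = e^2 / 2. *)
move=> q1 /andP[e0 e1]; pose c := (q - 1) * e ^+ 2 / 24.
have e20 : 0 < e ^+ 2 by rewrite exprn_gt0.
have e21 : e ^+ 2 <= 1 by rewrite expr_le1 // ltW.
have c0 : 0 < c by rewrite /c divr_gt0 // mulr_gt0 //; lra.
have K1 : 0 < (1 + c) / c by rewrite divr_gt0 //; lra.
have K2 : 0 < 4 / e ^+ 2 by rewrite divr_gt0.
(* One summand for each of the two cases with d > e M: there the mean A of the powers is at most a
   multiple of A - m^p, while d^p <= M^p <= A. *)
exists ((1 + c) / c + 4 / e ^+ 2); first lra.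
move=> p s t m d qp s0 t0 m0 d0 md mM dM.
have p1 : 1 <= p by lra.
have MA := powR_midpoint s0 t0 p1.
have M0 : 0 <= (s + t) / 2 by lra.
have mMp : m `^ p <= ((s + t) / 2) `^ p by rewrite ge0_ler_powR ?nnegrE //; lra.
have dMp : d `^ p <= ((s + t) / 2) `^ p by rewrite ge0_ler_powR ?nnegrE //; lra.
have gap := powR_midpoint_gap s0 t0 (ltW q1) qp.
have Mp0 : 0 <= ((s + t) / 2) `^ p := powR_ge0 _ _.
set A := (s `^ p + t `^ p) / 2 in MA gap *.
have mA : 0 <= A - m `^ p by lra.
have eA : 0 <= e * A by apply: mulr_ge0; lra.
have KA1 : 0 <= (1 + c) / c * (A - m `^ p) by apply: mulr_ge0 => //; lra.
have KA2 : 0 <= 4 / e ^+ 2 * (A - m `^ p) by apply: mulr_ge0 => //; lra.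
rewrite [X in _ <= X + _]mulrDl.
(* If d <= e M, then d^p <= e^p M^p <= e A because e <= 1 <= p, and the last term suffices. *)
have [deM|deM] := leP d (e * ((s + t) / 2)).
  have : d `^ p <= (e * ((s + t) / 2)) `^ p.
    by rewrite ge0_ler_powR ?nnegrE //; [lra|apply: mulr_ge0 => //; lra].
  rewrite powRM //; last lra.
  have ep : e `^ p <= e by apply: ge1r_powR => //; rewrite e0 e1.
  have : e `^ p * ((s + t) / 2) `^ p <= e * A.
    by apply: ler_pM => //; exact: powR_ge0.
  lra.
have st0 : 0 < s + t.
  rewrite lt_neqAle addr_ge0 // andbT eq_sym; apply/eqP => st.
  by move: deM dM; rewrite st mul0r mulr0; lra.
have {}gap := gap st0.
set M := (s + t) / 2 in mM dM MA M0 mMp dMp gap Mp0 deM.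
set h := (s - t) / (s + t) in gap.
have hM : h * M = (s - t) / 2 by rewrite /h /M; field; rewrite gt_eqF.
have mE : m ^+ 2 = M ^+ 2 + (h * M) ^+ 2 - d ^+ 2 by rewrite hM /M; lra.
have M0' : 0 < M by rewrite /M; lra.
have d2 : (e * M) ^+ 2 <= d ^+ 2.
  by rewrite ler_sqr ?nnegrE ?(ltW deM) // mulr_ge0 // ltW.
(* Either s and t differ much relative to their mean, and the gap gives A >= (1 + c) M^p, or they
   are close and the directions of the vectors must differ. *)
clearbody h M; have [hl|hl] := leP (e ^+ 2 / 2) (h ^+ 2).
  have g : M `^ p * (1 + c) <= A.
    apply: le_trans gap; apply: ler_wpM2l => //; rewrite lerD2l /c.
    have := @ler_wpM2l _ ((q - 1) / 12) _ _ _ hl; move=> /(_ ltac:(lra)); lra.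
  suff : A <= (1 + c) / c * (A - m `^ p) by lra.
  have -> : (1 + c) / c * (A - m `^ p) = ((1 + c) * (A - m `^ p)) / c.
    by field; rewrite gt_eqF.
  rewrite ler_pdivlMr //.
  have : (1 + c) * m `^ p <= (1 + c) * M `^ p by rewrite ler_wpM2l //; lra.
  lra.
(* By the parallelogram identity m^2 = M^2 + (h M)^2 - d^2 <= (1 - e^2 / 2) M^2, which is at most
   the square of the right-hand side: the midpoint itself is short. *)
have m2 : m <= (1 - e ^+ 2 / 4) * M.
  rewrite -(@ler_sqr _ m) ?nnegrE //; last by apply: mulr_ge0 => //; lra.
  have M2 : 0 <= M ^+ 2 := sqr_ge0 _.
  have := ler_wpM2r M2 (ltW hl); rewrite exprMn in d2; rewrite exprMn in mE.
  have : 0 <= (e ^+ 2 / 4) ^+ 2 * M ^+ 2 by rewrite mulr_ge0 // sqr_ge0.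
  rewrite mE exprMn; lra.
have : m `^ p <= ((1 - e ^+ 2 / 4) * M) `^ p.
  by rewrite ge0_ler_powR ?nnegrE //; [lra|apply: mulr_ge0 => //; lra].
rewrite powRM //; last lra.
have kp : (1 - e ^+ 2 / 4) `^ p <= 1 - e ^+ 2 / 4 by apply: ge1r_powR => //; lra.
have : (1 - e ^+ 2 / 4) `^ p * M `^ p <= (1 - e ^+ 2 / 4) * A.
  by apply: ler_pM => //; exact: powR_ge0.
move=> a1 a2; suff : A <= 4 / e ^+ 2 * (A - m `^ p) by lra.
rewrite mulrAC ler_pdivlMr //; lra.
Qed.

(** Beyond [th] the factor (a / th)^(q - 1) is at least 1. Integrated over a set of finite measure,
    this stands in for Hölder's inequality. *)
Lemma le_eps_powR th q a : 0 < th -> 1 <= q -> 0 <= a ->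
  a <= th + a `^ q / th `^ (q - 1).
Proof.
move=> th0 q1 a0; have T0 : 0 < th `^ (q - 1) by rewrite powR_gt0.
have [ath|ath] := leP a th.
  by rewrite (le_trans ath) // lerDl divr_ge0 ?powR_ge0.
suff : a <= a `^ q / th `^ (q - 1) by lra.
rewrite ler_pdivlMr // -(@mulr_powRB1 _ a q) //; last lra.
by rewrite ler_wpM2l // ge0_ler_powR ?nnegrE //; lra.
Qed.

Lemma powR2_ge p : 1 <= p -> p <= 2 `^ p.
Proof.
move=> p1; have := @powR_ge_linear 2 1 p ltac:(lra) ltac:(lra) p1.
by rewrite !powR1; lra.
Qed.

(** Since p <= 2^p, halving the argument pays for the weight 1 / p, however large p is. *)
Lemma powR_half_le a p : 0 <= a -> 1 <= p -> (a / 2) `^ p <= a `^ p / p.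
Proof.
move=> a0 p1; rewrite powRM ?invr_ge0 // ler_wpM2l ?powR_ge0 //.
rewrite -[2^-1]powR_inv1 // -powRrM mulN1r powRN lef_pV2 ?posrE ?powR_gt0 //; last lra.
exact: powR2_ge.
Qed.

(** The weight 1 / p has no positive lower bound, so large exponents are treated apart. For p > M
    and a > 2 the factor a^(p - q) >= 2^(p - q) makes up for p; for a <= 2 only 2^q is claimed, on a
    set that will be small. For p <= M, either a^q <= th or a^(p - q) is bounded below. *)
Lemma powR_le_modular q M th : 1 <= q -> q <= M -> 0 < th <= 1 ->
  exists2 K, 0 <= K & forall a p, 0 <= a -> q <= p ->
    a `^ q <= th + 2 `^ q * (M < p)%R%:R + K * (a `^ p / p).
Proof.
move=> q1 qM /andP[th0 th1]; pose al := th `^ q^-1.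
have q0 : 0 < q by lra.
have al0 : 0 < al by rewrite powR_gt0.
have al1 : al <= 1.
  have := @ge0_ler_powR R q^-1 _ th 1; rewrite powR1; apply; rewrite ?nnegrE ?invr_ge0; lra.
have alq : al `^ q = th by rewrite /al -powRrM mulVf ?gt_eqF // powRr1 // ltW.
(* A lower bound of a^(p - q) for a > al and p <= M, because al <= 1. *)
pose B := al `^ (M - q).
have B0 : 0 < B by rewrite powR_gt0.
have C0 : 0 < 2 `^ q :> R by rewrite powR_gt0.
have MB0 : 0 < M / B by rewrite divr_gt0 //; lra.
exists (2 `^ q + M / B); first lra.
move=> a p a0 qp.
have p0 : 0 < p by lra.
have ap0 : 0 <= a `^ p / p by rewrite divr_ge0 ?powR_ge0 // ltW.
have X1 : 0 <= 2 `^ q * (a `^ p / p) by rewrite mulr_ge0 // ltW.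
have X2 : 0 <= M / B * (a `^ p / p) by rewrite mulr_ge0 // ltW.
rewrite [X in _ <= _ + X]mulrDl.
have aE : 0 < a -> a `^ q = a `^ p / a `^ (p - q).
  move=> a0'; have -> : a `^ p = a `^ q * a `^ (p - q).
    by rewrite -powRD; [congr (_ `^ _); ring|rewrite (gt_eqF a0') implybT].
  by rewrite mulfK // gt_eqF // powR_gt0.
have [Mp|pM] := ltP M p; rewrite ?mulr1 ?mulr0 ?addr0.
  have [a2|a2] := leP a 2.
    have : a `^ q <= 2 `^ q by rewrite ge0_ler_powR ?nnegrE //; lra.
    lra.
  suff : a `^ q <= 2 `^ q * (a `^ p / p) by lra.
  have a00 : 0 < a by lra.
  rewrite aE // mulrCA ler_wpM2l ?powR_ge0 //.
  rewrite ler_pdivlMr // mulrC ler_pdivrMr ?powR_gt0 //.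
  have h1 : 2 `^ (p - q) <= a `^ (p - q) by rewrite ge0_ler_powR ?nnegrE //; lra.
  have h2 : p <= 2 `^ q * 2 `^ (p - q).
    rewrite -powRD; last by rewrite implybE pnatr_eq0 orbT.
    by rewrite addrC subrK powR2_ge //; lra.
  by apply: le_trans h2 _; rewrite ler_wpM2l // ltW.
have [aal|aal] := leP a al.
  have : a `^ q <= al `^ q by rewrite ge0_ler_powR ?nnegrE //; lra.
  rewrite alq; lra.
suff : a `^ q <= M / B * (a `^ p / p) by lra.
have a00 : 0 < a by lra.
rewrite aE // mulrCA ler_wpM2l ?powR_ge0 //.
rewrite mulrAC ler_pdivlMr // mulrC ler_pdivrMr ?powR_gt0 //.
have h1 : al `^ (p - q) <= a `^ (p - q) by rewrite ge0_ler_powR ?nnegrE //; lra.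
have h2 : B <= al `^ (p - q) by apply: ger_powR; [rewrite al0|lra].
have h3 : 1 <= M / p by rewrite ler_pdivlMr // mul1r.
rewrite -[B]mul1r; apply: ler_pM => //; [exact: ltW|lra].
Qed.

End powR_inequalities.

(** * The Euclidean norm *)

Section euclid_norm.
Variables (R : realType) (n : nat).
Implicit Types a b v : 'rV[R]_n.

Lemma euclid_norm_ge0 v : 0 <= euclid_norm v.
Proof. exact: sqrtr_ge0. Qed.

Lemma euclid_norm_sqr v : euclid_norm v ^+ 2 = \sum_(i < n) v ord0 i ^+ 2.
Proof. by rewrite sqr_sqrtr // sumr_ge0 // => i _; exact: sqr_ge0. Qed.

Lemma euclid_norm0 : euclid_norm (0 : 'rV[R]_n) = 0.
Proof.
rewrite /euclid_norm big1 ?sqrtr0 // => i _.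
by rewrite mxE expr0n.
Qed.

Lemma euclid_normZ (c : R) v : euclid_norm (c *: v) = `|c| * euclid_norm v.
Proof.
rewrite /euclid_norm -sqrtr_sqr -sqrtrM ?sqr_ge0 //; congr Num.sqrt.
by rewrite mulr_sumr; apply: eq_bigr => i _; rewrite mxE exprMn.
Qed.

Lemma coord_le_euclid_norm v i : `|v ord0 i| <= euclid_norm v.
Proof.
rewrite /euclid_norm -sqrtr_sqr ler_sqrt ?sumr_ge0 // => [|j _]; last exact: sqr_ge0.
by rewrite (bigD1 i) //= lerDl sumr_ge0 // => j _; exact: sqr_ge0.
Qed.

Lemma euclid_norm_parallelogram a b :
  euclid_norm (a + b) ^+ 2 + euclid_norm (a - b) ^+ 2 =
  2 * (euclid_norm a ^+ 2 + euclid_norm b ^+ 2).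
Proof.
rewrite !euclid_norm_sqr -!big_split /= mulr_sumr; apply: eq_bigr => i _.
by rewrite !mxE; ring.
Qed.

(** Young's inequality bounds the square of the left side by (1 + l) |a|^2 + (1 + 1 / l) |b|^2 for
    every l > 0; at l = |b| / |a| this is (|a| + |b|)^2. *)
Lemma euclid_normD a b : euclid_norm (a + b) <= euclid_norm a + euclid_norm b.
Proof.
have a0 := euclid_norm_ge0 a; have b0 := euclid_norm_ge0 b.
rewrite -(@ler_sqr _ (euclid_norm _)) ?nnegrE ?euclid_norm_ge0 ?addr_ge0 //.
rewrite euclid_norm_sqr.
have key (l : R) : 0 < l -> \sum_i (a + b) ord0 i ^+ 2 <=
    (1 + l) * euclid_norm a ^+ 2 + (1 + l^-1) * euclid_norm b ^+ 2.
  move=> l0; rewrite !euclid_norm_sqr !mulr_sumr -big_split /=.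
  apply: ler_sum => i _; rewrite mxE; set x := a _ _; set y := b _ _.
  have : 0 <= (l * x - y) ^+ 2 / l by rewrite divr_ge0 ?sqr_ge0 // ltW.
  have -> : (l * x - y) ^+ 2 / l = l * x ^+ 2 - 2 * x * y + l^-1 * y ^+ 2.
    by field; rewrite gt_eqF.
  lra.
have [a00|a00] := eqVneq (euclid_norm a) 0.
  have az i : a ord0 i = 0.
    by apply/normr0_eq0/le_anti; rewrite normr_ge0 andbT -a00 coord_le_euclid_norm.
  rewrite a00 add0r euclid_norm_sqr; apply: ler_sum => i _.
  by rewrite mxE az add0r.
have [b00|b00] := eqVneq (euclid_norm b) 0.
  have bz i : b ord0 i = 0.
    by apply/normr0_eq0/le_anti; rewrite normr_ge0 andbT -b00 coord_le_euclid_norm.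
  rewrite b00 addr0 euclid_norm_sqr; apply: ler_sum => i _.
  by rewrite mxE bz addr0.
apply: le_trans (key (euclid_norm b / euclid_norm a) _) _.
  by rewrite divr_gt0 // lt_neqAle eq_sym ?a00 ?b00.
rewrite le_eqVlt; apply/orP; left; apply/eqP; field.
by rewrite a00.
Qed.

End euclid_norm.

(** * Boxes and Lebesgue measure on R^n *)

Section boxes.
Variables (R : realType) (n : nat).
Implicit Types (a b c v : 'rV[R]_n) (U : set 'rV[R]_n).

Definition obox a b : set 'rV[R]_n :=
  [set v | forall i, a ord0 i < v ord0 i < b ord0 i].

Definition cbox a b : set 'rV[R]_n :=
  [set v | forall i, a ord0 i <= v ord0 i <= b ord0 i].

Definition orthant c : set 'rV[R]_n := [set v | forall i, c ord0 i < v ord0 i].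

Lemma sub_obox_cbox a b : obox a b `<=` cbox a b.
Proof. by move=> v ab i; have /andP[/ltW-> /ltW->] := ab i. Qed.

Lemma compact_cbox a b : compact (cbox a b).
Proof.
have := @rV_compact R n (fun i => `[a ord0 i, b ord0 i]%classic) _.
move=> /(_ ltac:(by move=> i; exact: segment_compact)).
by congr compact; apply/seteqP; split => v ab i; have := ab i; rewrite /= in_itv.
Qed.

Lemma measurable_coord_preimage (i : 'I_n) (A : set (measurableTypeR R)) :
  measurable A -> measurable [set v : 'rV[R]_n | A (v ord0 i)].
Proof. by move=> mA; have := measurable_coord i measurableT mA; rewrite setTI. Qed.

Lemma measurable_obox a b : measurable (obox a b).
Proof.
rewrite (_ : obox a b = \bigcap_(i in [set: 'I_n]) [set v | `]a ord0 i, b ord0 i[%classic (v ord0 i)]).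
  apply: fin_bigcap_measurable; first exact: finite_finset.
  by move=> i _; exact: measurable_coord_preimage.
by apply/seteqP; split=> v ab i; have := ab i; rewrite /= in_itv/=; [|exact].
Qed.

Lemma measurable_cbox a b : measurable (cbox a b).
Proof.
rewrite (_ : cbox a b = \bigcap_(i in [set: 'I_n]) [set v | `[a ord0 i, b ord0 i]%classic (v ord0 i)]).
  apply: fin_bigcap_measurable; first exact: finite_finset.
  by move=> i _; exact: measurable_coord_preimage.
by apply/seteqP; split=> v ab i; have := ab i; rewrite /= in_itv/=; [|exact].
Qed.

Lemma measurable_orthant c : measurable (orthant c).
Proof.
rewrite (_ : orthant c = \bigcap_(i in [set: 'I_n]) [set v | `]c ord0 i, +oo[%classic (v ord0 i)]).
  apply: fin_bigcap_measurable; first exact: finite_finset.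
  by move=> i _; exact: measurable_coord_preimage.
by apply/seteqP; split=> v ab i; have := ab i; rewrite /= in_itv/= andbT; [|exact].
Qed.

Lemma open_ball_box U x : open U -> U x ->
  exists2 e : R, 0 < e & cbox (x - const_mx e) (x + const_mx e) `<=` U.
Proof.
move=> oU Ux; have /nbhs_ballP[e /= e0 eU] : nbhs x U by exact: open_nbhs_nbhs.
exists (e / 2); first by rewrite divr_gt0.
move=> v xv; apply: eU; split=> // i j; rewrite ord1.
have := xv j; rewrite !mxE /ball/= => h.
by rewrite ltr_distl; apply/andP; split; lra.
Qed.

Definition rat_obox (cd : 'rV[rat]_n * 'rV[rat]_n) :=
  obox (map_mx ratr cd.1) (map_mx ratr cd.2).

Definition rat_cbox (cd : 'rV[rat]_n * 'rV[rat]_n) :=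
  cbox (map_mx ratr cd.1) (map_mx ratr cd.2).

Lemma open_rat_box U x : open U -> U x ->
  exists2 cd, rat_obox cd x & rat_cbox cd `<=` U.
Proof.
move=> oU Ux; have [e e0 eU] := open_ball_box oU Ux.
have xe i : x ord0 i < x ord0 i + e by rewrite ltrDl.
have ex i : x ord0 i - e < x ord0 i by rewrite gtrBl.
have /choice[c cP] : forall i, exists q : rat, ratr q \in `]x ord0 i - e, x ord0 i[.
  by move=> i; have [q qP] := rat_in_itvoo (ex i); exists q.
have /choice[d dP] : forall i, exists q : rat, ratr q \in `]x ord0 i, x ord0 i + e[.
  by move=> i; have [q qP] := rat_in_itvoo (xe i); exists q.
exists (\row_i c i, \row_i d i).
  move=> i; rewrite !mxE /=; have := cP i; have := dP i; rewrite !in_itv/=.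
  by move=> /andP[-> _] /andP[_ ->].
move=> v vP; apply: eU => i; have := vP i; rewrite !mxE.
have := cP i; have := dP i; rewrite !in_itv/=.
by move=> /andP[d1 d2] /andP[c1 c2] h; lra.
Qed.

(** The index runs over codes of pairs of rational corners, with [set0] at all other codes. The
    closed box is required to lie in [U] so that bumps on the open one are test functions. *)
Definition inner_rat_box U (k : nat) : set 'rV[R]_n :=
  if unpickle k is Some cd then
    if `[< rat_cbox cd `<=` U >] then rat_obox cd else set0
  else set0.

Lemma open_inner_rat_box U : open U -> U = \bigcup_k inner_rat_box U k.
Proof.
move=> oU; apply/seteqP; split => x.
  move=> Ux; have [cd cdx cdU] := open_rat_box oU Ux.
  by exists (pickle cd) => //; rewrite /inner_rat_box pickleK asboolT.
case=> k _; rewrite /inner_rat_box; case: unpickle => [cd|//].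
by case: asboolP => // cdU cdx; apply: cdU; exact: sub_obox_cbox.
Qed.

Lemma measurable_open_rV U : open U -> measurable U.
Proof.
move=> oU; rewrite (open_inner_rat_box oU); apply: bigcupT_measurable => k.
rewrite /inner_rat_box; case: unpickle => [cd|]; last exact: measurable0.
by case: asboolP => _; [exact: measurable_obox|exact: measurable0].
Qed.

Lemma measurable_closed_rV U : closed U -> measurable U.
Proof.
move=> cU; rewrite -[U]setCK; apply: measurableC; apply: measurable_open_rV.
exact: closed_openC.
Qed.

Lemma measurable_compact_rV U : compact U -> measurable U.
Proof. by move=> cU; apply: measurable_closed_rV; exact: (compact_closed (@norm_hausdorff _ _)). Qed.

Lemma measurable_fun_within_open U (f : 'rV[R]_n -> R) : open U ->
  {within U, continuous f} -> measurable_fun U (f : _ -> measurableTypeR R).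
Proof.
move=> oU cf; apply: (@measurability _ _ _ _ _ _ (@RGenOInfty.G R)).
  exact: RGenOInfty.measurableE.
move=> _ [_ [x ->] <-]; apply: measurable_open_rV.
rewrite openE => v [Uv /= fv].
have cv : {for v, continuous f}.
  by move: cf; rewrite continuous_open_subspace // => /(_ v); apply; rewrite inE.
have : \forall w \near v, x < f w.
  move: fv; rewrite in_itv/= andbT => fv.
  have h : nbhs (f v) [set y | x < y] by apply: open_nbhs_nbhs; split => //; exact: open_gt.
  exact: (cv _ h).
move=> h; have {}oU : nbhs v U by exact: open_nbhs_nbhs.
by apply: filterS2 oU h => w Uw xw; split => //=; rewrite in_itv/= andbT.
Qed.

Lemma continuous_measurable_rV (f : 'rV[R]_n -> R) : continuous f ->
  measurable_fun [set: 'rV[R]_n] (f : _ -> measurableTypeR R).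
Proof.
move=> cf; apply: measurable_fun_within_open; first exact: openT.
exact: continuous_subspaceT.
Qed.

Lemma bounded_sub_cbox (A : set 'rV[R]_n) : bounded_set A ->
  exists2 M : R, 0 < M & A `<=` cbox (const_mx (- M)) (const_mx M).
Proof.
move=> [M [Mr AM]]; exists (`|M| + 1); first by rewrite ltr_pwDr.
have MM : M < `|M| + 1 by rewrite (le_lt_trans (real_ler_norm Mr)) // ltrDl.
move=> v Av i; rewrite !mxE -ler_norml.
apply: le_trans (AM _ MM v Av).
rewrite [leRHS]/Num.norm /= mx_normrE; apply/bigmax_geP; right => /=.
by exists (ord0, i).
Qed.

End boxes.

(** Orthants are stable under intersection, unlike the coordinate preimages that generate the
    sigma-algebra; this makes them fit for Dynkin's argument. *)
Lemma orthant_sigma_algebra (R : realType) n (A : set 'rV[R]_n) :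
  measurable A -> <<s range (@orthant R n) >> A.
Proof.
pose G := range (@orthant R n).
suff : g_sigma_preimage (fun (i : 'I_n) (v : 'rV[R]_n) => v ord0 i : measurableTypeR R)
  `<=` <<s G >> by exact.
apply: smallest_sub; first exact: smallest_sigma_algebra.
move=> B; rewrite -bigcup_seq /= => -[i _ [Y mY <-]]; rewrite setTI.
have : measurable_fun [set: g_sigma_algebraType G] (fun v : 'rV[R]_n => v ord0 i : measurableTypeR R).
  apply: (@measurability _ _ _ _ _ _ (@RGenOInfty.G R)).
    exact: RGenOInfty.measurableE.
  move=> _ [_ [x ->] <-]; rewrite setTI.
  (* A half-space is a countable union of orthants: the other coordinates are only asked to exceed
     -k, with k arbitrary. *)
  rewrite (_ : _ @^-1` _ = \bigcup_k orthant (\row_j (if j == i then x else - k%:R))).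
    by apply: bigcupT_measurable => k; apply: sub_sigma_algebra; exists (\row_j (if j == i then x else - k%:R)).
  apply/seteqP; split => v /=.
    rewrite in_itv/= andbT => xv.
    exists (Num.truncn (\sum_j `|v ord0 j|)).+1 => // j; rewrite mxE.
    case: eqVneq => [->//|ji]; rewrite ltrNl.
    apply: le_lt_trans (truncnS_gt _).
    rewrite (bigD1 j) //=; apply: le_trans (ler_wpDr _ (lexx _)).
      by rewrite ler_normr lexx orbT.
    by rewrite sumr_ge0.
  by case=> k _ /(_ i); rewrite mxE eqxx in_itv/= andbT.
by move=> /(_ measurableT Y mY); rewrite setTI.
Qed.

Lemma lebesgue_rV_cbox_lty (R : realType) n (a b : 'rV[R]_n) :
  (lebesgue_rV (cbox a b) < +oo)%E.
Proof.
elim: n a b => [|n IH] a b.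
  by rewrite /= diracE ltry.
rewrite /= /pushforward.
rewrite (_ : _ @^-1` _ = `[a ord0 ord0, b ord0 ord0]%classic `*`
   cbox (rsubmx (a : 'rV_(1 + n))) (rsubmx (b : 'rV_(1 + n)))).
  rewrite product_measure1E //; last exact: measurable_cbox.
  apply: lte_mul_pinfty; [exact: measure_ge0| |exact: IH].
  rewrite [X in X \is a _](@lebesgue_measure_itv R `[a ord0 ord0, b ord0 ord0]).
  by rewrite /=; case: ifP.
apply/seteqP; split => -[x v] /=.
  move=> xv; split.
    have := xv ord0; rewrite in_itv/= /cons_rV/=.
    have -> : (ord0 : 'I_(1 + n)) = lshift n (ord0 : 'I_1) by exact: val_inj.
    by rewrite (@row_mxEl _ 1 1 n) mxE.
  by move=> i; have := xv (rshift 1 i); rewrite /cons_rV (@row_mxEr _ 1 1 n) !mxE.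
move=> [xab vab] i; rewrite /cons_rV.
have [j ->|j ->] := @split_ordP 1 n i.
  rewrite (@row_mxEl _ 1 1 n) mxE (ord1 j); move: xab; rewrite in_itv/=.
  by have <- : lshift n (ord0 : 'I_1) = (ord0 : 'I_n.+1) by exact: val_inj.
by have := vab j; rewrite (@row_mxEr _ 1 1 n) !mxE.
Qed.

Lemma lebesgue_rV_bounded_lty (R : realType) n (A : set 'rV[R]_n) :
  measurable A -> bounded_set A -> (lebesgue_rV A < +oo)%E.
Proof.
move=> mA /bounded_sub_cbox[M _ AM].
apply: le_lt_trans (lebesgue_rV_cbox_lty (const_mx (- M)) (const_mx M)).
by apply: le_measure; rewrite ?inE //; exact: measurable_cbox.
Qed.

(** * Smooth cutoff functions *)

Section smooth_line.
Variable R : realType.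
Implicit Types (f g b : R -> R) (t x : R).

(** The powers of 1 / t are included because the derivatives of exp(-1 / t) are combinations of
    these functions. *)
Definition exp_inv (k : nat) t : R := if 0 < t then t^-1 ^+ k * expR (- t^-1) else 0.

Lemma exp_inv_ge0 k t : 0 <= exp_inv k t.
Proof.
rewrite /exp_inv; case: ifP => // t0.
by rewrite mulr_ge0 ?expR_ge0 // exprn_ge0 // invr_ge0 ltW.
Qed.

(** From x^(k + 2) / (k + 2)! <= exp x at x = 1 / t. A quadratic bound is what makes the difference
    quotient at 0 tend to 0. *)
Lemma exp_inv_le k t : exp_inv k t <= (k.+2)`!%:R * t ^+ 2.
Proof.
rewrite /exp_inv; case: ifPn => [t0|_]; last by rewrite mulr_ge0 // sqr_ge0.
have x0 : 0 <= t^-1 by rewrite invr_ge0 ltW.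
have e0 : 0 < expR t^-1 by exact: expR_gt0.
have := expR_ge1Dxn k.+1 x0 => h.
have {}h : t^-1 ^+ k.+2 <= k.+2`!%:R * expR t^-1.
  rewrite mulrC -ler_pdivrMr ?ltr0n ?fact_gt0 //.
  by apply: le_trans h; rewrite lerDr.
rewrite expRN ler_pdivrMr //.
have t2 : 0 < t ^+ 2 by rewrite exprn_gt0.
have -> : t^-1 ^+ k = t ^+ 2 * t^-1 ^+ k.+2.
  by rewrite !exprS; field; rewrite gt_eqF.
rewrite [leRHS]mulrAC [leRHS]mulrC; exact: ler_wpM2l (ltW t2) _ _ h.
Qed.

Lemma is_derive_exp_inv k t :
  is_derive t 1 (exp_inv k) (exp_inv k.+2 t - k%:R * exp_inv k.+1 t).
Proof.
have [t0|t0|<-] := ltgtP 0 t.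
- rewrite /exp_inv t0.
  apply: (@near_eq_is_derive _ _ _ (fun x => x^-1 ^+ k * expR (- x^-1))).
    have : \forall x \near t, 0 < x by apply: open_nbhs_nbhs; split => //; exact: open_gt.
    by apply: filterS => x x0; rewrite x0.
  have d1 : is_derive t 1 (fun x : R => x^-1) (- t ^- 2).
    have := @is_deriveV R id t 1 1; rewrite scaler1; apply; first by rewrite gt_eqF.
  have d2 : is_derive t 1 (fun x : R => expR (- x^-1)) (expR (- t^-1) * t ^- 2).
    apply: (@is_derive1_comp _ expR (fun x => - x^-1) t (expR (- t^-1))).
    by have := @is_deriveN _ _ _ _ t 1 _ d1; rewrite opprK.
  have d3 := @is_deriveX _ _ (fun x => x^-1) k t 1 _ d1.
  rewrite (_ : (fun x => x^-1) ^+ k = (fun x => x^-1 ^+ k)) in d3; last first.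
    by apply/funext => x; rewrite exprfctE.
  apply: (is_derive_eq (is_deriveM d3 d2)).
  rewrite /GRing.scale /=; case: k {d3} => [|k].
    by rewrite !mul0r subr0 -!exprVn; ring.
  by rewrite /= -!exprVn !exprS; move: (k.+1%:R : R) => c; ring.
- have tn : ~~ (0 < t) by rewrite -leNgt ltW.
  rewrite /exp_inv (negbTE tn) mulr0 subr0.
  apply: (@near_eq_is_derive _ _ _ (cst 0)).
  have : \forall x \near t, x < 0 by apply: open_nbhs_nbhs; split => //; exact: open_lt.
  by apply: filterS => x x0; rewrite ltNge (ltW x0).
have -> : exp_inv k.+2 (0 : R) - k%:R * exp_inv k.+1 (0 : R) = 0.
  by rewrite /exp_inv ltxx mulr0 subr0.
have lim0 : (fun h : R => h^-1 *: ((exp_inv k \o shift 0) (h *: 1) - exp_inv k 0)) @ 0^' --> (0 : R).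
  apply/cvgr0Pnorm_lt => e e0.
  have M0 : 0 < (k.+2)`!%:R :> R by rewrite ltr0n fact_gt0.
  have : \forall h \near (0 : R)^', `|h| < e / (k.+2)`!%:R /\ h != 0.
    exists (e / (k.+2)`!%:R) => /=; first exact: divr_gt0.
    by move=> h /=; rewrite sub0r normrN.
  apply: filterS => h [he h0] /=.
  rewrite /exp_inv ltxx subr0 addr0 -/(exp_inv k _) /GRing.scale/= mulr1.
  rewrite normrM normfV ger0_norm ?exp_inv_ge0 // mulrC.
  rewrite ltr_pdivrMr ?normr_gt0 //.
  apply: le_lt_trans (exp_inv_le _ _) _.
  rewrite -real_normK ?num_real // expr2 mulrA ltr_pM2r ?normr_gt0 //.
  by rewrite mulrC -ltr_pdivlMr.
by apply: DeriveDef; [apply/cvg_ex; exists 0|exact/cvg_lim].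
Qed.

(* An inductively generated class closed under differentiation, so that all its
   members are smooth; the last constructor admits the primitives that turn a
   bump into a step. *)
Inductive smooth1 : (R -> R) -> Prop :=
| smooth1_exp_inv k : smooth1 (exp_inv k)
| smooth1_cst c : smooth1 (cst c)
| smooth1_affine (a c : R) f : smooth1 f -> smooth1 (fun t => f (a * t + c))
| smooth1D f g : smooth1 f -> smooth1 g -> smooth1 (f \+ g)
| smooth1M f g : smooth1 f -> smooth1 g -> smooth1 (f \* g)
| smooth1_primitive f g : smooth1 g -> (forall t, is_derive t 1 f (g t)) ->
    smooth1 f.

Lemma smooth1_derive f : smooth1 f ->
  exists2 g, smooth1 g & forall t, is_derive t 1 f (g t).
Proof.
elim=> {f} [k|c|a c f _ [g sg fg]|f g sf [f' sf' ff'] sg [g' sg' gg']|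
  f g sf [f' sf' ff'] sg [g' sg' gg']|f g sg _ fg].
- exists (exp_inv k.+2 \+ (cst (- k%:R) \* exp_inv k.+1)).
    by do 2 constructor; constructor.
  by move=> t; apply: is_derive_eq; [exact: is_derive_exp_inv|rewrite /= mulNr].
- by exists (cst 0); [constructor|move=> t; exact: is_derive_cst].
- exists (cst a \* (fun t => g (a * t + c))); first by do 2 constructor.
  move=> t /=; rewrite mulrC.
  apply: (@is_derive1_comp _ f (fun t => a * t + c)).
  have -> : (fun t => a * t + c) = a *: (id : R -> R) + cst c by apply/funext.
  apply: is_derive_eq.
  by rewrite addr0 /GRing.scale /= mulr1.
- by exists (f' \+ g'); [constructor|move=> t; exact: is_deriveD].
- exists ((f \* g') \+ (g \* f')); first by do 2 constructor.
  by move=> t; exact: is_deriveM.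
- by exists g.
Qed.

Lemma smooth1_continuous f : smooth1 f -> continuous f.
Proof.
move=> /smooth1_derive[g _ fg] t.
by apply/differentiable_continuous/derivable1_diffP; case: (fg t).
Qed.

Lemma is_derive_primitive b (l r : R) : continuous b ->
    (forall t, ~~ (l <= t <= r) -> b t = 0) ->
  forall t, is_derive t 1
    (fun x => \int[@lebesgue_measure R]_(s in `]-oo, x]) b s) (b t).
Proof.
move=> cb b0 t.
have bi : (@lebesgue_measure R).-integrable setT (EFin \o b).
  have -> : EFin \o b = (EFin \o b) \_ `[l, r].
    apply/funext => x; rewrite patchE; case: ifPn => //.
    by rewrite notin_setE /= in_itv /= => /negP/b0 ->.
  rewrite -integrable_mkcond //; apply: continuous_compact_integrable.
    exact: segment_compact.
  exact: continuous_subspaceT.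
have t1 : t < t + 1 by rewrite ltrDl.
have [||h1 h2] := @continuous_FTC1 R b -oo%O t (t + 1) t1 _ _ (cb t).
- exact: integrableS bi.
- by rewrite /Order.lt /= num_real.
by split; [exact: h1|rewrite -derive1E; exact: h2].
Qed.

End smooth_line.

(** * Smooth steps and bumps on the line *)

Section smooth_step.
Variable R : realType.
Implicit Types (a b c k t : R).

(** This is exp(-1 / t) exp(-1 / (1 - t)) on ]0, 1[ and 0 elsewhere; [-1 * t + 1] is spelled so as
    to match the constructor [smooth1_affine]. *)
Definition step_density t : R := exp_inv 0 t * exp_inv 0 (-1 * t + 1).

Lemma smooth1_step_density : smooth1 step_density.
Proof.
apply: (@smooth1M _ (exp_inv 0) (fun t => exp_inv 0 (-1 * t + 1))).
  exact: smooth1_exp_inv.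
by apply: smooth1_affine; exact: smooth1_exp_inv.
Qed.

Lemma step_density_ge0 t : 0 <= step_density t.
Proof. by rewrite mulr_ge0 // exp_inv_ge0. Qed.

Lemma step_density_eq0 t : ~~ (0 < t < 1) -> step_density t = 0.
Proof.
rewrite /step_density /exp_inv negb_and => /orP[/negbTE ->|t1]; first by rewrite mul0r.
by rewrite [X in _ * X]ifF ?mulr0 //; apply/negP => h; move/negP: t1; apply; lra.
Qed.

Lemma step_density_gt0 t : 0 < t < 1 -> 0 < step_density t.
Proof.
move=> /andP[t0 t1]; rewrite /step_density /exp_inv t0 ifT; last lra.
by rewrite !expr0 !mul1r mulr_gt0 // expR_gt0.
Qed.

Definition step_primitive t : R :=
  \int[@lebesgue_measure R]_(s in `]-oo, t]) step_density s.

Lemma is_derive_step_primitive t : is_derive t 1 step_primitive (step_density t).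
Proof.
apply: (@is_derive_primitive _ _ 0 1).
  exact: smooth1_continuous smooth1_step_density.
move=> x x01; apply: step_density_eq0; apply: contra x01.
by move=> /andP[/ltW -> /ltW ->].
Qed.

Lemma smooth1_step_primitive : smooth1 step_primitive.
Proof.
exact: (smooth1_primitive smooth1_step_density is_derive_step_primitive).
Qed.

Lemma step_primitive_mvt a b : a < b -> exists2 c, a < c < b &
  step_primitive b - step_primitive a = step_density c * (b - a).
Proof.
move=> ab; have [||c] := @MVT R step_primitive step_density a b ab.
- by move=> x _; exact: is_derive_step_primitive.
- exact/continuous_subspaceT/smooth1_continuous/smooth1_step_primitive.
by rewrite in_itv /= => ? ?; exists c.
Qed.

Lemma step_primitive_le a b : a <= b -> step_primitive a <= step_primitive b.
Proof.
rewrite le_eqVlt => /predU1P[->//|ab]; have [c _ h] := step_primitive_mvt ab.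
by rewrite -subr_ge0 h mulr_ge0 ?step_density_ge0 // subr_ge0 ltW.
Qed.

Lemma step_primitive_cst a b : a <= b -> b <= 0 \/ 1 <= a ->
  step_primitive b = step_primitive a.
Proof.
rewrite le_eqVlt => /predU1P[->//|ab h]; have [c /andP[ac cb] e] := step_primitive_mvt ab.
apply/eqP; rewrite -subr_eq0 e step_density_eq0 ?mul0r // negb_and -!leNgt.
by case: h => h; [rewrite (le_trans (ltW cb) h)|rewrite (le_trans h (ltW ac)) orbT].
Qed.

Lemma step_primitive01 : step_primitive 0 < step_primitive 1.
Proof.
have [c c01 h] := step_primitive_mvt (@ltr01 R).
by rewrite -subr_gt0 h subr0 mulr1 step_density_gt0.
Qed.

Definition step t : R :=
  (step_primitive 1 - step_primitive 0)^-1 * (step_primitive t - step_primitive 0).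

Lemma smooth1_step : smooth1 step.
Proof.
apply: (@smooth1M _ (cst (step_primitive 1 - step_primitive 0)^-1)
  (step_primitive \+ cst (- step_primitive 0))).
  exact: smooth1_cst.
by apply: smooth1D; [exact: smooth1_step_primitive|exact: smooth1_cst].
Qed.

Lemma step_eq0 t : t <= 0 -> step t = 0.
Proof. by move=> t0; rewrite /step (@step_primitive_cst t 0) ?subrr ?mulr0 //; left. Qed.

Lemma step_eq1 t : 1 <= t -> step t = 1.
Proof.
move=> t1; rewrite /step (@step_primitive_cst 1 t) ?mulVf //; last by right.
by rewrite subr_eq0 gt_eqF // step_primitive01.
Qed.

Lemma step_ge0 t : 0 <= step t.
Proof.
have h := step_primitive01; have [t0|t0] := leP t 0; first by rewrite step_eq0.
by apply: mulr_ge0; rewrite ?invr_ge0 subr_ge0; [exact: ltW|exact/step_primitive_le/ltW].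
Qed.

Lemma step_le1 t : step t <= 1.
Proof.
have h := step_primitive01; have [t0|t0] := leP 1 t; first by rewrite step_eq1.
rewrite /step mulrC ler_pdivrMr ?subr_gt0 // mul1r lerD2r.
by rewrite step_primitive_le // ltW.
Qed.

(** A rise after [a] and a fall before [b], each of length 1 / k. The support stays in [a, b] for
    all k, and the bumps tend to the indicator of the open interval from inside. *)
Definition bump1 k a b t : R := step (k * (t - a)) * step (k * (b - t)).

Lemma smooth1_bump1 k a b : smooth1 (bump1 k a b).
Proof.
apply: (@smooth1M _ (fun t => step (k * (t - a))) (fun t => step (k * (b - t)))).
  rewrite (_ : (fun t => _) = (fun t => step (k * t + (- k * a)))).
    exact: smooth1_affine smooth1_step.
  by apply/funext => t; congr step; ring.
rewrite (_ : (fun t => _) = (fun t => step (- k * t + k * b))).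
  exact: smooth1_affine smooth1_step.
by apply/funext => t; congr step; ring.
Qed.

Lemma bump1_ge0 k a b t : 0 <= bump1 k a b t.
Proof. by rewrite mulr_ge0 // step_ge0. Qed.

Lemma bump1_le1 k a b t : bump1 k a b t <= 1.
Proof. by rewrite mulr_ile1 // ?step_ge0 // step_le1. Qed.

Lemma bump1_eq0 k a b t : 0 <= k -> ~~ (a < t < b) -> bump1 k a b t = 0.
Proof.
move=> k0; rewrite /bump1 negb_and -!leNgt => /orP[h|h].
  by rewrite step_eq0 ?mul0r // mulr_ge0_le0 // subr_le0.
by rewrite [X in _ * X]step_eq0 ?mulr0 // mulr_ge0_le0 // subr_le0.
Qed.

Lemma bump1_eq1 k a b t : 0 < k -> a + k^-1 <= t -> t <= b - k^-1 ->
  bump1 k a b t = 1.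
Proof.
move=> k0 h1 h2; rewrite /bump1 !step_eq1 ?mulr1 //.
  by rewrite mulrC -ler_pdivrMr // div1r; lra.
by rewrite mulrC -ler_pdivrMr // div1r; lra.
Qed.

Lemma bump1_cvg a b t :
  (bump1 n%:R a b t @[n --> \oo] --> ((a < t < b)%R%:R : R)).
Proof.
have [/andP[ta tb]|h] := boolP (a < t < b); last first.
  rewrite (_ : (fun n : nat => _) = cst 0); first exact: cvg_cst.
  by apply/funext => n /=; rewrite bump1_eq0.
(* Inside the interval the sequence is eventually equal to 1: it suffices that n exceed 1 / (t - a)
   and 1 / (b - t). *)
apply: cvg_near_cst; near=> n.
have n0 : 0 < n%:R :> R by rewrite ltr0n; near: n; exact: nbhs_infty_gt.
have h1 : (t - a)^-1 <= n%:R by near: n; exact: nbhs_infty_ger.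
have h2 : (b - t)^-1 <= n%:R by near: n; exact: nbhs_infty_ger.
rewrite bump1_eq1 //.
  rewrite addrC -lerBrDr -[leRHS]invrK lef_pV2 ?posrE ?invr_gt0 // subr_gt0 //.
rewrite lerBrDr addrC -lerBrDr -[leRHS]invrK lef_pV2 ?posrE ?invr_gt0 // subr_gt0 //.
Unshelve. all: by end_near. Qed.

End smooth_step.

(** * Bumps and cutoffs in several variables *)

Section smooth_space.
Variables (R : realType) (n : nat).
Implicit Types (f g : 'rV[R]_n -> R) (Omega K : set 'rV[R]_n) (a b v : 'rV[R]_n).

(* [smooth_fun] quantifies over iterated partial derivatives; this class is closed
   under [partial], so one differentiation suffices to prove membership. *)
Inductive smooth_rV : ('rV[R]_n -> R) -> Prop :=
| smooth_rV_cst c : smooth_rV (cst c)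
| smooth_rV_coord i (f : R -> R) : smooth1 f -> smooth_rV (fun v => f (v ord0 i))
| smooth_rVD f g : smooth_rV f -> smooth_rV g -> smooth_rV (f \+ g)
| smooth_rVM f g : smooth_rV f -> smooth_rV g -> smooth_rV (f \* g).

Lemma is_derive_coord i j (f : R -> R) (df : R) v :
  is_derive (v ord0 i) 1 f df ->
  is_derive v (delta_mx ord0 j) (fun w => f (w ord0 i)) (if i == j then df else 0).
Proof.
move=> [fd fE]; have [ij|ij] := eqVneq i j; last first.
  have E : (fun h : R => h^-1 *: (((fun w : 'rV[R]_n => f (w ord0 i)) \o shift v)
      (h *: delta_mx ord0 j) - f (v ord0 i))) = cst 0.
    apply/funext => h /=.
    by rewrite !mxE eqxx /= (negbTE ij) mulr0 add0r subrr scaler0.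
  have lim0 : (fun h : R => h^-1 *: (((fun w : 'rV[R]_n => f (w ord0 i)) \o shift v)
      (h *: delta_mx ord0 j) - f (v ord0 i))) @ 0^' --> (0 : R).
    by rewrite E; exact: cvg_cst.
  by split; [apply/cvg_ex; exists 0|exact: cvg_lim lim0].
have E : (fun h : R => h^-1 *: (((fun w : 'rV[R]_n => f (w ord0 i)) \o shift v)
    (h *: delta_mx ord0 j) - f (v ord0 i))) =
   (fun h : R => h^-1 *: ((f \o shift (v ord0 i)) (h *: 1) - f (v ord0 i))).
  by apply/funext => h /=; rewrite !mxE !eqxx /= ij eqxx.
by split; [rewrite /derivable E|rewrite /derive E].
Qed.

Lemma smooth_rV_derive f : smooth_rV f -> forall i, exists2 g, smooth_rV g &
  forall v, is_derive v (delta_mx ord0 i) f (g v).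
Proof.
elim=> {f} [c|j f sf|f g sf IHf sg IHg|f g sf IHf sg IHg] i.
- by exists (cst 0); [constructor|move=> v; exact: is_derive_cst].
- have [g sg fg] := smooth1_derive sf.
  exists (if j == i then (fun v => g (v ord0 j)) else cst 0).
    by case: ifP => _; constructor.
  by move=> v; have := is_derive_coord i (fg (v ord0 j)); case: ifP.
- have [f' sf' ff'] := IHf i; have [g' sg' gg'] := IHg i.
  by exists (f' \+ g'); [constructor|move=> t; exact: is_deriveD].
- have [f' sf' ff'] := IHf i; have [g' sg' gg'] := IHg i.
  exists ((f \* g') \+ (g \* f')); first by do 2 constructor.
  by move=> t; exact: is_deriveM.
Qed.

Lemma smooth_rV_continuous f : smooth_rV f -> continuous f.
Proof.
elim=> {f} [c|j f sf|f g sf IHf sg IHg|f g sf IHf sg IHg] v.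
- exact: cst_continuous.
- apply: (@continuous_comp _ _ _ (fun w : 'rV[R]_n => w ord0 j) f).
    exact: coord_continuous.
  exact: smooth1_continuous.
- exact: cvgD (IHf v) (IHg v).
- exact: cvgM (IHf v) (IHg v).
Qed.

Lemma smooth_rV_partial f i : smooth_rV f -> smooth_rV (partial i f).
Proof.
move=> /smooth_rV_derive/(_ i)[g sg fg].
by rewrite (_ : partial i f = g) //; apply/funext => v; case: (fg v).
Qed.

Lemma smooth_rV_smooth_fun f : smooth_rV f -> smooth_fun f.
Proof.
move=> sf s; have {sf} sf : smooth_rV (foldr (@partial R n) f s).
  by elim: s => //= i s; exact: smooth_rV_partial.
move=> i; split; last exact/smooth_rV_continuous/smooth_rV_partial.
by have [g _ fg] := smooth_rV_derive sf i; move=> v; case: (fg v).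
Qed.

Lemma partialM f g i v : smooth_rV f -> smooth_rV g ->
  partial i (f \* g) v = f v * partial i g v + g v * partial i f v.
Proof.
move=> /smooth_rV_derive/(_ i)[f' _ ff'] /smooth_rV_derive/(_ i)[g' _ gg'].
rewrite /partial (@derive_val _ _ _ _ _ f _ (ff' v)) (@derive_val _ _ _ _ _ g _ (gg' v)).
have h := is_deriveM (ff' v) (gg' v).
exact: (@derive_val _ _ _ _ _ (f * g) _ h).
Qed.

Lemma smooth_rV_test_fun Omega K f : smooth_rV f -> compact K -> K `<=` Omega ->
  [set v | f v != 0] `<=` K -> test_fun Omega f.
Proof.
move=> sf cK KO fK; have cl : closure [set v | f v != 0] `<=` K.
  rewrite closureE => v; apply; split => //.
  exact: (compact_closed (@norm_hausdorff _ _)).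
split; [exact: smooth_rV_smooth_fun| |exact: subset_trans cl KO].
exact: (subclosed_compact (@closed_closure _ _) cK cl).
Qed.

Definition rV_bump (k : R) a b : 'rV[R]_n -> R :=
  fun v => \prod_(i < n) bump1 k (a ord0 i) (b ord0 i) (v ord0 i).

Lemma smooth_rV_prod (I : Type) (s : seq I) (F : I -> 'rV[R]_n -> R) :
  (forall i, smooth_rV (F i)) -> smooth_rV (fun v => \prod_(i <- s) F i v).
Proof.
move=> sF; elim: s => [|i s IH].
  by rewrite (_ : (fun _ => _) = cst 1); [constructor|apply/funext=> v; rewrite big_nil].
rewrite (_ : (fun _ => _) = F i \* (fun v => \prod_(i <- s) F i v)); first by constructor.
by apply/funext=> v; rewrite big_cons.
Qed.

Lemma smooth_rV_bump k a b : smooth_rV (rV_bump k a b).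
Proof.
apply: (@smooth_rV_prod _ _ (fun i v => bump1 k (a ord0 i) (b ord0 i) (v ord0 i))).
by move=> i; constructor; exact: smooth1_bump1.
Qed.

Lemma bump_ge0 k a b v : 0 <= rV_bump k a b v.
Proof. by rewrite prodr_ge0 // => i _; exact: bump1_ge0. Qed.

Lemma bump_le1 k a b v : rV_bump k a b v <= 1.
Proof.
suff /andP[] : 0 <= rV_bump k a b v <= 1 by [].
rewrite /rV_bump; elim/big_ind : _ => // [|x y /andP[x0 x1] /andP[y0 y1]|i _].
- by rewrite ler01 lexx.
- by rewrite mulr_ge0 //= mulr_ile1.
- by rewrite bump1_ge0 bump1_le1.
Qed.

Lemma bump_eq0 k a b v : 0 <= k -> ~ obox a b v -> rV_bump k a b v = 0.
Proof.
move=> k0 /existsNP[i /negP abv].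
by rewrite /rV_bump (bigD1 i) //= bump1_eq0 ?mul0r.
Qed.

Lemma bump_support k a b : 0 <= k -> [set v | rV_bump k a b v != 0] `<=` cbox a b.
Proof.
move=> k0 v /= nz; apply: sub_obox_cbox; apply: contrapT => h.
by move: nz; rewrite bump_eq0 // eqxx.
Qed.

Lemma test_fun_bump Omega k a b : 0 <= k -> cbox a b `<=` Omega ->
  test_fun Omega (rV_bump k a b).
Proof.
move=> k0 abO; apply: smooth_rV_test_fun abO (bump_support k0).
  exact: smooth_rV_bump.
exact: compact_cbox.
Qed.

Lemma bump_cvg a b v :
  (rV_bump m%:R a b v @[m --> \oo] --> (\1_(obox a b) v : R)).
Proof.
have -> : \1_(obox a b) v = \prod_(i < n) ((a ord0 i < v ord0 i < b ord0 i)%R%:R : R).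
  rewrite indicE; have [h|h] := pselect (obox a b v).
    by rewrite mem_set //= big1 // => i _; rewrite (h i).
  rewrite memNset //; have /existsNP[i /negP abv] := h.
  by rewrite (bigD1 i) //= (negbTE abv) mul0r.
rewrite /rV_bump; elim: (index_enum _) => [|i s IH].
  rewrite big_nil; rewrite (_ : (fun m => _) = cst 1); first exact: cvg_cst.
  by apply/funext => m /=; rewrite big_nil.
rewrite big_cons; rewrite (_ : (fun m : nat => _) = (fun m : nat =>
  bump1 m%:R (a ord0 i) (b ord0 i) (v ord0 i)) \*
  (fun m : nat => \prod_(j <- s) bump1 m%:R (a ord0 j) (b ord0 j) (v ord0 j))).
  by apply: cvgM; [exact: bump1_cvg|exact: IH].
by apply/funext => m /=; rewrite big_cons.
Qed.

Lemma open_obox a b : open (obox a b).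
Proof.
rewrite openE => v abv.
apply: (@filter_forall _ _ (fun i w => a ord0 i < w ord0 i < b ord0 i) (nbhs v)) => i.
have : nbhs (v ord0 i) `]a ord0 i, b ord0 i[%classic.
  by apply: open_nbhs_nbhs; split; [exact: interval_open|rewrite /= in_itv/=].
move=> h; have {}h : \forall w \near v, `]a ord0 i, b ord0 i[%classic ((w : 'rV[R]_n) ord0 i).
  exact: (@coord_continuous R 1 n ord0 i v _ h).
by move: h; apply: filterS => w; rewrite /= in_itv.
Qed.

(* The cutoff is 1 - prod (1 - b_k) for finitely many bumps b_k covering K. *)
Lemma smooth_cutoff Omega K : open Omega -> compact K -> K `<=` Omega ->
  exists2 eta, smooth_rV eta & [/\ (forall v, 0 <= eta v <= 1),
    (exists2 K', compact K' & K' `<=` Omega /\ [set v | eta v != 0] `<=` K') &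
    forall v, K v -> \forall w \near v, eta w = 1].
Proof.
move=> oO cK KO.
have /choice[e eP] : forall x, exists e : R, 0 < e /\
    (Omega x -> cbox (x - const_mx e) (x + const_mx e) `<=` Omega).
  move=> x; have [Ox|nOx] := pselect (Omega x).
    by have [e e0 eO] := open_ball_box oO Ox; exists e.
  by exists 1; split.
pose half x := obox (x - const_mx (e x / 2)) (x + const_mx (e x / 2)).
have : cover_compact K by rewrite -compact_cover.
move=> /(_ _ K half) [].
- by move=> x _; exact: open_obox.
- move=> x Kx; exists x => // i; rewrite !mxE.
  by have [e0 _] := eP x; apply/andP; split; lra.
move=> D DK KD.
(* With slope 2 / e the ramps have length e / 2, so the bump equals 1 on [half x]. *)
pose b x := rV_bump (2 / e x) (x - const_mx (e x)) (x + const_mx (e x)).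
pose P v := \prod_(x <- finmap.enum_fset D) (1 - b x v).
have bk x : 0 <= 2 / e x by have [e0 _] := eP x; rewrite divr_ge0 // ltW.
have P01 v : 0 <= P v <= 1.
  rewrite /P; elim/big_ind : _ => // [|x y /andP[x0 x1] /andP[y0 y1]|x _].
  - by rewrite ler01 lexx.
  - by rewrite mulr_ge0 //= mulr_ile1.
  - by rewrite subr_ge0 bump_le1 gerBl bump_ge0.
exists (fun v => 1 - P v).
  rewrite (_ : (fun v => _) = cst 1 \+ (cst (-1) \* P)).
    apply: smooth_rVD; [exact: smooth_rV_cst|apply: smooth_rVM; first exact: smooth_rV_cst].
    apply: (@smooth_rV_prod _ _ (fun x v => 1 - b x v)) => x.
    rewrite (_ : (fun v => _) = cst 1 \+ (cst (-1) \* b x)).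
      apply: smooth_rVD; [exact: smooth_rV_cst|apply: smooth_rVM; first exact: smooth_rV_cst].
      exact: smooth_rV_bump.
    by apply/funext => v /=; rewrite mulN1r.
  by apply/funext => v /=; rewrite mulN1r.
split.
- by move=> v; have /andP[p0 p1] := P01 v; rewrite subr_ge0 p1 gerBl p0.
- exists (\bigcup_(x in [set` finmap.enum_fset D]) cbox (x - const_mx (e x)) (x + const_mx (e x))).
    by rewrite bigcup_seq; apply: bigsetU_compact => x _; exact: compact_cbox.
  split.
    apply: bigcup_sub => x xD; have [_] := eP x; apply; apply: KO.
    by have := DK x xD; rewrite inE.
  move=> v /=; apply: contra_neqP => nv; apply/eqP; rewrite subr_eq0 eq_sym; apply/eqP.
  rewrite /P big_seq big1 // => x xD; rewrite /b bump_eq0 ?subr0 // => h; apply: nv.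
  by exists x => //; exact: sub_obox_cbox.
(* One factor of [P] vanishes on a whole half box. The value 1 near [K], and not only on [K], will
   kill the derivatives of the cutoff there. *)
- move=> v Kv; have [x xD hv] := KD _ Kv.
  have : nbhs v (half x) by apply: open_nbhs_nbhs; split => //; exact: open_obox.
  apply: filterS => w hw; rewrite /P (big_rem x) //=.
  have [e0 _] := eP x; suff -> : b x w = 1 by rewrite subrr mul0r subr0.
  rewrite /b /rV_bump big1 // => i _; apply: bump1_eq1; first by rewrite divr_gt0.
    by have := hw i; rewrite !mxE invf_div => /andP[h1 h2]; lra.
  by have := hw i; rewrite !mxE invf_div => /andP[h1 h2]; lra.
Qed.

End smooth_space.

(** * The fundamental lemma of the calculus of variations *)

Section C1_continuous.
Variables (R : realType) (n : nat).
Implicit Types (f : 'rV[R]_n -> R) (x y v : 'rV[R]_n).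

Lemma mean_value_bound (g g' : R -> R) (M a b : R) :
  (forall t : R, is_derive t 1 g (g' t)) ->
  (forall t, Num.min a b <= t <= Num.max a b -> `|g' t| <= M) ->
  `|g b - g a| <= M * `|b - a|.
Proof.
move=> dg; have cg : continuous g.
  by move=> t; apply/differentiable_continuous/derivable1_diffP; case: (dg t).
have key a' b' : a' < b' -> (forall t, a' <= t <= b' -> `|g' t| <= M) ->
    `|g b' - g a'| <= M * `|b' - a'|.
  move=> ab gM; have [|c] := @MVT R g g' a' b' ab (fun t _ => dg t).
    exact: continuous_subspaceT.
  rewrite in_itv /= => /andP[ac cb] ->; rewrite normrM ler_wpM2r //.
  by apply: gM; rewrite (ltW ac) (ltW cb).
have [ab|ba|->] := ltgtP a b; [exact: key| |by rewrite !subrr normr0 mulr0].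
by move=> gM; rewrite distrC [X in _ * X]distrC; exact: key.
Qed.

Definition row_set x (i : 'I_n) (t : R) : 'rV[R]_n :=
  \row_j (if j == i then t else x ord0 j).

Lemma is_derive_row_set f x i t : derivable f (row_set x i t) (delta_mx ord0 i) ->
  is_derive t 1 (fun s => f (row_set x i s)) (partial i f (row_set x i t)).
Proof.
move=> df.
have E : (fun h : R => h^-1 *: (((fun s => f (row_set x i s)) \o shift t) (h *: 1) -
    f (row_set x i t))) = (fun h : R => h^-1 *: ((f \o shift (row_set x i t))
      (h *: delta_mx ord0 i) - f (row_set x i t))).
  apply/funext => h /=; congr (_ *: (f _ - _)); apply/rowP => j; rewrite !mxE eqxx /=.
  by case: eqVneq => _; [|rewrite mulr0 add0r].
by split; [rewrite /derivable E|rewrite /derive E].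
Qed.

(** [C1_fun] speaks of partial derivatives only, so continuity has to be derived: the increment is
    telescoped through points that differ in one coordinate, and each term obeys a mean value bound,
    the partial derivatives being bounded near [x]. *)
Lemma C1_fun_continuous f : C1_fun f -> continuous f.
Proof.
move=> C1f; suff H (x : 'rV[R]_n) : {for x, continuous f} by exact: H.
pose M := 1 + \sum_i `|partial i f x|.
have M0 : 0 <= M by rewrite addr_ge0 // sumr_ge0.
have : \forall v \near x, forall i, `|partial i f v| <= M.
  apply: (@filter_forall _ _ (fun i v => `|partial i f v| <= M) (nbhs x)) => i.
  have /(_ x)/cvgrPdist_lt/(_ 1 ltr01) := (C1f i).2.
  apply: filterS => v hv; rewrite /M (bigD1 i) //=.
  have : 0 <= \sum_(j < n | j != i) `|partial j f x| by rewrite sumr_ge0.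
  have := ler_normB (partial i f x) (partial i f x - partial i f v).
  by rewrite opprB addrCA subrr addr0; lra.
move=> /nbhs_ballP[e /= e0 eM].
have lip y : ball x e y -> `|f y - f x| <= \sum_i M * `|y ord0 i - x ord0 i|.
  (* [z k] interpolates between x and y one coordinate at a time. A ball of the sup norm is a box,
     so no intermediate point leaves it. *)
  move=> xy; pose z (k : nat) : 'rV[R]_n := \row_j (if (j < k)%N then y ord0 j else x ord0 j).
  have -> : f y - f x = \sum_(0 <= k < n) (f (z k.+1) - f (z k)).
    rewrite telescope_sumr //; congr (f _ - f _); apply/rowP => j; rewrite !mxE //.
    by rewrite ltn_ord.
  rewrite big_mkord; apply: le_trans (ler_norm_sum _ _ _) _; apply: ler_sum => i _.
  have -> : f (z i.+1) = f (row_set (z i) i (y ord0 i)).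
    congr f; apply/rowP => j; rewrite !mxE; case: eqVneq => [->|ji].
      by rewrite ltnSn.
    by rewrite ltnS leq_eqVlt (inj_eq val_inj) (negbTE ji).
  have -> : f (z i) = f (row_set (z i) i (x ord0 i)).
    congr f; apply/rowP => j; rewrite !mxE; case: eqVneq => [->|//].
    by rewrite ltnn.
  apply: (@mean_value_bound (fun s => f (row_set (z i) i s))
    (fun s => partial i f (row_set (z i) i s))).
    by move=> t; apply: is_derive_row_set; exact: (C1f i).1.
  move=> t tP; apply: eM; split => // k j; rewrite ord1 !mxE.
  have := xy.2 ord0 i; have := xy.2 ord0 j; rewrite /ball /= => hj hi.
  case: eqVneq => [->|_]; last by case: ifP => // _; rewrite subrr normr0.
  move: hi tP; rewrite ltr_distl => /andP[hi1 hi2].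
  case: (leP (x ord0 i) (y ord0 i)) => xyi /andP[t1 t2];
    by rewrite ltr_distl; apply/andP; split; lra.
apply/(@cvgrPdist_lt R R _ (nbhs x) (nbhs_filter x) f (f x)) => eps eps0.
have D0 : 0 < M * n%:R + 1 by rewrite ltr_wpDl // mulr_ge0.
have : \forall y \near x, ball x e y /\ ball x (eps / (M * n%:R + 1)) y.
  by apply: filterI; apply: nbhsx_ballx; rewrite // divr_gt0.
apply: filterS => y [/lip h [_ hy]]; rewrite distrC; apply: le_lt_trans h _.
apply: (@le_lt_trans _ _ (\sum_(i < n) M * (eps / (M * n%:R + 1)))).
  apply: ler_sum => i _; apply: ler_wpM2l => //.
  by rewrite distrC ltW //; have := hy ord0 i; rewrite /ball.
rewrite sumr_const card_ord -[ltLHS]mulr_natr; set N := n%:R.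
rewrite [ltLHS](_ : _ = eps * (M * N) / (M * N + 1)); last by ring.
by rewrite ltr_pdivrMr // ltr_pM2l // ltrDl.
Qed.

End C1_continuous.

(** As g is integrable, the measurable sets on whose trace in B its integral vanishes form a Dynkin
    system; it contains a generating π-system, hence all measurable sets, and this forces g = 0
    almost everywhere. *)
Lemma pi_system_integral_eq0 d (T : measurableType d) (R : realType)
    (mu : {measure set T -> \bar R}) (G : set (set T)) (B : set T) (g : T -> R) :
  @measurable _ T = <<s G >> -> setI_closed G -> measurable B ->
  mu.-integrable B (EFin \o g) -> (\int[mu]_(x in B) (g x)%:E = 0)%E ->
  (forall A, G A -> \int[mu]_(x in B `&` A) (g x)%:E = 0)%E ->
  ae_eq mu B g (cst 0).
Proof.
move=> sG GI mB ig gB gG.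
have key A : measurable A -> (\int[mu]_(x in B `&` A) (g x)%:E = 0)%E.
  rewrite sG; move: A.
  apply: (@dynkin_induction _ _ G (fun A => \int[mu]_(x in B `&` A) (g x)%:E = 0)%E) => //.
  - by rewrite setIT.
  - move=> A mA gA.
    have mA' : measurable (B `&` ~` A) by apply: measurableI => //; exact: measurableC.
    have := @integral_setU _ _ _ mu (B `&` A) (B `&` ~` A) (EFin \o g).
    rewrite -setIUr setUv setIT => /(_ (measurableI _ _ mB mA) mA' (measurable_int _ ig)).
    rewrite gB gA add0e => <- //.
    by apply/disj_setPS => x [[_ ?] [_]].
  - move=> F mF tF gF; rewrite setI_bigcupr integral_bigcup //.
    + by rewrite eseries0 // => k _ _; exact: gF.
    + exact: trivIset_setIl.
    + by move=> k; exact: measurableI.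
    + apply: integrableS ig => //; first by apply: bigcupT_measurable => k; exact: measurableI.
      by apply: bigcup_sub => k _; exact: subIsetl.
have : ae_eq mu B (EFin \o g) (cst 0%E).
  apply: integral_ae_eq => // E EB mE.
  by rewrite integral0; have := key _ mE; rewrite setIidr.
by apply: filterS => x h Bx; have [] := h Bx.
Qed.

Section fundamental_lemma.
Variables (R : realType) (n : nat).
Local Notation mu := (@lebesgue_rV R n).
Implicit Types (Omega K : set 'rV[R]_n) (g h u psi : 'rV[R]_n -> R) (a b : 'rV[R]_n).

Lemma L1locM_integrable Omega K u h : measurable Omega -> L1loc Omega u ->
  continuous h -> compact K -> K `<=` Omega ->
  (forall x, ~ K x -> h x = 0) ->
  mu.-integrable Omega (EFin \o (fun x => u x * h x)).
Proof.
move=> mO [mu_ iu] ch cK KO h0; have mK := measurable_compact_rV cK.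
rewrite integrable_mkcond //.
rewrite (_ : _ \_ _ = (EFin \o (fun x => u x * h x)) \_ K); last first.
  apply/funext => x; rewrite !patchE; case: ifPn => [xO|xO].
    case: ifPn => // xK; rewrite /= h0 ?mulr0 // => Kx.
    by move: xK; rewrite mem_set.
  by rewrite ifF //; apply/negbTE; apply: contra xO; rewrite !inE; exact: KO.
rewrite -integrable_mkcond //.
rewrite (_ : _ \o _ = ((EFin \o h) \* (EFin \o u))%E); last first.
  by apply/funext => x /=; rewrite mulrC EFinM.
apply: integrableMr => //; last exact: iu.
  exact: measurable_funTS (continuous_measurable_rV ch).
have /compact_bounded[M [Mr hM]] : compact (h @` K).
  by apply: continuous_compact => //; exact: continuous_subspaceT.
by exists M; split => // y My x Kx; apply: (hM y My); exists x.
Qed.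

Lemma test_fun_continuous Omega psi : test_fun Omega psi -> continuous psi.
Proof. by case=> /(_ [::])/C1_fun_continuous. Qed.

Lemma test_fun_eq0 psi x : ~ closure [set v | psi v != 0] x -> psi x = 0.
Proof. by apply: contra_notP => /eqP h; exact: subset_closure. Qed.

Lemma test_fun_partial_eq0 psi i x :
  ~ closure [set v | psi v != 0] x -> partial i psi x = 0.
Proof.
move=> nx; rewrite /partial.
have : \forall v \near x, psi v = 0.
  have : nbhs x (~` closure [set v | psi v != 0]).
    apply: open_nbhs_nbhs; split=> //; apply: closed_openC; exact: closed_closure.
  by apply: filterS => v; exact: test_fun_eq0.
move=> /(@near_eq_derive R _ _ psi (cst 0)) ->.
by rewrite derive_val.
Qed.

Lemma L1loc_test_integrable Omega u psi : open Omega -> L1loc Omega u ->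
  test_fun Omega psi -> mu.-integrable Omega (EFin \o (fun x => u x * psi x)).
Proof.
move=> oO lu tpsi; have [_ cK KO] := tpsi.
apply: (L1locM_integrable _ lu _ cK KO); first exact: measurable_open_rV.
  exact: test_fun_continuous tpsi.
by move=> x; exact: test_fun_eq0.
Qed.

Lemma L1loc_partial_integrable Omega u psi i : open Omega -> L1loc Omega u ->
  test_fun Omega psi ->
  mu.-integrable Omega (EFin \o (fun x => u x * partial i psi x)).
Proof.
move=> oO lu tpsi; have [sm cK KO] := tpsi.
apply: (L1locM_integrable _ lu _ cK KO); first exact: measurable_open_rV.
  by have := (sm [::] i).2.
by move=> x; exact: test_fun_partial_eq0.
Qed.

(** The bumps are bounded by 1, live in the closed box and converge to the indicator of the open
    one, so dominated convergence applies with |g| on the closed box. *)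
Lemma L1loc_integral_obox_eq0 Omega g : open Omega -> L1loc Omega g ->
  (forall (m : nat) a b, cbox a b `<=` Omega ->
    \int[mu]_(x in Omega) (g x * rV_bump m%:R a b x) = 0) ->
  forall a b, cbox a b `<=` Omega -> (\int[mu]_(x in obox a b) (g x)%:E = 0)%E.
Proof.
move=> oO lg gb a b abO.
have mC := measurable_cbox a b; have mB := measurable_obox a b.
have mO := measurable_open_rV oO.
have iC : mu.-integrable (cbox a b) (EFin \o g).
  by apply: lg.2 => //; exact: compact_cbox.
have mgC := measurable_int _ iC.
pose f_ (m : nat) x := (g x * rV_bump m%:R a b x)%:E.
pose f x := (g x * \1_(obox a b) x)%:E.
have f0 m : (\int[mu]_(x in cbox a b) f_ m x = 0)%E.
  have := gb m a b abO; rewrite /Rintegral => /eqP.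
  rewrite (_ : integral _ _ _ = (\int[mu]_(x in cbox a b) f_ m x)%E); last first.
    rewrite [LHS]integral_mkcond [RHS]integral_mkcond; congr integral.
    apply/funext => x; rewrite !patchE; case: ifPn => [xO|xO].
      case: ifPn => // xK; rewrite /= bump_eq0 ?mulr0 // => Kx.
      by move: xK; rewrite mem_set //; exact: sub_obox_cbox.
    by rewrite ifF //; apply/negbTE; apply: contra xO; rewrite !inE; exact: abO.
  rewrite fine_eq0; first by move/eqP.
  apply: integrable_fin_num => //.
  apply: (integrableS (measurable_open_rV oO) mC abO).
  apply: (L1loc_test_integrable oO lg); exact: test_fun_bump.
have [] := @dominated_convergence _ _ _ mu _ mC f_ f (abse \o (EFin \o g)).
- move=> m; apply/measurable_EFinP; apply: measurable_funM; first exact/measurable_EFinP.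
  apply: measurable_funTS; apply: continuous_measurable_rV.
  exact: smooth_rV_continuous (smooth_rV_bump _ _ _).
- apply/measurable_EFinP; apply: measurable_funM; first exact/measurable_EFinP.
  by apply: measurable_funTS; exact: measurable_indic.
- apply: aeW => x _; apply: cvg_EFin; first exact: nearW.
  by apply: cvgM; [exact: cvg_cst|exact: bump_cvg].
- exact: integrable_abse.
- apply: aeW => x m _; rewrite /f_ /= lee_fin normrM.
  by rewrite -[leRHS]mulr1 ler_wpM2l // ger0_norm ?bump_ge0 // bump_le1.
move=> _ _; rewrite (_ : [sequence _]_m = cst 0%E); last by apply/funext => m; exact: f0.
move=> /(cvg_lim (@ereal_hausdorff R)); rewrite lim_cst // => f00.
rewrite [RHS]f00 [LHS]integral_mkcond [RHS]integral_mkcond; congr integral.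
apply/funext => x; rewrite !patchE /f indicE; case: ifPn => xB.
  by rewrite mulr1 ifT //; move: xB; rewrite !inE; exact: sub_obox_cbox.
by rewrite mulr0 if_same.
Qed.

(** Bumps are enough as test functions. An orthant meets a box in a box whose closed version still
    lies in [Omega], so the integrals vanish on a π-system; countably many rational boxes then
    exhaust [Omega]. *)
Lemma fundamental_lemma Omega g : open Omega -> L1loc Omega g ->
  (forall (m : nat) a b, cbox a b `<=` Omega ->
    \int[mu]_(x in Omega) (g x * rV_bump m%:R a b x) = 0) ->
  ae_eq mu Omega g (cst 0).
Proof.
move=> oO lg gb; have gbox := L1loc_integral_obox_eq0 oO lg gb.
have boxae a b : cbox a b `<=` Omega -> ae_eq mu (obox a b) g (cst 0).
  move=> abO; apply: (@pi_system_integral_eq0 _ _ _ mu (range (@orthant R n))).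
  - apply/seteqP; split => A; first exact: orthant_sigma_algebra.
    move: A; apply: smallest_sub; first exact: sigma_algebra_measurable.
    by move=> _ [c _ <-]; exact: measurable_orthant.
  - move=> _ _ [c _ <-] [c' _ <-]; exists (\row_i Num.max (c ord0 i) (c' ord0 i)) => //.
    apply/seteqP; split => v.
      by move=> h; split => i; have := h i; rewrite mxE gt_max => /andP[].
    by move=> [h1 h2] i; rewrite mxE gt_max h1 h2.
  - exact: measurable_obox.
  - apply: (integrableS (measurable_cbox a b) (measurable_obox a b) (@sub_obox_cbox _ _ a b)).
    by apply: lg.2 => //; exact: compact_cbox.
  - exact: gbox.
  - move=> _ [c _ <-].
    rewrite (_ : _ `&` _ = obox (\row_i Num.max (a ord0 i) (c ord0 i)) b).
      apply: gbox => v h; apply: abO => i; have /andP[] := h i.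
      by rewrite mxE ge_max => /andP[-> _] ->.
    apply/seteqP; split => v.
      by move=> [h1 h2] i; rewrite mxE gt_max h2 andbT; exact: h1.
    by move=> h; split => i; have := h i; rewrite mxE gt_max => /andP[/andP[h1 h2] h3] //; apply/andP.
have : forall k, ae_eq mu (inner_rat_box Omega k) g (cst 0).
  move=> k; rewrite /inner_rat_box; case: unpickle => [cd|]; last exact: aeW.
  by case: asboolP => [h|_]; [exact: boxae|exact: aeW].
move=> /ae_foralln; apply: filterS => x hx Ox.
by move: Ox; rewrite (open_inner_rat_box oO) => -[k _ kx]; exact: hx kx.
Qed.

End fundamental_lemma.

(** * The Poincaré inequality for compactly supported functions *)

(* Fubini on an abstract product X * Y: the functions z |-> int_{t < z.1} H(t, z.2)
   dt, cut off outside the slab, are integrable, and integrating them against b is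
   integrating H against the tail integral B of b.  The measures are kept abstract
   because [lebesgue_rV] unfolds to an iterated product. *)
Section halfline.
Context d1 d (R : realType) (X : measurableType d1) (Y : measurableType d).
Variable m1 : {sigma_finite_measure set X -> \bar R}.
Variable m2 : {sigma_finite_measure set Y -> \bar R}.
Variables (slab : X -> bool) (lt : X -> X -> bool) (H : X * Y -> R).
Hypothesis mslab : measurable_fun setT slab.
Hypothesis mlt : measurable_fun setT (fun z : X * X => lt z.1 z.2).
Hypothesis slab_fin : (m1 [set s | slab s] < +oo)%E.
Local Notation mu := (m1 \x m2)%E.
Hypothesis iH : mu.-integrable setT (EFin \o H).

Definition halfline_integrand (z : (X * Y) * X) : R :=
  if slab z.1.1 && lt z.2 z.1.1 then H (z.2, z.1.2) else 0.

(** [fine] sends infinite values to 0, which makes the function real everywhere without spoiling the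
    bounds below. *)
Definition halfline_integral (z : X * Y) : R :=
  fine (\int[m1]_t (halfline_integrand (z, t))%:E).

Let m_slab : measurable [set s | slab s].
Proof.
rewrite (_ : [set s | slab s] = slab @^-1` [set true]); first last.
  by apply/seteqP; split.
by rewrite -[X in measurable X]setTI; exact: mslab.
Qed.

Lemma measurable_halfline_fun : measurable_fun setT H.
Proof. by apply/measurable_EFinP; exact: measurable_int iH. Qed.

Lemma measurable_halfline_integrand : measurable_fun setT halfline_integrand.
Proof.
have m11 : measurable_fun setT (fun z : X * Y * X => z.1.1).
  by apply: measurableT_comp; [exact: measurable_fst|exact: measurable_fst].
have m12 : measurable_fun setT (fun z : X * Y * X => z.1.2).
  by apply: measurableT_comp; [exact: measurable_snd|exact: measurable_fst].
have m2' : measurable_fun setT (fun z : X * Y * X => z.2).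
  exact: measurable_snd.
apply: measurable_fun_ifT => //.
  apply: measurable_and; first exact: (measurableT_comp mslab).
  apply: (measurableT_comp mlt (g := fun z => (z.2, z.1.1))).
  exact: measurable_fun_pair.
apply: measurableT_comp; first exact: measurable_halfline_fun.
exact: measurable_fun_pair.
Qed.

Let W (w : Y) : \bar R := (\int[m1]_t `|H (t, w)|%:E)%E.

Let mH : measurable_fun setT (fun z => (`|H z|)%:E).
Proof.
apply/measurable_EFinP; apply: measurableT_comp => //.
exact: measurable_halfline_fun.
Qed.

Let mW : measurable_fun setT W.
Proof. by apply: (measurable_fun_fubini_tonelli_G (fun z => (`|H z|)%:E)). Qed.

Let W0 w : (0 <= W w)%E.
Proof. by apply: integral_ge0 => t _; rewrite lee_fin. Qed.

Let intW : (\int[m2]_w W w < +oo)%E.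
Proof.
have /integrableP[_] := iH.
by rewrite (fubini_tonelli2 (fun z => (`|H z|)%:E)).
Qed.

Lemma halfline_integrand_le z :
  (\int[m1]_t `|(halfline_integrand (z, t))%:E| <=
   (if slab z.1 then W z.2 else 0))%E.
Proof.
have mz : measurable_fun setT (fun t => halfline_integrand (z, t)).
  apply: (measurableT_comp measurable_halfline_integrand).
  exact: pair1_measurable.
rewrite /W; case: ifPn => zM.
  apply: ge0_le_integral => //.
  - by apply/measurable_EFinP; apply: measurableT_comp.
  - apply/measurable_EFinP; apply: measurableT_comp => //.
    apply: (measurableT_comp measurable_halfline_fun).
    exact: pair2_measurable.
  - move=> t _; rewrite lee_fin /halfline_integrand /= zM /=.
    by case: ifP => // _; rewrite normr0.
rewrite integral0_eq // => t _.
by rewrite /halfline_integrand /= (negbTE zM) /= normr0.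
Qed.

Let mslab1 : measurable_fun setT (fun z : X * Y => slab z.1).
Proof. by apply: (measurableT_comp mslab); exact: measurable_fst. Qed.

Let halfline_integral_le_slab z :
  ((`|halfline_integral z|)%:E <= if slab z.1 then W z.2 else 0)%E.
Proof.
have h1 : ((`|halfline_integral z|)%:E <=
    `|\int[m1]_t (halfline_integrand (z, t))%:E|)%E.
  by rewrite /halfline_integral; case: (integral _ _ _) => [r| |] //=; rewrite leey.
apply: le_trans h1 _.
have mz : measurable_fun setT (fun t => (halfline_integrand (z, t))%:E).
  apply/measurable_EFinP.
  apply: (measurableT_comp measurable_halfline_integrand).
  exact: pair1_measurable.
by apply: le_trans (le_abse_integral _ _ mz) (halfline_integrand_le z).
Qed.

Lemma halfline_integral_le z : ((`|halfline_integral z|)%:E <= W z.2)%E.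
Proof. by apply: le_trans (halfline_integral_le_slab z) _; case: ifP. Qed.

Lemma measurable_halfline_integral : measurable_fun setT halfline_integral.
Proof.
have mF : measurable_fun setT (EFin \o halfline_integrand).
  by apply/measurable_EFinP; exact: measurable_halfline_integrand.
apply: (measurableT_comp (fine_measurable measurableT)).
rewrite [X in measurable_fun _ X](_ : _ =
    (fun z => \int[m1]_t (EFin \o halfline_integrand)^\+ (z, t)) \-
    (fun z => \int[m1]_t (EFin \o halfline_integrand)^\- (z, t)))%E; last first.
  apply/funext => z; rewrite [LHS]integralE.
  by congr (_ - _)%E; apply: eq_integral => t _; rewrite ?funeposE ?funenegE.
apply: emeasurable_funB.
- by apply: (measurable_fun_fubini_tonelli_F (EFin \o halfline_integrand)^\+%E) => //; exact: measurable_funepos.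
- by apply: (measurable_fun_fubini_tonelli_F (EFin \o halfline_integrand)^\-%E) => //; exact: measurable_funeneg.
Qed.

(** The slab makes this true: the function is dominated by the integral of |H| over a full line,
    which does not depend on the first variable, and is cut off outside a set of finite measure. *)
Lemma integrable_halfline_integral :
  mu.-integrable setT (EFin \o halfline_integral).
Proof.
have mslabW : measurable_fun setT (fun z : X * Y => (if slab z.1 then W z.2 else 0)%E).
  apply: measurable_fun_ifT => //.
  by apply: measurableT_comp; [exact: mW|exact: measurable_snd].
have mV : measurable_fun setT (EFin \o halfline_integral).
  by apply/measurable_EFinP; exact: measurable_halfline_integral.
apply/integrableP; split => //.
apply: (@le_lt_trans _ _ (\int[mu]_z (if slab z.1 then W z.2 else 0))%E).
  apply: ge0_le_integral => //; first exact: measurableT_comp.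
  by move=> z _; exact: halfline_integral_le_slab.
rewrite fubini_tonelli2 //; last by move=> z; case: ifP.
rewrite /fubini_G /=.
rewrite (_ : (fun y => _) = (fun w => m1 [set s | slab s] * W w)%E); last first.
  apply/funext => w; rewrite muleC -integral_cst // [RHS]integral_mkcond.
  by apply: eq_integral => x _; rewrite patchE /= mem_setE.
by rewrite ge0_integralZl //; apply: lte_mul_pinfty => //; rewrite ge0_fin_numE.
Qed.

Variables (b B : X -> R) (c : Y -> R) (C : R).
Hypotheses (mb : measurable_fun setT b)
  (mB : measurable_fun setT B) (mc : measurable_fun setT c).
Hypotheses (b1 : forall s, `|b s| <= 1) (c1 : forall w, `|c w| <= 1)
  (BC : forall t, `|B t| <= C).
Hypothesis bM : forall s, ~~ slab s -> b s = 0.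
Hypothesis BE : forall t, (B t)%:E = (\int[m1]_s (if lt t s then b s else 0)%:E)%E.

Let int_b : (\int[m1]_s (`|b s|)%:E < +oo)%E.
Proof.
apply: (@le_lt_trans _ _ (\int[m1]_s (\1_[set s | slab s] s)%:E)%E).
  apply: ge0_le_integral => //.
  - by apply/measurable_EFinP; apply: measurableT_comp.
  - by apply/measurable_EFinP; exact: measurable_indic.
  - move=> s _; rewrite lee_fin indicE mem_setE.
    by rewrite -topredE /=; case: (boolP (slab s)) => h //=; rewrite bM ?normr0.
by rewrite integral_indic // setIT.
Qed.

(** For fixed w this is Fubini on X * X for H(t, w) b(s) c(w) restricted to t < s. It is integrable
    because t |-> |H(t, w)| is, and because b is bounded with support in the slab. *)
Let slice w : m1.-integrable setT (fun t => (H (t, w))%:E) ->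
  (\int[m1]_s (halfline_integral (s, w) * (b s * c w))%:E =
   \int[m1]_t (H (t, w) * (B t * c w))%:E)%E.
Proof.
move=> iHw.
have mHw : measurable_fun setT (fun t => H (t, w)).
  by apply/measurable_EFinP; exact: measurable_int iHw.
pose K (z : X * X) :=
  if lt z.2 z.1 then H (z.2, w) * (b z.1 * c w) else 0.
have mK : measurable_fun setT K.
  apply: measurable_fun_ifT => //.
    apply: (measurableT_comp mlt (g := fun z => (z.2, z.1))).
    by apply: measurable_fun_pair; [exact: measurable_snd|exact: measurable_fst].
  apply: measurable_funM; first by apply: (measurableT_comp mHw); exact: measurable_snd.
  apply: measurable_funM => //.
  by apply: (measurableT_comp mb); exact: measurable_fst.
have Wfin : W w \is a fin_num.
  rewrite ge0_fin_numE //; have /integrableP[_] := iHw.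
  by [].
have iK : (m1 \x m1)%E.-integrable setT (EFin \o K).
  apply/integrable12ltyP; first exact/measurable_EFinP.
  apply: (@le_lt_trans _ _ (\int[m1]_s ((`|b s|)%:E * W w))%E).
    apply: ge0_le_integral => //.
    - by move=> s _; exact: integral_ge0.
    - apply: (measurable_fun_fubini_tonelli_F (abse \o (EFin \o K))) => //.
      by apply: measurableT_comp => //; exact/measurable_EFinP.
      by move=> x /=; rewrite lee_fin.
    - rewrite [X in measurable_fun _ X](_ : _ = (fun s => W w * (`|b s|)%:E)%E); last first.
        by apply/funext => s; rewrite muleC.
      by apply: measurable_funeM; apply/measurable_EFinP; apply: measurableT_comp.
    - move=> s _; rewrite /W -ge0_integralZl //; last first.
        by apply/measurable_EFinP; apply: measurableT_comp.
      apply: ge0_le_integral => //.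
      + apply/measurable_EFinP; apply: measurableT_comp => //.
        by apply: (measurableT_comp mK); exact: pair1_measurable.
      + apply: measurable_funeM.
        by apply/measurable_EFinP; apply: measurableT_comp.
      + move=> t _; rewrite /K /= -EFinM lee_fin.
        case: ifP => _; last by rewrite normr0 mulr_ge0.
        rewrite !normrM mulrCA ler_wpM2l // -[leRHS]mulr1 ler_wpM2l //.
  rewrite ge0_integralZr //; last by apply/measurable_EFinP; apply: measurableT_comp.
  have b0 : (0 <= \int[m1]_s (`|b s|)%:E)%E by exact: integral_ge0.
  by apply: lte_mul_pinfty => //; [rewrite ge0_fin_numE|rewrite -ge0_fin_numE].
transitivity (\int[m1]_s \int[m1]_t (K (s, t))%:E)%E.
  apply: eq_integral => s _.
  have [sM|/bM bs] := boolP (slab s); last first.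
    rewrite bs mul0r mulr0 integral0_eq // => t _.
    by rewrite /K /= bs mul0r mulr0 if_same.
  have is_ : m1.-integrable setT (fun t => (halfline_integrand (s, w, t))%:E).
    apply: le_integrable iHw => //.
      apply/measurable_EFinP; apply: (measurableT_comp measurable_halfline_integrand).
      exact: pair1_measurable.
    by move=> t _; rewrite lee_fin /halfline_integrand /=; case: ifP => // _; rewrite normr0.
  have fin := integrable_fin_num measurableT is_.
  rewrite EFinM /halfline_integral fineK // muleC -integralZl //.
  apply: eq_integral => t _; rewrite /halfline_integrand /K /= sM /= -EFinM.
  by case: ifP => _; [rewrite mulrC|rewrite mulr0].
rewrite (Fubini iK); apply: eq_integral => t _.
transitivity ((H (t, w) * c w)%:E * \int[m1]_s (if lt t s then b s else 0)%:E)%E.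
  rewrite -integralZl //.
    apply: eq_integral => s _; rewrite /K /= -EFinM.
    by case: ifP => _; [congr EFin; ring|rewrite mulr0].
  have ms : measurable_fun setT (fun s => if lt t s then b s else 0).
    apply: measurable_fun_ifT => //; apply: (measurableT_comp mlt (g := fun s => (t, s))).
    exact: pair1_measurable.
  apply/integrableP; split; first exact/measurable_EFinP.
  apply: le_lt_trans int_b; apply: ge0_le_integral => //.
  - by apply/measurable_EFinP; apply: measurableT_comp.
  - by apply/measurable_EFinP; apply: measurableT_comp.
  - by move=> s _; rewrite lee_fin; case: ifP => // _; rewrite normr0.
by rewrite -BE -EFinM; congr EFin; ring.
Qed.

(** Almost every slice of the integrable H is integrable, so [slice] holds for almost every w and
    the outer integrals agree. *)
Lemma halfline_integral_by_parts :
  (\int[mu]_z (halfline_integral z * (b z.1 * c z.2))%:E =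
   \int[mu]_z (H z * (B z.1 * c z.2))%:E)%E.
Proof.
have mb1 : measurable_fun setT (fun z : X * Y => b z.1).
  by apply: (measurableT_comp mb); exact: measurable_fst.
have mB1 : measurable_fun setT (fun z : X * Y => B z.1).
  by apply: (measurableT_comp mB); exact: measurable_fst.
have mc2 : measurable_fun setT (fun z : X * Y => c z.2).
  by apply: (measurableT_comp mc); exact: measurable_snd.
have iV : mu.-integrable setT (fun z => (halfline_integral z * (b z.1 * c z.2))%:E).
  apply: le_integrable integrable_halfline_integral => //.
    apply/measurable_EFinP; apply: measurable_funM.
      by apply/measurable_EFinP; exact: measurable_int integrable_halfline_integral.
    exact: measurable_funM.
  move=> z _; rewrite lee_fin normrM -[leRHS]mulr1 ler_wpM2l //.
  by rewrite normrM mulr_ile1.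
have iB : mu.-integrable setT (fun z => (H z * (B z.1 * c z.2))%:E).
  apply: (@le_integrable _ _ _ _ _ _ _ (fun z => C%:E * (H z)%:E)%E) => //.
  - apply/measurable_EFinP; apply: measurable_funM; first exact: measurable_halfline_fun.
    exact: measurable_funM.
  - move=> z _; rewrite -EFinM lee_fin !normrM mulrC ler_wpM2r //.
    rewrite -[leRHS]mulr1 ler_pM //.
    exact: le_trans (BC z.1) (ler_norm _).
  - exact: integrableZl.
rewrite -(integral21_prod_meas1 iV) -(integral21_prod_meas1 iB).
apply: ae_eq_integral => //.
- exact: measurable_fubini_G iV.
- exact: measurable_fubini_G iB.
have := ae_integrable2 iH; apply: filterS => w iHw _.
exact: slice.
Qed.

End halfline.

(** B is the total integral of b minus the primitive of b from -oo. It is smooth with derivative -b,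
    but constant and possibly nonzero far to the left: it needs a cutoff before it can serve as a
    test function. *)
Lemma smooth1_tail_integral (R : realType) (b : R -> R) (l r : R) : smooth1 b ->
    (forall t, ~~ (l <= t <= r) -> b t = 0) ->
  exists B : R -> R, [/\ smooth1 B, forall t : R, is_derive t 1 B (- b t),
    forall t, (B t)%:E =
      (\int[@lebesgue_measure R]_s (if t < s then b s else 0)%:E)%E &
    exists C, forall t, `|B t| <= C].
Proof.
move=> sb b0; have cb := smooth1_continuous sb.
pose lam := @lebesgue_measure R.
have ib : lam.-integrable setT (EFin \o b).
  have -> : EFin \o b = (EFin \o b) \_ `[l, r].
    apply/funext => x; rewrite patchE; case: ifPn => //.
    by rewrite notin_setE /= in_itv /= => /negP/b0 ->.
  rewrite -integrable_mkcond //; apply: continuous_compact_integrable.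
    exact: segment_compact.
  exact: continuous_subspaceT.
pose P x := \int[lam]_(s in `]-oo, x]) b s.
have dP (t : R) : is_derive t 1 P (b t) by exact: (is_derive_primitive cb b0 t).
have sP : smooth1 P := smooth1_primitive sb dP.
pose B t := \int[lam]_s b s + -1 * P t.
have iS (A : set (measurableTypeR R)) : measurable A -> lam.-integrable A (EFin \o b).
  by move=> mA; exact: integrableS ib.
have BE t : (B t)%:E = (\int[lam]_s (if t < s then b s else 0)%:E)%E.
  transitivity (\int[lam]_(s in `]t, +oo[) (b s)%:E)%E; last first.
    rewrite integral_mkcond; apply: eq_integral => s _.
    by rewrite patchE mem_setE in_itv /= andbT; case: ifP.
  rewrite -(fineK (integrable_fin_num _ (iS _ _))) //; congr EFin.
  have -> : B t = \int[lam]_s b s - P t by rewrite /B mulN1r.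
  have E : [set: measurableTypeR R] = `]-oo, t]%classic `|` `]t, +oo[%classic.
    by apply/seteqP; split => // x _ /=; rewrite !in_itv /= andbT; case: (leP x t); [left|right].
  rewrite E Rintegral_setU //.
  - by rewrite addrC addKr.
  - by rewrite -E.
  - apply/disj_setPS => x [] /=; rewrite !in_itv /= andbT => xt tx.
    by move: (le_lt_trans xt tx); rewrite ltxx.
exists B; split => //.
- apply: (@smooth1D _ (cst (\int[lam]_s b s)) (cst (-1) \* P)); first exact: smooth1_cst.
  by apply: smooth1M => //; exact: smooth1_cst.
- move=> t; have h := is_deriveD (is_derive_cst (\int[lam]_s b s : R) t 1) (is_deriveZ (-1) (dP t)).
  apply: (is_derive_eq h).
  by rewrite add0r /GRing.scale /= mulN1r.
have fin : (\int[lam]_s `|(b s)%:E| \is a fin_num)%E.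
  by rewrite ge0_fin_numE; [case/integrableP: ib|exact: integral_ge0].
exists (fine (\int[lam]_s `|(b s)%:E|)%E) => t.
rewrite -lee_fin fineK // -[leLHS]/(`|(B t)%:E|%E) BE.
have mb := measurable_int _ ib.
have mt : measurable_fun setT (fun s : measurableTypeR R => (if t < s then b s else 0)%:E).
  apply/measurable_EFinP; apply: measurable_fun_ifT => //; last exact/measurable_EFinP.
  by apply: measurable_fun_ltr.
apply: le_trans (le_abse_integral _ _ mt) _ => //.
apply: ge0_le_integral => //.
- exact: measurableT_comp.
- exact: measurableT_comp.
- by move=> s _; rewrite lee_fin; case: ifP => // _; rewrite normr0.
Qed.

Lemma partial_invariant (R : realType) n (f : 'rV[R]_n -> R) i v :
  (forall h : R, f (h *: delta_mx ord0 i + v) = f v) -> partial i f v = 0.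
Proof.
move=> fv; rewrite /partial /derive.
rewrite (_ : (fun h : R => _) = cst 0); first exact: lim_cst.
by apply/funext => h /=; rewrite fv subrr scaler0.
Qed.

(** * Integrals on R^(m+1) as integrals on a product *)

Section cons_transfer.
Variables (R : realType) (m : nat).
Local Notation lam := (@lebesgue_measure R).
Local Notation mu := (@lebesgue_rV R m.+1).
Local Notation mum := (@lebesgue_rV R m).
Local Notation cns := (@cons_rV R m).

Definition uncons_rV (v : 'rV[R]_m.+1) : measurableTypeR R * 'rV[R]_m :=
  (v ord0 ord0, rsubmx (v : 'rV_(1 + m))).

Lemma lshift_ord0 : lshift m (ord0 : 'I_1) = (ord0 : 'I_m.+1).
Proof. exact: val_inj. Qed.

Lemma cons_rV0 z : cns z ord0 ord0 = z.1.
Proof. by rewrite /cons_rV -lshift_ord0 (@row_mxEl _ 1 1 m) mxE. Qed.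

Lemma cons_rVS z j : cns z ord0 (rshift 1 j) = z.2 ord0 j.
Proof. by rewrite /cons_rV (@row_mxEr _ 1 1 m). Qed.

Lemma cons_rVK z : uncons_rV (cns z) = z.
Proof.
by case: z => x v; rewrite /uncons_rV cons_rV0; congr pair; rewrite /cons_rV/= row_mxKr.
Qed.

Lemma measurable_cons_rV : measurable_fun setT cns.
Proof.
apply: measurable_fun_rV => i; have [j ->|j ->] := @split_ordP 1 m i.
  rewrite (ord1 j) lshift_ord0 [X in measurable_fun _ X](_ : _ = fst) //.
  by apply/funext => z; rewrite cons_rV0.
rewrite [X in measurable_fun _ X](_ : _ = (fun v : 'rV[R]_m => v ord0 j) \o snd).
  by apply: measurableT_comp; [exact: measurable_coord|exact: measurable_snd].
by apply/funext => z; rewrite cons_rVS.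
Qed.

Lemma measurable_uncons_rV : measurable_fun setT uncons_rV.
Proof.
apply/measurable_fun_pairP; split => /=; first exact: measurable_coord.
apply: measurable_fun_rV => i /=.
rewrite [X in measurable_fun _ X](_ : _ = fun v : 'rV[R]_m.+1 => v ord0 (rshift 1 i)).
  exact: measurable_coord.
by apply/funext => v; rewrite mxE.
Qed.

Lemma ge0_integral_cons_rV (f : 'rV[R]_m.+1 -> \bar R) : measurable_fun setT f ->
  (forall v, 0 <= f v)%E ->
  (\int[mu]_v f v = \int[lam \x mum]_z f (cns z))%E.
Proof.
move=> mf f0; rewrite (_ : \int[mu]_v f v = \int[pushforward (lam \x mum) cns]_v f v)%E.
  by rewrite (ge0_integral_pushforward measurable_cons_rV).
by apply: eq_measure_integral => [|? A mA _ //]; exact: measurable_cons_rV.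
Qed.

Lemma integrable_cons_rV (f : 'rV[R]_m.+1 -> \bar R) : measurable_fun setT f ->
  mu.-integrable setT f <-> (lam \x mum)%E.-integrable setT (f \o cns).
Proof.
move=> mf; split => /integrableP[_ fi]; apply/integrableP; split => //.
- by apply: measurableT_comp => //; exact: measurable_cons_rV.
- by move: fi; rewrite ge0_integral_cons_rV //; exact: measurableT_comp.
- by rewrite ge0_integral_cons_rV //; exact: measurableT_comp.
Qed.

Lemma integral_cons_rV (f : 'rV[R]_m.+1 -> \bar R) : mu.-integrable setT f ->
  (\int[mu]_v f v = \int[lam \x mum]_z f (cns z))%E.
Proof.
move=> fi; have mf := measurable_int _ fi; have := fi => /(integrable_cons_rV mf) fi'.
rewrite (_ : \int[mu]_v f v = \int[pushforward (lam \x mum) cns]_v f v)%E.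
  by rewrite (integral_pushforward measurable_cons_rV).
by apply: eq_measure_integral => [|? A mA _ //]; exact: measurable_cons_rV.
Qed.

End cons_transfer.

(** * Integrals along rays in the first coordinate *)

Section representation.
Variables (R : realType) (m : nat).
Local Notation lam := (@lebesgue_measure R).
Local Notation mu := (@lebesgue_rV R m.+1).
Local Notation mum := (@lebesgue_rV R m).
Local Notation cns := (@cons_rV R m).
Variables (Omega : set 'rV[R]_m.+1) (M : R).
Hypotheses (oO : open Omega)
  (OM : Omega `<=` obox (const_mx (- M)) (const_mx M)).

Let mO : measurable Omega := measurable_open_rV oO.

Definition in_slab (s : measurableTypeR R) : bool := - M < s < M.
Definition left_of (t s : measurableTypeR R) : bool := t < s.

Lemma measurable_in_slab : measurable_fun setT in_slab.
Proof. by apply: measurable_and; apply: measurable_fun_ltr. Qed.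

Lemma measurable_left_of :
  measurable_fun setT (fun z : measurableTypeR R * measurableTypeR R => left_of z.1 z.2).
Proof. by apply: measurable_fun_ltr; [exact: measurable_fst|exact: measurable_snd]. Qed.

Lemma in_slab_lty : (lam [set s | in_slab s] < +oo)%E.
Proof.
rewrite (_ : [set s | in_slab s] = `]- M, M[%classic).
  by rewrite lebesgue_measure_itv /=; case: ifP => _ //; rewrite -EFinB ltry.
by apply/seteqP; split => s /=; rewrite in_itv.
Qed.

(** The ray comes from the left and ends at [v]. Outside the slab the value is 0, which keeps the
    function integrable. *)
Definition ray_integral (h : 'rV[R]_m.+1 -> R) (v : 'rV[R]_m.+1) : R :=
  halfline_integral lam in_slab left_of (h \o cns) (uncons_rV v).

Lemma integrable_ray_integral h : mu.-integrable setT (EFin \o h) ->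
  mu.-integrable setT (EFin \o ray_integral h).
Proof.
move=> ih; have mh := measurable_int _ ih.
have ih' : (lam \x mum)%E.-integrable setT (EFin \o (h \o cns)).
  exact: ((integrable_cons_rV mh).1 ih).
have mV : measurable_fun setT (halfline_integral lam in_slab left_of (h \o cns)).
  by apply: (@measurable_halfline_integral _ _ _ _ _ lam mum) => //;
    [exact: measurable_in_slab|exact: measurable_left_of].
apply/integrable_cons_rV.
  apply/measurable_EFinP; apply: (measurableT_comp mV).
  exact: measurable_uncons_rV.
rewrite (_ : _ \o _ = EFin \o halfline_integral lam in_slab left_of (h \o cns)).
  apply: integrable_halfline_integral => //;
  [exact: measurable_in_slab|exact: measurable_left_of|exact: in_slab_lty].
by apply/funext => z /=; rewrite /ray_integral cons_rVK.
Qed.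

Lemma ray_integral_by_parts (h : 'rV[R]_m.+1 -> R) (b B : R -> R) (c : 'rV[R]_m -> R) (C : R) :
  mu.-integrable setT (EFin \o h) ->
  continuous b -> continuous B -> continuous c ->
  (forall s, `|b s| <= 1) -> (forall w, `|c w| <= 1) -> (forall t, `|B t| <= C) ->
  (forall s, ~~ (- M < s < M) -> b s = 0) ->
  (forall t, (B t)%:E = \int[lam]_s (if (t < s)%R then b s else 0)%:E)%E ->
  (\int[mu]_v (ray_integral h v * (b (v ord0 ord0) * c (uncons_rV v).2))%:E =
   \int[mu]_v (h v * (B (v ord0 ord0) * c (uncons_rV v).2))%:E)%E.
Proof.
move=> ih cb cB cc b1 c1 BC bM BE; have mh := measurable_int _ ih.
have ih' : (lam \x mum)%E.-integrable setT (EFin \o (h \o cns)).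
  exact: ((integrable_cons_rV mh).1 ih).
have mb : measurable_fun [set: measurableTypeR R] b by exact: continuous_measurable_fun.
have mB : measurable_fun [set: measurableTypeR R] B by exact: continuous_measurable_fun.
have mc := continuous_measurable_rV cc.
have m0 := @measurable_coord R m.+1 ord0.
have mb' : measurable_fun setT (fun v : 'rV[R]_m.+1 => b (v ord0 ord0)).
  exact: (measurableT_comp mb m0).
have mB' : measurable_fun setT (fun v : 'rV[R]_m.+1 => B (v ord0 ord0)).
  exact: (measurableT_comp mB m0).
have mc' : measurable_fun setT (fun v : 'rV[R]_m.+1 => c (uncons_rV v).2).
  apply: (measurableT_comp mc); apply: measurableT_comp; first exact: measurable_snd.
  exact: measurable_uncons_rV.
have iV := integrable_ray_integral ih.
rewrite integral_cons_rV; last first.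
  apply: le_integrable iV => //.
    apply/measurable_EFinP; apply: measurable_funM; last exact: measurable_funM.
    by apply/measurable_EFinP; exact: measurable_int (integrable_ray_integral ih).
  move=> v _; rewrite lee_fin normrM -[leRHS]mulr1 ler_wpM2l //.
  by rewrite normrM mulr_ile1.
rewrite integral_cons_rV; last first.
  apply: (@le_integrable _ _ _ _ _ _ _ (fun z => C%:E * (h z)%:E)%E) => //.
  - apply/measurable_EFinP; apply: measurable_funM; first exact/measurable_EFinP.
    exact: measurable_funM.
  - move=> z _; rewrite -EFinM lee_fin !normrM mulrC ler_wpM2r //.
    rewrite -[leRHS]mulr1 ler_pM //.
    exact: le_trans (BC _) (ler_norm _).
  - exact: integrableZl.
rewrite (_ : (\int[_]_z (ray_integral h (cns z) * _)%:E)%E =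
  (\int[lam \x mum]_z (halfline_integral lam in_slab left_of (h \o cns) z *
     (b z.1 * c z.2))%:E)%E); last first.
  by apply: eq_integral => z _; rewrite /ray_integral cons_rVK cons_rV0.
rewrite (@halfline_integral_by_parts _ _ _ _ _ lam mum in_slab left_of _ _ _ _ _
  b B c C) //.
- by apply: eq_integral => z _; rewrite cons_rVK cons_rV0.
- exact: measurable_in_slab.
- exact: measurable_left_of.
- exact: in_slab_lty.
Qed.

End representation.

(** * Compactly supported functions as ray integrals *)

Section weak_gradient_representation.
Variables (R : realType) (m : nat).
Local Notation lam := (@lebesgue_measure R).
Local Notation mu := (@lebesgue_rV R m.+1).
Local Notation cns := (@cons_rV R m).

Lemma smooth_rV_tail (c : 'rV[R]_m -> R) : smooth_rV c ->
  smooth_rV (fun v : 'rV[R]_m.+1 => c (uncons_rV v).2).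
Proof.
elim=> {c} [c|j f sf|f g sf IHf sg IHg|f g sf IHf sg IHg].
- exact: smooth_rV_cst.
- rewrite (_ : (fun v => _) = (fun v : 'rV[R]_m.+1 => f (v ord0 (rshift 1 j)))).
    exact: smooth_rV_coord.
  by apply/funext => v; rewrite /uncons_rV /= mxE.
- exact: smooth_rVD IHf IHg.
- exact: smooth_rVM IHf IHg.
Qed.

Lemma partial_tail (c : 'rV[R]_m -> R) v :
  partial ord0 (fun v : 'rV[R]_m.+1 => c (uncons_rV v).2) v = 0.
Proof.
apply: partial_invariant => h; congr c; rewrite /uncons_rV /=.
apply/rowP => j; rewrite !mxE eqxx /=.
by rewrite mulr0 add0r.
Qed.

Lemma rV_bump_cons k (a b v : 'rV[R]_m.+1) :
  rV_bump k a b v = bump1 k (a ord0 ord0) (b ord0 ord0) (v ord0 ord0) *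
    rV_bump k (uncons_rV a).2 (uncons_rV b).2 (uncons_rV v).2.
Proof.
rewrite /rV_bump big_ord_recl; congr (_ * _).
apply: eq_bigr => j _; rewrite /uncons_rV /= !mxE.
by rewrite (_ : rshift 1 j = lift ord0 j) //; exact: val_inj.
Qed.

Variables (Omega : set 'rV[R]_m.+1) (M : R).
Hypotheses (oO : open Omega)
  (OM : Omega `<=` obox (const_mx (- M)) (const_mx M)).

(* With eta a cutoff equal to 1 near the support of u, testing with eta times the
   tail integral of a bump in the first coordinate shows that u and the ray integral
   of h = eta * G_0 have the same integral against every bump. *)
Lemma weak_gradient_ray_integral (u : 'rV[R]_m.+1 -> R) G :
  is_weak_gradient Omega u G -> compactly_supported Omega u ->
  exists h : 'rV[R]_m.+1 -> R, [/\ mu.-integrable setT (EFin \o h),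
    forall v, Omega v -> `|h v| <= `|G v ord0 ord0|,
    forall v, ~ Omega v -> h v = 0 &
    ae_eq mu Omega u (ray_integral M h)].
Proof.
move=> [lu lG wG] [K [cK KO uK]].
have mO : measurable Omega := measurable_open_rV oO.
have [eta seta [eta01 [K' cK' [K'O etaK']] eta1]] := smooth_cutoff oO cK KO.
have ceta := smooth_rV_continuous seta.
have eta0 v : ~ K' v -> eta v = 0.
  by move=> nv; apply/eqP; apply/negP => /negP /etaK'.
have etaK v : K v -> eta v = 1 by move=> /eta1 /nbhs_singleton.
pose h := (fun v => G v ord0 ord0 * eta v) \_ Omega.
have iG : mu.-integrable Omega (EFin \o (fun v => G v ord0 ord0 * eta v)).
  exact: (L1locM_integrable mO (lG ord0) ceta cK' K'O eta0).
have EFin_patch (f : 'rV[R]_m.+1 -> R) : EFin \o (f \_ Omega) = (EFin \o f) \_ Omega.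
  by apply/funext => v; rewrite /= !patchE; case: ifP.
have ih : mu.-integrable setT (EFin \o h).
  by rewrite /h EFin_patch -integrable_mkcond.
(* [u] is only assumed locally integrable, but it agrees almost everywhere with u * eta. *)
have iu : mu.-integrable Omega (EFin \o u).
  have /integrableP[muu luu] := L1locM_integrable mO lu ceta cK' K'O eta0.
  have mu1 : measurable_fun Omega (EFin \o u) by apply/measurable_EFinP; exact: lu.1.
  apply/integrableP; split => //.
  apply: le_lt_trans luu; rewrite le_eqVlt; apply/orP; left; apply/eqP.
  apply: ge0_ae_eq_integral => //.
  - exact: measurableT_comp.
  - exact: measurableT_comp.
  move: uK; apply: filterS => v huK Ov /=.
  have [Kv|nKv] := pselect (K v); first by rewrite etaK // mulr1.
  by rewrite (huK (conj Ov nKv)) mul0r.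
pose ut := u \_ Omega.
have iut : mu.-integrable setT (EFin \o ut).
  by rewrite /ut EFin_patch -integrable_mkcond.
have iV := integrable_ray_integral M ih.
exists h; split => //.
- move=> v Ov; rewrite /h patchE mem_set // normrM -[leRHS]mulr1 ler_wpM2l //.
  by have /andP[e0 e1] := eta01 v; rewrite ger0_norm.
- by move=> v nOv; rewrite /h patchE memNset.
pose U := obox (const_mx (- M)) (const_mx M) : set 'rV[R]_m.+1.
have oU : open U := @open_obox _ _ _ _.
have mU : measurable U := measurable_open_rV oU.
pose g v := ut v - ray_integral M h v.
have ig : mu.-integrable setT (EFin \o g).
  have := integrableB measurableT iut iV.
  by apply: eq_integrable.
suff : ae_eq mu U g (cst 0).
  apply: filterS => v gv Ov; have := gv (OM Ov).
  by rewrite /g /ut patchE mem_set // => /eqP; rewrite subr_eq0 => /eqP.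
apply: (fundamental_lemma oU).
  split.
    by apply/measurable_EFinP; apply: measurable_funTS; exact: measurable_int ig.
  by move=> C cC _; apply: integrableS ig => //; exact: measurable_compact_rV.
move=> k a b abU; set psi := rV_bump k%:R a b.
have psi0 v : ~ U v -> psi v = 0.
  move=> nU; apply: bump_eq0 => // abv; apply: nU; apply: abU.
  exact: sub_obox_cbox.
rewrite Rintegral_mkcond (_ : _ \_ U = (fun v => ut v * psi v - ray_integral M h v * psi v)); last first.
  apply/funext => v; rewrite patchE; case: ifPn => [_|]; first by rewrite /g mulrBl.
  by move=> nU; rewrite psi0 ?mulr0 ?subr0 // => Uv; move: nU; rewrite mem_set.
have mpsi : measurable_fun setT psi.
  exact: continuous_measurable_rV (smooth_rV_continuous (smooth_rV_bump _ _ _)).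
have ipsi (f : 'rV[R]_m.+1 -> R) : mu.-integrable setT (EFin \o f) ->
    mu.-integrable setT (EFin \o (fun v => f v * psi v)).
  move=> fi; have fi' := fi; apply: le_integrable fi' => //.
    apply/measurable_EFinP; apply: measurable_funM => //.
    by apply/measurable_EFinP; exact: measurable_int fi.
  move=> v _; rewrite lee_fin normrM -[leRHS]mulr1 ler_wpM2l //.
  by rewrite ger0_norm ?bump_ge0 // bump_le1.
rewrite RintegralB; [|exact: measurableT|exact: ipsi|exact: ipsi].
(* A box with reversed corners is empty, so its inclusion in [U] does not locate the corners; but
   then the bump is identically 0. *)
have [abne|abe] := pselect (forall i, a ord0 i <= b ord0 i); last first.
  have psi00 v : psi v = 0.
    apply: bump_eq0 => // abv; apply: abe => i.
    by have /andP[h1 h2] := abv i; exact: ltW (lt_trans h1 h2).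
  by rewrite /Rintegral !integral0_eq ?subrr // => v _; rewrite psi00 mulr0.
pose b1 := bump1 k%:R (a ord0 ord0) (b ord0 ord0).
pose c := rV_bump k%:R (uncons_rV a).2 (uncons_rV b).2.
have sb1 : smooth1 b1 := smooth1_bump1 _ _ _.
have sc : smooth_rV c := smooth_rV_bump _ _ _.
have psiE v : psi v = b1 (v ord0 ord0) * c (uncons_rV v).2 by exact: rV_bump_cons.
have b1ab s : ~~ (a ord0 ord0 <= s <= b ord0 ord0) -> b1 s = 0.
  move=> sab; apply: bump1_eq0 => //; apply: contra sab.
  by move=> /andP[/ltW-> /ltW->].
have [B [sB dB BE [C BC]]] := smooth1_tail_integral sb1 b1ab.
pose Psi (v : 'rV[R]_m.+1) := B (v ord0 ord0) * c (uncons_rV v).2.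
have sB' : smooth_rV (fun v : 'rV[R]_m.+1 => B (v ord0 ord0)) by exact: smooth_rV_coord.
have sc' := smooth_rV_tail sc.
have sPsi : smooth_rV Psi := smooth_rVM sB' sc'.
have dPsi v : partial ord0 Psi v = - psi v.
  rewrite /Psi (partialM _ _ sB' sc') partial_tail mulr0 add0r psiE.
  have := is_derive_coord (ord0 : 'I_m.+1) (dB (v ord0 ord0)).
  rewrite eqxx => hB.
  have -> : partial ord0 (fun w : 'rV[R]_m.+1 => B (w ord0 ord0)) v =
      - b1 (v ord0 ord0) by case: hB.
  by rewrite mulrN mulrC.
(* [Psi] need not vanish to the left of the bump; the cutoff makes it admissible. *)
have tPsi : test_fun Omega (eta \* Psi).
  apply: (smooth_rV_test_fun (smooth_rVM seta sPsi) cK' K'O) => v /=.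
  by apply: contraPP => /eta0 ->; rewrite mul0r eqxx.
have E1 : \int[mu]_v (ray_integral M h v * psi v) = \int[mu]_v (h v * Psi v).
  rewrite /Rintegral; congr fine.
  rewrite -(@ray_integral_by_parts _ _ M h b1 B c C ih) //.
  - by apply: eq_integral => v _; rewrite psiE.
  - exact: smooth1_continuous.
  - exact: smooth1_continuous.
  - exact: smooth_rV_continuous.
  - by move=> s; rewrite ger0_norm ?bump1_ge0 // bump1_le1.
  - by move=> w; rewrite ger0_norm ?bump_ge0 // bump_le1.
  - move=> s; apply: contraNeq => b1s.
    have /andP[as_ sb] : a ord0 ord0 <= s <= b ord0 ord0 by apply: contraNT b1s => /b1ab ->.
    have /andP[Ma _] : - M < a ord0 ord0 < M.
      have := abU a _ ord0; rewrite !mxE; apply=> i; by rewrite lexx abne.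
    have /andP[_ Mb] : - M < b ord0 ord0 < M.
      have := abU b _ ord0; rewrite !mxE; apply=> i; by rewrite lexx abne.
    by rewrite (lt_le_trans Ma as_) (le_lt_trans sb Mb).
have E2 : \int[mu]_v (ut v * psi v) = \int[mu]_(v in Omega) (u v * psi v).
  rewrite [RHS]Rintegral_mkcond; apply: eq_Rintegral => v _.
  by rewrite /ut !patchE; case: ifP => // _; rewrite mul0r.
have E3 : \int[mu]_v (h v * Psi v) = \int[mu]_(v in Omega) (G v ord0 ord0 * (eta \* Psi) v).
  rewrite [RHS]Rintegral_mkcond; apply: eq_Rintegral => v _.
  by rewrite /h !patchE; case: ifP => // _; rewrite ?mul0r //= mulrA.
have ipO : mu.-integrable Omega (EFin \o (fun v => u v * psi v)).
  have := ipsi _ iut; rewrite integrable_mkcond // => /integrableP[mm ll].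
  rewrite integrable_mkcond //; apply/integrableP.
  rewrite (_ : _ \_ Omega = ((EFin \o (fun v => ut v * psi v)) \_ setT)) //.
  apply/funext => v; rewrite !patchE in_setT /= /ut patchE.
  by case: ifP => // _; rewrite mul0r.
(* Off [K] the function u vanishes almost everywhere. On [K] the cutoff is 1 nearby, so its
   derivative is 0 and the partial derivative of the product is -psi. *)
have E4 : \int[mu]_(v in Omega) (u v * partial ord0 (eta \* Psi) v) =
    - \int[mu]_(v in Omega) (u v * psi v).
  rewrite -[RHS]mulN1r -RintegralZl //.
  rewrite /Rintegral; congr fine; apply: ae_eq_integral => //.
  - exact: measurable_int (L1loc_partial_integrable ord0 oO lu tPsi).
  - apply/measurable_EFinP; apply: measurable_funM => //.
    by apply/measurable_EFinP; exact: measurable_int ipO.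
  move: uK; apply: filterS => v huK Ov; congr EFin.
  have [Kv|nKv] := pselect (K v); last by rewrite (huK (conj Ov nKv)) !mul0r mulr0.
  rewrite (partialM _ _ seta sPsi) dPsi etaK //.
  rewrite [X in _ + _ * X](_ : _ = 0) ?mulr0 ?addr0; first by ring.
  rewrite /partial (@near_eq_derive _ _ _ eta (cst 1)) ?derive_val //.
  by move: (eta1 v Kv).
rewrite E1 E2 E3.
have := wG ord0 _ tPsi; rewrite E4 => /oppr_inj ->.
by rewrite subrr.
Qed.

End weak_gradient_representation.

(** Hölder's inequality up to the constant: [le_eps_powR] is integrated over D and [th] is chosen to
    make both terms equal, whence the factor 2 inside the q-th power. *)
Lemma le_powR_integral d (T : measurableType d) (R : realType)
    (mu : {measure set T -> \bar R}) (D : set T) (f : T -> R) (q L w : R) :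
  1 < q -> 0 < L -> measurable D -> (mu D <= L%:E)%E -> measurable_fun setT f ->
  (forall x, 0 <= f x) -> (forall x, ~ D x -> f x = 0) -> 0 <= w ->
  (w%:E <= \int[mu]_x (f x)%:E)%E ->
  ((w `^ q)%:E <= (2 `^ q * L `^ (q - 1))%:E * \int[mu]_x (f x `^ q)%:E)%E.
Proof.
move=> q1 L0 mD muD mf f0 fD w0 wf.
have c0 : 0 < 2 `^ q * L `^ (q - 1) by rewrite mulr_gt0 // powR_gt0.
have mfq : measurable_fun setT (fun x => f x `^ q).
  exact: (measurableT_comp (measurable_powR q) mf).
have A0 : (0 <= \int[mu]_x (f x `^ q)%:E)%E.
  by apply: integral_ge0 => x _; rewrite lee_fin powR_ge0.
have key th : 0 < th ->
    (w%:E <= (th * L)%:E + (th `^ (q - 1))^-1%:E * \int[mu]_x (f x `^ q)%:E)%E.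
  move=> th0; apply: le_trans wf _.
  have T0 : 0 < th `^ (q - 1) by rewrite powR_gt0.
  apply: (@le_trans _ _ (\int[mu]_x ((th * \1_D x)%:E +
      (th `^ (q - 1))^-1%:E * (f x `^ q)%:E))%E).
    apply: ge0_le_integral => //.
    - by move=> x _; rewrite lee_fin.
    - exact/measurable_EFinP.
    - apply: emeasurable_funD.
        by apply/measurable_EFinP; apply: measurable_funM => //; exact: measurable_indic.
      by apply: measurable_funeM; exact/measurable_EFinP.
    - move=> x _; rewrite -EFinM -EFinD lee_fin indicE.
      have [Dx|nDx] := pselect (D x).
        by rewrite mem_set // mulr1 mulrC; apply: le_eps_powR => //; exact: ltW.
      rewrite fD // memNset // mulr0 add0r mulr_ge0 ?powR_ge0 // invr_ge0 ltW //.
  rewrite ge0_integralD //; last 4 first.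
  - by move=> x _; rewrite lee_fin mulr_ge0 // ltW.
  - by apply/measurable_EFinP; apply: measurable_funM => //; exact: measurable_indic.
  - by move=> x _; rewrite -EFinM lee_fin mulr_ge0 ?powR_ge0 // invr_ge0 ltW.
  - by apply: measurable_funeM; exact/measurable_EFinP.
  apply: leeD; last first.
    rewrite ge0_integralZl //.
    - exact/measurable_EFinP.
    - by move=> x _; rewrite lee_fin powR_ge0.
    - by rewrite lee_fin invr_ge0 ltW.
  under eq_integral do rewrite EFinM.
  rewrite ge0_integralZl //; last 2 first.
  - by apply/measurable_EFinP; exact: measurable_indic.
  - by rewrite lee_fin ltW.
  rewrite integral_indic // setIT EFinM; apply: lee_wpmul2l => //.
  by rewrite lee_fin ltW.
have [->|Afin] := eqVneq (\int[mu]_x (f x `^ q)%:E)%E +oo%E.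
  by rewrite gt0_muley ?leey // lte_fin.
have {}Afin : (\int[mu]_x (f x `^ q)%:E)%E \is a fin_num.
  by rewrite ge0_fin_numE // lt_neqAle Afin leey.
move: key A0; rewrite -(fineK Afin); move: (fine _) => a key.
rewrite lee_fin => a0; rewrite -EFinM lee_fin.
have {}key th : 0 < th -> w <= th * L + a / th `^ (q - 1).
  by move=> /key; rewrite -EFinM -EFinD lee_fin [X in _ + X]mulrC.
have q0 : 0 < q by lra.
(* The balancing value of [th] would be 0 here; th = e / L with arbitrary e replaces it. *)
have [a00|a00] := eqVneq a 0.
  rewrite a00 mulr0; suff -> : w = 0 by rewrite powR0 // gt_eqF.
  apply/eqP; rewrite eq_le w0 andbT; apply/ler_addgt0Pl => e e0; rewrite addr0.
  have := key (e / L) (divr_gt0 e0 L0).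
  by rewrite a00 mul0r addr0 divfK // gt_eqF.
have {a00}a0 : 0 < a by rewrite lt_neqAle eq_sym a00.
have aL : 0 < a / L by rewrite divr_gt0.
(* The solution of th L = a / th^(q - 1). *)
pose th := (a / L) `^ q^-1.
have th0 : 0 < th by rewrite powR_gt0.
have thq : th `^ q = a / L.
  by rewrite /th -powRrM mulVf ?gt_eqF // powRr1 // ltW.
have aE : a / th `^ (q - 1) = th * L.
  have -> : a = th `^ q * L by rewrite thq divfK // gt_eqF.
  rewrite -(@mulr_powRB1 _ th q) ?(ltW th0) //.
  have : th `^ (q - 1) != 0 by rewrite gt_eqF // powR_gt0.
  by move: (_ `^ _) => T0 T0n; field.
have wth : w <= 2 * (th * L) by have := key _ th0; rewrite aE; lra.
have thL : 0 <= th * L by rewrite ltW // mulr_gt0.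
apply: (@le_trans _ _ ((2 * (th * L)) `^ q)).
  by rewrite ge0_ler_powR ?nnegrE //; [exact: ltW|rewrite mulr_ge0].
rewrite powRM // powRM ?(ltW th0) ?(ltW L0) // thq.
rewrite -[leRHS]mulrA ler_pM2l ?powR_gt0 //.
rewrite -(@mulr_powRB1 _ L q) ?(ltW L0) //.
by rewrite mulrA divfK ?gt_eqF // mulrC.
Qed.

Section poincare.
Variables (R : realType) (m : nat).
Local Notation lam := (@lebesgue_measure R).
Local Notation mu := (@lebesgue_rV R m.+1).
Local Notation mum := (@lebesgue_rV R m).
Local Notation cns := (@cons_rV R m).

(** On each line parallel to the first axis, |u|^q is bounded through [le_powR_integral] by the
    integral of |h|^q over that line. Integrating this bound across the slab costs a further factor
    L, the width of the slab. *)
Lemma poincare_compact_support (Omega : set 'rV[R]_m.+1) (q : R) :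
  open Omega -> bounded_set Omega -> 1 < q ->
  exists2 C : R, 0 <= C & forall u G, is_weak_gradient Omega u G ->
    compactly_supported Omega u ->
    (\int[mu]_(x in Omega) (`|u x| `^ q)%:E <=
     C%:E * \int[mu]_(x in Omega) (`|G x ord0 ord0| `^ q)%:E)%E.
Proof.
move=> oO bO q1; have mO := measurable_open_rV oO.
have [M0 M00 OM0] := bounded_sub_cbox bO.
(* Enlarged so that the closed box lies in an open one. *)
pose M := M0 + 1.
have OM : Omega `<=` obox (const_mx (- M)) (const_mx M).
  move=> v /OM0 h i; have := h i; rewrite !mxE /M => /andP[h1 h2].
  by apply/andP; split; lra.
pose L := 2 * M.
have L0 : 0 < L by rewrite /L /M; lra.
have lamL : lam [set s | in_slab M s] = L%:E.
  rewrite (_ : [set s | in_slab M s] = `]- M, M[%classic).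
    rewrite lebesgue_measure_itv /= lte_fin ifT; last by rewrite /M; lra.
    by rewrite -EFinB; congr EFin; rewrite /L; ring.
  by apply/seteqP; split => s /=; rewrite in_itv.
have mS : measurable [set s | in_slab M s].
  rewrite (_ : [set s | in_slab M s] = `]- M, M[%classic).
    exact: measurable_itv.
  by apply/seteqP; split => s /=; rewrite in_itv.
pose c := 2 `^ q * L `^ (q - 1).
have c0 : 0 <= c by rewrite mulr_ge0 // powR_ge0.
exists (L * c); first by rewrite mulr_ge0 // ltW.
move=> u G wG cu; have [h [ih hG h0 uh]] := weak_gradient_ray_integral oO OM wG cu.
have mh := measurable_int _ ih.
have mhr : measurable_fun setT h by exact/measurable_EFinP.
have ih' := (integrable_cons_rV mh).1 ih.
have mh' : measurable_fun setT (h \o cns).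
  by apply: measurableT_comp => //; exact: measurable_cons_rV.
have mhq' : measurable_fun setT (fun z => (`|h (cns z)| `^ q)%:E).
  apply/measurable_EFinP; apply: (measurableT_comp (measurable_powR q)).
  exact: measurableT_comp mh'.
pose A (w : 'rV[R]_m) : \bar R := (\int[lam]_t (`|h (cns (t, w))| `^ q)%:E)%E.
have A0 w : (0 <= A w)%E by apply: integral_ge0 => t _; rewrite lee_fin powR_ge0.
have mA : measurable_fun setT A.
  exact: (measurable_fun_fubini_tonelli_G (fun z => (`|h (cns z)| `^ q)%:E)).
(* Constant along the first coordinate inside the slab, so its integral over a line is L times that
   constant. *)
pose B (v : 'rV[R]_m.+1) : \bar R :=
  if in_slab M (v ord0 ord0) then (c%:E * A (uncons_rV v).2)%E else 0%E.
have B0 v : (0 <= B v)%E by rewrite /B; case: ifP => // _; rewrite mule_ge0 // lee_fin.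
have mB : measurable_fun setT B.
  apply: measurable_fun_ifT => //.
    apply: (measurableT_comp (@measurable_in_slab R M)); exact: measurable_coord.
  apply: measurable_funeM; apply: (measurableT_comp mA).
  by apply: measurableT_comp; [exact: measurable_snd|exact: measurable_uncons_rV].
have mVr : measurable_fun setT (ray_integral M h).
  by apply/measurable_EFinP; exact: measurable_int (integrable_ray_integral M ih).
have mu_ : measurable_fun Omega u by case: wG => -[].
have absq (f : 'rV[R]_m.+1 -> R) (D : set 'rV[R]_m.+1) :
    measurable_fun D f -> measurable_fun D (fun x => (`|f x| `^ q)%:E).
  move=> mf; apply/measurable_EFinP; apply: (measurableT_comp (measurable_powR q)).
  exact: measurableT_comp mf.
apply: (@le_trans _ _ (\int[mu]_(x in Omega) (`|ray_integral M h x| `^ q)%:E)%E).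
  rewrite le_eqVlt; apply/orP; left; apply/eqP.
  apply: ge0_ae_eq_integral => //.
  - exact: absq.
  - by apply: absq; exact: measurable_funTS.
  - by move: uh; apply: filterS => x ux /ux ->.
apply: (@le_trans _ _ (\int[mu]_(x in Omega) B x)%E).
  apply: ge0_le_integral => //.
  - by apply: absq; exact: measurable_funTS.
  - exact: measurable_funTS.
  move=> v Ov; have sv : in_slab M (v ord0 ord0) by have := OM _ Ov ord0; rewrite !mxE.
  rewrite /B sv /c; apply: (@le_powR_integral _ _ _ lam [set s | in_slab M s]
      (fun t => `|h (cns (t, (uncons_rV v).2))|)) => //.
  - by rewrite [X in (X <= _)%E]lamL.
  - apply: measurableT_comp => //; apply: (measurableT_comp mh').
    exact: pair2_measurable.
  - move=> t nt; rewrite h0 ?normr0 // => /OM /(_ ord0).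
    by rewrite cons_rV0 !mxE.
  - apply: (@halfline_integral_le _ _ _ _ _ lam mum) => //.
    + exact: measurable_in_slab.
    + exact: measurable_left_of.
apply: (@le_trans _ _ (\int[mu]_x B x)%E); first exact: ge0_subset_integral.
have mBc : measurable_fun setT (fun z => B (cns z)).
  by apply: (measurableT_comp mB); exact: measurable_cons_rV.
rewrite (ge0_integral_cons_rV mB B0).
rewrite (fubini_tonelli2 (m1 := lam) (m2 := mum) (fun z => B (cns z)) mBc (fun z => B0 (cns z))).
rewrite /fubini_G /= (_ : (fun y => _) = (fun w => (L * c)%:E * A w)%E); last first.
  apply/funext => w; rewrite EFinM -muleA -lamL muleC -integral_cst //.
  rewrite [RHS]integral_mkcond; apply: eq_integral => x _.
  by rewrite patchE mem_setE /B cons_rV0 cons_rVK /=.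
rewrite ge0_integralZl //; last by rewrite lee_fin mulr_ge0 // ltW.
apply: lee_wpmul2l; first by rewrite lee_fin mulr_ge0 // ltW.
have -> : (\int[mum]_w A w = \int[mu]_v (`|h v| `^ q)%:E)%E.
  rewrite (ge0_integral_cons_rV (absq h setT mhr)) //.
  by rewrite (fubini_tonelli2 (m1 := lam) (m2 := mum) _ mhq').
have lG : measurable_fun Omega (fun v => G v ord0 ord0) by case: wG => _ /(_ ord0)[].
have -> : (\int[mu]_(x in Omega) (`|G x ord0 ord0| `^ q)%:E =
    \int[mu]_x ((fun x => (`|G x ord0 ord0| `^ q)%:E) \_ Omega) x)%E.
  by rewrite [LHS](@integral_mkcond _ _ _ mu).
apply: ge0_le_integral => //.
- exact: absq.
- by apply/(measurable_restrictT _ _).1 => //; exact: absq.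
move=> v _; rewrite patchE; case: ifPn => [|nv].
  by rewrite inE => Ov; rewrite lee_fin ge0_ler_powR ?nnegrE ?hG //; lra.
rewrite h0; first by rewrite normr0 powR0 // gt_eqF //; lra.
by move=> Ov; move: nv; rewrite mem_set.
Qed.

End poincare.

(** * Weak gradients *)

Section measurability.
Context d (T : measurableType d) (R : realType).
Implicit Types (D : set T).

Lemma measurable_fun_powR D (f p : T -> R) : measurable D ->
  measurable_fun D f -> measurable_fun D p -> measurable_fun D (fun x => f x `^ p x).
Proof.
move=> mD mf mp; rewrite /powR; apply: measurable_fun_if => //.
- by apply: measurable_fun_eqr.
- have mp' : measurable_fun D (fun x => if p x == 0 then 1 else 0 : R).
    apply: measurable_fun_if => //.
    by apply: measurable_fun_eqr.
  apply: (measurable_funS mD); first exact: subIsetl.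
  by apply: eq_measurable_fun mp' => x _; case: ifP.
- apply: (measurable_funS mD); first exact: subIsetl.
  apply: measurableT_comp => //; apply: measurable_funM => //.
  by apply: measurableT_comp => //; exact: measurable_ln.
Qed.

Lemma measurable_sum_fun n D (F : 'I_n -> T -> R) :
  (forall i, measurable_fun D (F i)) -> measurable_fun D (fun x => \sum_(i < n) F i x).
Proof.
move=> mF; elim: (index_enum _) => [|i s IH].
  rewrite (_ : (fun x => _) = cst 0); first exact: measurable_cst.
  by apply/funext => x; rewrite big_nil.
rewrite (_ : (fun x => _) = F i \+ (fun x => \sum_(j <- s) F j x)).
  exact: measurable_funD.
by apply/funext => x; rewrite big_cons.
Qed.

Lemma measurable_euclid_norm n D (G : T -> 'rV[R]_n) :
  (forall i, measurable_fun D (fun x => G x ord0 i)) ->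
  measurable_fun D (fun x => euclid_norm (G x)).
Proof.
move=> mG; apply: (measurableT_comp (f := @Num.sqrt R)).
  by apply: continuous_measurable_fun; exact: sqrt_continuous.
apply: (@measurable_sum_fun n D (fun i x => G x ord0 i ^+ 2)) => i.
exact: measurable_funX.
Qed.

End measurability.

Section weak_gradient.
Variables (R : realType) (n : nat) (Omega : set 'rV[R]_n).
Local Notation mu := (@lebesgue_rV R n).
Hypothesis oO : open Omega.
Implicit Types (u v : 'rV[R]_n -> R) (G H : 'rV[R]_n -> 'rV[R]_n) (a b : R).

Let mO : measurable Omega := measurable_open_rV oO.

Lemma L1loc_lin a b u v : L1loc Omega u -> L1loc Omega v ->
  L1loc Omega (fun x => a * u x + b * v x).
Proof.
move=> [mu_ iu] [mv iv]; split.
  by apply: measurable_funD; apply: measurable_funM => //; exact: measurable_cst.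
move=> K cK KO; have mK := measurable_compact_rV cK.
have := integrableD mK (integrableZl mK a (iu K cK KO)) (integrableZl mK b (iv K cK KO)).
by apply: eq_integrable.
Qed.

Lemma is_weak_gradient_lin a b u v G H :
  is_weak_gradient Omega u G -> is_weak_gradient Omega v H ->
  is_weak_gradient Omega (fun x => a * u x + b * v x) (fun x => a *: G x + b *: H x).
Proof.
move=> [lu lG wG] [lv lH wH]; split.
- exact: L1loc_lin.
- move=> i; have := L1loc_lin a b (lG i) (lH i); congr L1loc.
  by apply/funext => x; rewrite !mxE.
move=> i psi tpsi.
have lin (f g : 'rV[R]_n -> R) (w : 'rV[R]_n -> R) :
    mu.-integrable Omega (EFin \o (fun x => f x * w x)) ->
    mu.-integrable Omega (EFin \o (fun x => g x * w x)) ->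
    \int[mu]_(x in Omega) ((a * f x + b * g x) * w x) =
    a * \int[mu]_(x in Omega) (f x * w x) + b * \int[mu]_(x in Omega) (g x * w x).
  move=> fi gi; rewrite -!RintegralZl // -RintegralD //.
  - by apply: eq_Rintegral => x _; ring.
  - by have := integrableZl mO a fi; apply: eq_integrable.
  - by have := integrableZl mO b gi; apply: eq_integrable.
rewrite lin; [|exact: L1loc_partial_integrable|exact: L1loc_partial_integrable].
rewrite [X in _ = - X](_ : _ =
    \int[mu]_(x in Omega) ((a * G x ord0 i + b * H x ord0 i) * psi x)); last first.
  by apply: eq_Rintegral => x _; rewrite !mxE.
rewrite lin; [|exact: L1loc_test_integrable|exact: L1loc_test_integrable].
by rewrite wG // wH //; ring.
Qed.

(** G - H is a weak gradient of 1 * u + (-1) * u = 0, so its components integrate to 0 against every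
    bump. *)
Lemma is_weak_gradient_unique u G H :
  is_weak_gradient Omega u G -> is_weak_gradient Omega u H -> ae_eq mu Omega G H.
Proof.
move=> wG wH; have [_ lD wD] := is_weak_gradient_lin 1 (-1) wG wH.
have /(_ _)-comp i : ae_eq mu Omega (fun x => (1 *: G x + (-1) *: H x) ord0 i) (cst 0).
  apply: (fundamental_lemma oO (lD i)) => k a b abO.
  have tb := test_fun_bump (ler0n R k) abO.
  apply: oppr_inj; rewrite -wD // oppr0.
  rewrite /Rintegral integral0_eq // => x _; congr EFin; ring.
have : {ae mu, forall x, forall i, Omega x -> (1 *: G x + (-1) *: H x) ord0 i = 0}.
  by apply: (@filter_forall _ _ (fun i x => Omega x -> (1 *: G x + (-1) *: H x) ord0 i = 0)) => i; exact: comp.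
apply: filterS => x h Ox; apply/rowP => i.
by have := h i Ox; rewrite !mxE; lra.
Qed.

Lemma wgradP u : (exists G, is_weak_gradient Omega u G) ->
  is_weak_gradient Omega u (wgrad Omega u).
Proof. by move=> [G wG]; exact: (@xgetPex _ (fun=> 0) [set G | is_weak_gradient Omega u G] (ex_intro _ G wG)). Qed.

Lemma wgrad_unique u G : is_weak_gradient Omega u G ->
  ae_eq mu Omega (wgrad Omega u) G.
Proof. by move=> wG; exact: (is_weak_gradient_unique (wgradP (ex_intro _ G wG)) wG). Qed.

(** [wgrad] is a choice among representatives, hence linear only up to a null set. *)
Lemma wgrad_lin a b u v : (exists G, is_weak_gradient Omega u G) ->
  (exists G, is_weak_gradient Omega v G) ->
  ae_eq mu Omega (wgrad Omega (fun x => a * u x + b * v x))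
    (fun x => a *: wgrad Omega u x + b *: wgrad Omega v x).
Proof.
by move=> /wgradP wu /wgradP wv; apply: wgrad_unique; exact: is_weak_gradient_lin.
Qed.

(** Test functions and their partial derivatives are bounded, so it is enough that the differences
    be small in L^1; u and G themselves need only be locally integrable. *)
Lemma is_weak_gradient_limit (u_ : nat -> 'rV[R]_n -> R)
    (G_ : nat -> 'rV[R]_n -> 'rV[R]_n) u G :
  (forall k, is_weak_gradient Omega (u_ k) (G_ k)) ->
  L1loc Omega u -> (forall i, L1loc Omega (fun x => G x ord0 i)) ->
  (forall e : R, 0 < e -> exists k,
    (\int[mu]_(x in Omega) (`|u_ k x - u x|)%:E <= e%:E)%E /\
    (forall i, \int[mu]_(x in Omega) (`|G_ k x ord0 i - G x ord0 i|)%:E <= e%:E)%E) ->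
  is_weak_gradient Omega u G.
Proof.
move=> wu lu lG app; split => // i psi tpsi.
have bounded (f : 'rV[R]_n -> R) : continuous f ->
    (forall x, ~ closure [set v | psi v != 0] x -> f x = 0) ->
    exists2 C, 0 <= C & forall x, `|f x| <= C.
  move=> cf f0; have [_ cK _] := tpsi.
  have /compact_bounded[C [Cr hC]] : compact (f @` closure [set v | psi v != 0]).
    by apply: continuous_compact => //; exact: continuous_subspaceT.
  exists (`|C| + 1); [by rewrite addr_ge0|move=> x].
  have [Kx|nKx] := pselect (closure [set v | psi v != 0] x).
    by apply: (hC (`|C| + 1)); [rewrite (le_lt_trans (real_ler_norm Cr)) // ltrDl|exists x].
  by rewrite f0 // normr0 addr_ge0.
have sm := let: And3 s _ _ := tpsi in s.
have [C1 C10 hC1] := bounded _ (sm [::] i).2 (fun x => @test_fun_partial_eq0 _ _ psi i x).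
have [C2 C20 hC2] := bounded _ (test_fun_continuous tpsi) (fun x => @test_fun_eq0 _ _ psi x).
have diff (f g w : 'rV[R]_n -> R) C (e : R) : 0 <= C -> (forall x, `|w x| <= C) ->
    L1loc Omega f -> L1loc Omega g -> measurable_fun Omega w ->
    mu.-integrable Omega (EFin \o (fun x => f x * w x)) ->
    mu.-integrable Omega (EFin \o (fun x => g x * w x)) ->
    (\int[mu]_(x in Omega) (`|f x - g x|)%:E <= e%:E)%E ->
    `|\int[mu]_(x in Omega) (f x * w x) - \int[mu]_(x in Omega) (g x * w x)| <= C * e.
  move=> C0 wC lf lg mw fi gi fg.
  have di : mu.-integrable Omega (EFin \o (fun x => f x * w x - g x * w x)).
    by have := integrableB mO fi gi; apply: eq_integrable.
  rewrite -RintegralB // -lee_fin EFin_normr_Rintegral //.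
  have mfg : measurable_fun Omega (fun x => f x - g x).
    exact: measurable_funB lf.1 lg.1.
  apply: le_trans (le_abse_integral _ _ _) _ => //; first exact: measurable_int di.
  apply: (@le_trans _ _ (\int[mu]_(x in Omega) (C%:E * (`|f x - g x|)%:E))%E).
    apply: ge0_le_integral => //.
    - by apply: measurableT_comp => //; exact: measurable_int di.
    - apply: measurable_funeM; apply/measurable_EFinP; exact: measurableT_comp.
    - move=> x _; rewrite -EFinM lee_fin -mulrBl normrM mulrC ler_wpM2r //.
  rewrite ge0_integralZl //; last by apply/measurable_EFinP; exact: measurableT_comp.
  by rewrite EFinM; apply: lee_wpmul2l.
apply/eqP; rewrite -subr_eq0 -normr_le0; apply/ler_addgt0Pl => e e0; rewrite addr0.
have D0 : 0 < C1 + C2 + 1 by lra.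
have [k [hu hG]] := app (e / (C1 + C2 + 1)) (divr_gt0 e0 D0).
have [luk lGk wk] := wu k.
have mpsi : measurable_fun Omega psi.
  by apply: measurable_funTS; exact: continuous_measurable_rV (test_fun_continuous tpsi).
have mdpsi : measurable_fun Omega (partial i psi).
  by apply: measurable_funTS; exact: continuous_measurable_rV (sm [::] i).2.
have d1 := diff _ _ _ _ _ C10 hC1 luk lu mdpsi
  (L1loc_partial_integrable i oO luk tpsi) (L1loc_partial_integrable i oO lu tpsi) hu.
have d2 := diff _ _ _ _ _ C20 hC2 (lGk i) (lG i) mpsi
  (L1loc_test_integrable oO (lGk i) tpsi) (L1loc_test_integrable oO (lG i) tpsi) (hG i).
have := wk i psi tpsi.
move: d1 d2.
set X1 := \int[mu]_(x in Omega) (u_ k x * _); set X2 := \int[mu]_(x in Omega) (u x * _).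
set Y1 := \int[mu]_(x in Omega) (G_ k x ord0 i * _).
set Y2 := \int[mu]_(x in Omega) (G x ord0 i * _).
set t := e / _ => d1 d2 XY.
have -> : X2 - - Y2 = (X2 - X1) + (Y2 - Y1) by rewrite XY; ring.
apply: le_trans (ler_normD _ _) _; rewrite distrC [X in _ + X]distrC.
apply: le_trans (lerD d1 d2) _.
have te : t * (C1 + C2 + 1) = e by rewrite /t divfK // gt_eqF.
have : 0 <= t by rewrite divr_ge0 // ltW.
nra.
Qed.

End weak_gradient.

(** * The energy with a variable exponent *)

Lemma ge0_le_integral_lin d (T : measurableType d) (R : realType)
    (mu : {measure set T -> \bar R}) (D : set T) (f g h k : T -> \bar R) (a b : R) :
  measurable D -> 0 <= a -> 0 <= b ->
  measurable_fun D f -> measurable_fun D g -> measurable_fun D h -> measurable_fun D k ->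
  (forall x, D x -> 0 <= f x)%E -> (forall x, D x -> 0 <= g x)%E ->
  (forall x, D x -> 0 <= h x)%E -> (forall x, D x -> 0 <= k x)%E ->
  (forall x, D x -> f x + a%:E * g x <= b%:E * (h x + k x))%E ->
  (\int[mu]_(x in D) f x + a%:E * \int[mu]_(x in D) g x <=
   b%:E * (\int[mu]_(x in D) h x + \int[mu]_(x in D) k x))%E.
Proof.
move=> mD a0 b0 mf mg mh mk f0 g0 h0 k0 fghk.
rewrite -(ge0_integralZl _ mD mg g0) // -(ge0_integralD mu mD f0) //; last 2 first.
- by move=> x Dx; rewrite mule_ge0 // g0.
- exact: measurable_funeM.
rewrite -(ge0_integralD mu mD h0) // -ge0_integralZl //; last 2 first.
- exact: emeasurable_funD.
- by move=> x Dx; rewrite adde_ge0 ?h0 ?k0.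
apply: ge0_le_integral => //.
- by move=> x Dx; rewrite adde_ge0 ?f0 // mule_ge0 // g0.
- by apply: emeasurable_funD => //; exact: measurable_funeM.
- by apply: measurable_funeM; exact: emeasurable_funD.
Qed.

Section variable_exponent.
Variables (R : realType) (n : nat) (Omega : set 'rV[R]_n) (p : 'rV[R]_n -> R).
Local Notation mu := (@lebesgue_rV R n).
Local Notation q := (pminus Omega p).
Hypotheses (oO : open Omega) (mp : measurable_fun Omega p) (q1 : 1 < q)
  (pq : forall x, Omega x -> q <= p x) (muO : (mu Omega < +oo)%E).
Implicit Types (f g u v : 'rV[R]_n -> R) (G H : 'rV[R]_n -> 'rV[R]_n) (a b : R).

Let mO : measurable Omega := measurable_open_rV oO.

Let p1 x : Omega x -> 1 < p x. Proof. by move=> /pq; exact: lt_le_trans. Qed.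
Let p0 x : Omega x -> 0 < p x. Proof. by move=> /p1; exact: lt_trans. Qed.
Let q0 : 0 < q. Proof. exact: lt_trans q1. Qed.

Definition measurable_field G :=
  forall i, measurable_fun Omega (fun x => G x ord0 i).

(** The Dirichlet integral of an arbitrary field. Since [wgrad] is a choice, the algebra is done on
    fields and carried over to functions by [energy_ae_eq]. *)
Definition energy G : \bar R :=
  (\int[mu]_(x in Omega) (euclid_norm (G x) `^ p x / p x)%:E)%E.

Lemma measurable_field_lin a b G H : measurable_field G -> measurable_field H ->
  measurable_field (fun x => a *: G x + b *: H x).
Proof.
move=> mG mH i; rewrite (_ : (fun x => _) = (fun x => a * G x ord0 i + b * H x ord0 i)).
  by apply: measurable_funD; apply: measurable_funM => //; exact: measurable_cst.
by apply/funext => x; rewrite !mxE.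
Qed.

Lemma measurable_inv_exponent : measurable_fun Omega (fun x => (p x)^-1).
Proof.
apply: (eq_measurable_fun (fun x => p x `^ (-1))).
  by move=> x; rewrite inE => Ox; rewrite powR_inv1 // ltW // p0.
exact: (measurableT_comp (measurable_powR (-1)) mp).
Qed.

Lemma measurable_energy_density G : measurable_field G ->
  measurable_fun Omega (fun x => (euclid_norm (G x) `^ p x / p x)%:E).
Proof.
move=> mG; apply/measurable_EFinP; apply: measurable_funM.
  by apply: measurable_fun_powR => //; exact: measurable_euclid_norm.
exact: measurable_inv_exponent.
Qed.

Lemma energy_density_ge0 (v : 'rV[R]_n) x : Omega x ->
  (0 <= (euclid_norm v `^ p x / p x)%:E)%E.
Proof. by move=> Ox; rewrite lee_fin divr_ge0 ?powR_ge0 // ltW // p0. Qed.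

Lemma energy_ge0 G : (0 <= energy G)%E.
Proof. by apply: integral_ge0 => x; exact: energy_density_ge0. Qed.

Lemma energy_ae_eq G H : measurable_field G -> measurable_field H ->
  ae_eq mu Omega G H -> energy G = energy H.
Proof.
move=> mG mH GH; apply: ge0_ae_eq_integral => //.
- exact: measurable_energy_density.
- exact: measurable_energy_density.
- by move=> x; exact: energy_density_ge0.
- by move=> x; exact: energy_density_ge0.
- by move: GH; apply: filterS => x h /h ->.
Qed.

Lemma energy_contract a G : `|a| <= 1 -> measurable_field G ->
  (energy (fun x => a *: G x) <= energy G)%E.
Proof.
move=> a1 mG.
have maG : measurable_field (fun x => a *: G x).
  move=> i; rewrite (_ : (fun x => _) = (fun x => a * G x ord0 i)).
    by apply: measurable_funM => //; exact: measurable_cst.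
  by apply/funext => x; rewrite !mxE.
apply: ge0_le_integral => //; [by move=> x; exact: energy_density_ge0|exact: measurable_energy_density|exact: measurable_energy_density|].
move=> x Ox; rewrite lee_fin ler_wpM2r ?invr_ge0 ?(ltW (p0 Ox)) //.
rewrite ge0_ler_powR ?nnegrE ?euclid_norm_ge0 ?(ltW (p0 Ox)) //.
by rewrite euclid_normZ ler_piMl // euclid_norm_ge0.
Qed.

(** [powR_uniform_convexity] at each point, with one K for all exponents p(x). The midpoint term
    stands on the left so that no possibly infinite integral is subtracted. *)
Lemma energy_uniform_convexity (e : R) : 0 < e <= 1 ->
  exists2 K : R, 0 <= K & forall G H, measurable_field G -> measurable_field H ->
    (energy (fun x => 2^-1 *: G x + (- 2^-1) *: H x)%R +
     K%:E * energy (fun x => 2^-1 *: G x + 2^-1 *: H x)%R <=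
     ((K + e) / 2)%:E * (energy G + energy H))%E.
Proof.
move=> e01; have [K K0 UC] := powR_uniform_convexity q1 e01.
exists K => // G H mG mH.
have mD := measurable_field_lin 2^-1 (- 2^-1) mG mH.
have mM := measurable_field_lin 2^-1 2^-1 mG mH.
have e0 : 0 < e by case/andP: e01.
have Ke0 : 0 <= (K + e) / 2 by rewrite divr_ge0 // addr_ge0 // ltW.
have meG := measurable_energy_density mG.
have meH := measurable_energy_density mH.
have meD := measurable_energy_density mD.
have meM := measurable_energy_density mM.
have eG0 (L : 'rV[R]_n -> 'rV[R]_n) x : Omega x ->
  (0 <= (euclid_norm (L x) `^ p x / p x)%:E)%E by exact: energy_density_ge0.
apply: (ge0_le_integral_lin mu mO K0 Ke0 meD meM meG meH (eG0 _) (eG0 _) (eG0 _) (eG0 _)).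
move=> x Ox; rewrite -!EFinM -!EFinD lee_fin.
set s := euclid_norm (G x); set t := euclid_norm (H x).
set dd := euclid_norm (_ + (- 2^-1) *: H x); set mm := euclid_norm (_ + 2^-1 *: H x).
have half (z : R) : 0 <= z -> `|2^-1| * z = z / 2 by rewrite ger0_norm // mulrC.
have eN (z : 'rV[R]_n) : euclid_norm (2^-1 *: z) = euclid_norm z / 2.
  by rewrite euclid_normZ half // euclid_norm_ge0.
have par : mm ^+ 2 + dd ^+ 2 = (s ^+ 2 + t ^+ 2) / 2.
  rewrite /mm /dd scaleNr euclid_norm_parallelogram !eN -/s -/t.
  by rewrite !expr_div_n; field.
have mst : mm <= (s + t) / 2.
  by rewrite /mm; apply: le_trans (euclid_normD _ _) _; rewrite !eN -/s -/t mulrDl.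
have dst : dd <= (s + t) / 2.
  rewrite /dd; apply: le_trans (euclid_normD _ _) _.
  rewrite [X in _ + X]euclid_normZ normrN half ?euclid_norm_ge0 // eN -/s -/t.
  by rewrite mulrDl.
have := UC (p x) s t mm dd (pq Ox) (euclid_norm_ge0 _) (euclid_norm_ge0 _)
  (euclid_norm_ge0 _) (euclid_norm_ge0 _) par mst dst.
have ip0 : 0 < (p x)^-1 by rewrite invr_gt0 p0.
move: (s `^ p x) (t `^ p x) (mm `^ p x) (dd `^ p x) ((p x)^-1) ip0 => S T MM DD i i0 h.
rewrite mulrA -mulrDl -[X in _ <= _ * X]mulrDl mulrA ler_pM2r //.
lra.
Qed.

(** The sets where p exceeds k decrease to the empty set, p being real-valued, and [Omega] has
    finite measure. *)
Lemma exponent_tail (e : R) : 0 < e ->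
  exists2 M : R, q <= M & (mu (Omega `&` [set x | (M < p x)%R]) <= e%:E)%E.
Proof.
move=> e0; pose F (k : nat) := Omega `&` [set x | k%:R < p x].
have mF k : measurable (F k).
  have := mp mO (measurable_itv `]k%:R, +oo[); congr measurable.
  by apply/seteqP; split => x [Ox]; rewrite /= in_itv /= andbT => h; split.
have FO k : F k `<=` Omega by exact: subIsetl.
have cF : \bigcap_k F k = set0.
  apply/seteqP; split => // x /= xF.
  have [_] := xF (Num.truncn (p x)).+1 I.
  by rewrite /= => /lt_trans/(_ (truncnS_gt _)); rewrite ltxx.
have : mu (F k) @[k --> \oo] --> mu (\bigcap_k F k).
  apply: nonincreasing_cvg_mu => //.
  - by apply: le_lt_trans muO; apply: le_measure; rewrite ?inE.
  - by rewrite cF.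
  - move=> j k jk; apply/subsetPset => x [Ox h]; split => //.
    by apply: le_lt_trans h; rewrite ler_nat.
rewrite cF measure0 => /fine_cvgP[].
move=> finF /cvgrPdist_lt /(_ e e0) cF0.
have [k _ kP] := filterI finF cF0.
(* Raised above q, as [powR_le_modular] will demand. *)
pose k' := maxn k (Num.truncn q).+1.
have [] := kP k' (leq_maxl _ _) => finFk; rewrite sub0r normrN => Fke.
exists k'%:R.
  by apply: ltW (lt_le_trans (truncnS_gt _) _); rewrite ler_nat leq_maxr.
rewrite -(fineK finFk) lee_fin ltW //.
by apply: le_lt_trans Fke; rewrite ler_norm.
Qed.

(** [powR_le_modular] is integrated and each of its three terms gets e / 3. The order of choice
    matters: M from the exponent tail, th from the measure of [Omega], then K, and from K the bound
    on the energy. *)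
Lemma energy_small_powR (e : R) : 0 < e -> exists2 dl : R, 0 < dl &
  forall G, measurable_field G -> (energy G <= dl%:E)%E ->
  (\int[mu]_(x in Omega) (euclid_norm (G x) `^ q)%:E <= e%:E)%E.
Proof.
move=> e0.
have mufin : mu Omega \is a fin_num by rewrite ge0_fin_numE.
pose V := fine (mu Omega).
have V0 : 0 <= V by rewrite fine_ge0.
have tq0 : 0 < 2 `^ q :> R by rewrite powR_gt0.
have [M qM muM] := exponent_tail (divr_gt0 e0 (mulr_gt0 (ltr0n R 3) tq0) : 0 < e / (3%:R * 2 `^ q)).
pose th := Num.min 1 (e / (3%:R * (V + 1))).
have th01 : 0 < th <= 1.
  rewrite /th lt_min ltr01 ge_min lexx /= andbT divr_gt0 // mulr_gt0 //.
  by rewrite ltr_wpDl.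
have thV : th * V <= e / 3%:R.
  have h : th <= e / (3%:R * (V + 1)) by rewrite /th ge_min lexx orbT.
  apply: le_trans (ler_wpM2r V0 h) _.
  have V10 : 0 < V + 1 by rewrite ltr_wpDl.
  have -> : e / (3%:R * (V + 1)) * V = e / 3%:R * (V / (V + 1)).
    by field; rewrite gt_eqF.
  rewrite ler_piMr ?divr_ge0 ?(ltW e0) // ler_pdivrMr // mul1r lerDl //.
have [K K0 mod] := powR_le_modular (ltW q1) qM th01.
exists (e / (3%:R * (K + 1))).
  by rewrite divr_gt0 // mulr_gt0 // ltr_wpDl.
move=> G mG Gdl.
have mA : measurable (Omega `&` [set x | M < p x]).
  have := mp mO (measurable_itv `]M, +oo[); congr measurable.
  by apply/seteqP; split => x [Ox]; rewrite /= in_itv /= andbT => h; split.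
pose A := Omega `&` [set x | M < p x].
have mind : measurable_fun Omega (fun x => ((2 `^ q * \1_A x))%:E : \bar R).
  apply/measurable_EFinP; apply: measurable_funM; first exact: measurable_cst.
  by apply: measurable_funTS; exact: measurable_indic.
have meG := measurable_energy_density mG.
apply: (@le_trans _ _ (\int[mu]_(x in Omega) (th%:E + (2 `^ q * \1_A x)%:E +
    K%:E * (euclid_norm (G x) `^ p x / p x)%:E))%E).
  apply: ge0_le_integral => //.
  - by move=> x _; rewrite lee_fin powR_ge0.
  - apply/measurable_EFinP; apply: (measurableT_comp (measurable_powR q)).
    exact: measurable_euclid_norm.
  - apply: emeasurable_funD; last exact: measurable_funeM.
    by apply: emeasurable_funD.
  move=> x Ox; rewrite -EFinM -!EFinD lee_fin.
  have -> : \1_A x = (M < p x)%R%:R :> R.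
    rewrite indicE; congr (nat_of_bool _)%:R; apply/idP/idP; first by rewrite inE => -[].
    by move=> h; rewrite inE.
  exact: mod (euclid_norm_ge0 _) (pq Ox).
rewrite ge0_integralD //; last 4 first.
- by move=> x _; rewrite adde_ge0 // lee_fin ?mulr_ge0 ?(ltW tq0) // ltW //; case/andP: th01.
- exact: emeasurable_funD.
- by move=> x Ox; rewrite mule_ge0 ?lee_fin //; exact: energy_density_ge0.
- exact: measurable_funeM.
rewrite ge0_integralD //; last by move=> x _; rewrite lee_fin ltW //; case/andP: th01.
have h1 : (\int[mu]_(x in Omega) th%:E <= (e / 3%:R)%:E)%E.
  by rewrite integral_cst // -[X in (_ * X <= _)%E](fineK mufin) -EFinM lee_fin.
have h2 : (\int[mu]_(x in Omega) (2 `^ q * \1_A x)%:E <= (e / 3%:R)%:E)%E.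
  under eq_integral do rewrite EFinM.
  rewrite ge0_integralZl //; last first.
    by apply/measurable_EFinP; apply: measurable_funTS; exact: measurable_indic.
  rewrite integral_indic // setIAC setIid.
  apply: le_trans (lee_wpmul2l _ muM) _; first by rewrite lee_fin ltW.
  by rewrite -EFinM lee_fin le_eqVlt; apply/orP; left; apply/eqP; field; rewrite gt_eqF.
have h3 : (\int[mu]_(x in Omega) (K%:E * (euclid_norm (G x) `^ p x / p x)%:E) <= (e / 3%:R)%:E)%E.
  rewrite ge0_integralZl //; last by move=> x; exact: energy_density_ge0.
  apply: le_trans (lee_wpmul2l _ Gdl) _; first by rewrite lee_fin.
  rewrite -EFinM lee_fin.
  have K10 : 0 < K + 1 by rewrite ltr_wpDl.
  have -> : K * (e / (3%:R * (K + 1))) = e / 3%:R * (K / (K + 1)).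
    by field; rewrite gt_eqF.
  by rewrite ler_piMr ?divr_ge0 ?(ltW e0) // ler_pdivrMr // mul1r lerDl.
apply: le_trans (leeD (leeD h1 h2) h3) _.
by rewrite -!EFinD lee_fin le_eqVlt; apply/orP; left; apply/eqP; field.
Qed.

Lemma powR_small_L1 (e : R) : 0 < e -> exists2 dl : R, 0 < dl &
  forall f, measurable_fun Omega f ->
  (\int[mu]_(x in Omega) (`|f x| `^ q)%:E <= dl%:E)%E ->
  (\int[mu]_(x in Omega) (`|f x|)%:E <= e%:E)%E.
Proof.
move=> e0.
have mufin : mu Omega \is a fin_num by rewrite ge0_fin_numE.
pose V := fine (mu Omega).
have V0 : 0 <= V by rewrite fine_ge0.
have V10 : 0 < V + 1 by rewrite ltr_wpDl.
pose th := e / (2 * (V + 1)).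
have th0 : 0 < th by rewrite divr_gt0 // mulr_gt0.
have T0 : 0 < th `^ (q - 1) by rewrite powR_gt0.
exists (th `^ (q - 1) * (e / 2)); first by rewrite mulr_gt0 // divr_gt0.
move=> f mf fd.
have mfq : measurable_fun Omega (fun x => (`|f x| `^ q)%:E).
  apply/measurable_EFinP; apply: (measurableT_comp (measurable_powR q)).
  exact: measurableT_comp mf.
apply: (@le_trans _ _ (\int[mu]_(x in Omega)
   (th%:E + (th `^ (q - 1))^-1%:E * (`|f x| `^ q)%:E))%E).
  apply: ge0_le_integral => //.
  - by apply/measurable_EFinP; exact: measurableT_comp.
  - by apply: emeasurable_funD => //; exact: measurable_funeM.
  move=> x _; rewrite -EFinM -EFinD lee_fin mulrC.
  exact: le_eps_powR (ltW q1) _.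
rewrite ge0_integralD //; last 3 first.
- by move=> x _; rewrite lee_fin ltW.
- by move=> x _; rewrite -EFinM lee_fin mulr_ge0 ?powR_ge0 // invr_ge0 ltW.
- exact: measurable_funeM.
rewrite ge0_integralZl //; last by rewrite lee_fin invr_ge0 ltW.
have h2 : ((th `^ (q - 1))^-1%:E * \int[mu]_(x in Omega) (`|f x| `^ q)%:E <= (e / 2)%:E)%E.
  apply: le_trans (lee_wpmul2l _ fd) _; first by rewrite lee_fin invr_ge0 ltW.
  by rewrite -EFinM lee_fin mulKf // gt_eqF.
have h1 : (\int[mu]_(x in Omega) th%:E <= (e / 2)%:E)%E.
  rewrite integral_cst // -[X in (_ * X <= _)%E](fineK mufin) -EFinM lee_fin -/V /th.
  have -> : e / (2 * (V + 1)) * V = e / 2 * (V / (V + 1)) by field; rewrite gt_eqF.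
  by rewrite ler_piMr ?divr_ge0 ?(ltW e0) // ler_pdivrMr // mul1r lerDl.
by apply: le_trans (leeD h1 h2) _; rewrite -EFinD lee_fin -splitr.
Qed.

End variable_exponent.

(** * Pointwise limits and Fatou's lemma *)

Section limits.
Context d (T : measurableType d) (R : realType).
Variables (mu : {measure set T -> \bar R}) (D : set T).
Hypothesis mD : measurable D.

Lemma powR_cvg (a_ : nat -> R) (a p : R) : 0 < p -> (forall k, 0 <= a_ k) ->
  a_ k @[k --> \oo] --> a -> a_ k `^ p @[k --> \oo] --> a `^ p.
Proof.
move=> p0 a_0 a_a.
have a0 : 0 <= a.
  by rewrite -(cvg_lim _ a_a) //; apply: limr_ge; [exact/cvgP/a_a|exact: nearW].
have [a00|an0] := eqVneq a 0; last first.
  have ap : 0 < a by rewrite lt0r an0.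
  have : expR (p * ln (a_ k)) @[k --> \oo] --> expR (p * ln a).
    apply: (@continuous_cvg _ _ _ _ _ (fun k => p * ln (a_ k)) expR); first exact: continuous_expR.
    apply: cvgM; first exact: cvg_cst.
    by apply: (@continuous_cvg _ _ _ _ _ _ (@ln R)) => //; exact: continuous_ln.
  rewrite [X in _ -> _ --> X](_ : _ = expR (p * ln a)); last by rewrite /powR (negbTE an0).
  apply: cvg_trans; apply: near_eq_cvg.
  by apply: filterS (cvgr_gt a a_a 0 ap) => k ak; rewrite /powR gt_eqF.
rewrite a00 powR0 ?gt_eqF //.
apply/cvgrPdist_lt => e e0.
have ep : a < e `^ p^-1 by rewrite a00 powR_gt0.
apply: filterS (cvgr_lt a a_a _ ep) => k h; rewrite sub0r normrN ger0_norm ?powR_ge0 //.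
have := gt0_ltr_powR p0 _ _ h; rewrite !nnegrE a_0 powR_ge0 => /(_ isT isT).
by rewrite -powRrM mulVf ?gt_eqF // powRr1 // ltW.
Qed.

(** The increments have summable L^1 norms, so the sum of their absolute values is integrable, hence
    finite almost everywhere, and the telescoping series converges absolutely there. *)
Lemma fast_L1_cauchy_cvg (f_ : nat -> T -> R) :
  (forall k, measurable_fun D (f_ k)) ->
  (forall k, \int[mu]_(x in D) (`|f_ k.+1 x - f_ k x|)%:E <= (1 / (2 ^ (k + 1))%:R)%:E)%E ->
  {ae mu, forall x, D x -> cvgn (f_^~ x)}.
Proof.
move=> mf fast.
pose g x : \bar R := (\sum_(k <oo) (`|f_ k.+1 x - f_ k x|)%:E)%E.
have mh k : measurable_fun D (fun x => (`|f_ k.+1 x - f_ k x|)%:E).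
  by apply/measurable_EFinP; apply: measurableT_comp => //; exact: measurable_funB.
have g0 x : (0 <= g x)%E by apply: nneseries_ge0 => k _ _; rewrite lee_fin.
have mg : measurable_fun D g by apply: ge0_emeasurable_sum => // k x _ _; rewrite lee_fin.
have gi : mu.-integrable D g.
  apply/integrableP; split => //.
  under eq_integral do rewrite gee0_abs //.
  rewrite integral_nneseries //.
  apply: (@le_lt_trans _ _ (\sum_(k <oo) (1 / (2 ^ (k + 1))%:R)%:E)%E).
    by apply: lee_nneseries => // k _ _; apply: integral_ge0 => x _; rewrite lee_fin.
  have /cvg_lim -> // := @cvg_geometric_eseries_half R 1 0.
  by rewrite ltry.
have := integrable_ae mD gi; apply: filterS => x gx Dx.
have gfin := gx Dx.
have cs : cvgn (series (fun k => f_ k.+1 x - f_ k x)).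
  apply: normed_cvg; apply: nondecreasing_is_cvgn.
    by apply: nondecreasing_series => k _ _; exact: normr_ge0.
  exists (fine (g x)) => _ [k _ <-]; rewrite -lee_fin fineK //= seriesEnat -sumEFin.
  by apply: nneseries_lim_ge => i _ _; rewrite lee_fin.
have -> : f_ ^~ x = (fun k => series (telescope (f_^~ x)) k + f_ 0%N x).
  by rewrite telescopeK; apply/funext => k /=; rewrite subrK.
by apply: is_cvgD; [exact: cs|exact: is_cvg_cst].
Qed.

Lemma fatou_bound (g_ : nat -> T -> \bar R) (g : T -> \bar R) (M : \bar R) :
  (forall k, measurable_fun D (g_ k)) -> (forall k x, D x -> 0 <= g_ k x)%E ->
  measurable_fun D g -> (forall x, D x -> 0 <= g x)%E ->
  {ae mu, forall x, D x -> g_ k x @[k --> \oo] --> g x} ->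
  (\forall k \near \oo, (\int[mu]_(x in D) g_ k x <= M)%E) ->
  (\int[mu]_(x in D) g x <= M)%E.
Proof.
move=> mg_ g_0 mg g0 cvg [N _ gM].
have g_0' k x : D x -> (0 <= g_ (k + N)%N x)%E by exact: g_0.
have := fatou mu mD (fun k => mg_ (k + N)%N) g_0'.
set u := fun k => (\int[mu]_(x in D) g_ (k + N)%N x)%E => fat.
have uM : (limn_einf u <= M)%E.
  rewrite limn_einf_lim; apply: lime_le; first exact: is_cvg_einfs.
  apply: nearW => k; apply: (@le_trans _ _ (u k)).
    by apply: ereal_inf_lbound; exists k => /=.
  by apply: gM; rewrite /= leq_addl.
apply: le_trans (le_trans fat uM).
apply: ae_ge0_le_integral => //.
- move=> x Dx; rewrite limn_einf_lim; apply: lime_ge; first exact: is_cvg_einfs.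
  by apply: nearW => k; apply: le_ereal_inf_tmp => _ [j _ <-]; exact: g_0.
- apply: (@measurableT_comp _ _ _ _ _ _ (@oppe R)) => //.
  by apply: measurable_fun_limn_esup => k; exact: measurableT_comp.
move: cvg; apply: filterS => x h Dx.
have /cvg_limn_einf_sup[-> _] // : (g_ (k + N)%N x) @[k --> \oo] --> g x.
by rewrite (cvg_shiftn N (fun k => g_ k x)); exact: h.
Qed.

End limits.

(** * The modular closure *)

Section sobolev_space.
Variables (R : realType) (n : nat) (Omega : set 'rV[R]_n) (p : 'rV[R]_n -> R).
Local Notation mu := (@lebesgue_rV R n).
Local Notation q := (pminus Omega p).
Hypotheses (oO : open Omega) (mp : measurable_fun Omega p) (q1 : 1 < q)
  (pq : forall x, Omega x -> q <= p x) (muO : (mu Omega < +oo)%E).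
Implicit Types (e f g h u v w : 'rV[R]_n -> R) (G H : 'rV[R]_n -> 'rV[R]_n) (a b : R).

Let mO : measurable Omega := measurable_open_rV oO.
Let q0 : 0 < q. Proof. exact: lt_trans q1. Qed.
Let p0 x : Omega x -> 0 < p x. Proof. by move=> /pq; exact: lt_le_trans. Qed.

Lemma measurable_lin a b f g : measurable_fun Omega f -> measurable_fun Omega g ->
  measurable_fun Omega (fun x => a * f x + b * g x).
Proof.
by move=> mf mg; apply: measurable_funD; apply: measurable_funM => //; exact: measurable_cst.
Qed.

Lemma measurable_normr_powR e f : measurable_fun Omega e -> measurable_fun Omega f ->
  measurable_fun Omega (fun x => (`|f x| `^ e x)%:E).
Proof.
move=> me mf; apply/measurable_EFinP; apply: measurable_fun_powR => //.
exact: measurableT_comp.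
Qed.

(** With an unbounded exponent no constant can be pulled out of the modular. The scaling k of the
    sum is shrunk instead, until k |a| <= l / 2 and k |b| <= r / 2, and midpoint convexity
    finishes. *)
Lemma Lvar_lin e a b f g : measurable_fun Omega e -> (forall x, Omega x -> 1 <= e x) ->
  Lvar Omega e f -> Lvar Omega e g -> Lvar Omega e (fun x => a * f x + b * g x).
Proof.
move=> me e1 [mf [l l0 fl]] [mg [r r0 gr]]; split; first exact: measurable_lin.
pose N := `|a| + `|b| + 1; have N0 : 0 < N by rewrite ltr_wpDl ?addr_ge0.
pose k := Num.min l r / (2 * N).
have k0 : 0 < k by rewrite divr_gt0 ?mulr_gt0 // lt_min l0 r0.
have kN : k * N <= Num.min l r / 2.
  by rewrite /k le_eqVlt; apply/orP; left; apply/eqP; field; rewrite gt_eqF.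
have [ml mr] : Num.min l r <= l /\ Num.min l r <= r by rewrite !ge_min !lexx orbT.
have ka : k * `|a| <= l / 2.
  have : k * `|a| <= k * N by rewrite ler_pM2l // /N -addrA lerDl addr_ge0.
  lra.
have kb : k * `|b| <= r / 2.
  have : k * `|b| <= k * N by rewrite ler_pM2l // /N addrAC lerDr addr_ge0.
  lra.
clearbody k; exists k => //.
have mh c (h : 'rV[R]_n -> R) : measurable_fun Omega h ->
    measurable_fun Omega (fun x => (`|c * h x| `^ e x)%:E).
  by move=> mh; apply: measurable_normr_powR => //; exact: measurable_funM.
apply: (@le_lt_trans _ _ (\int[mu]_(x in Omega)
    ((`|l * f x| `^ e x)%:E + (`|r * g x| `^ e x)%:E))%E); last first.
  have pos (h : 'rV[R]_n -> R) x : Omega x -> (0 <= (`|h x| `^ e x)%:E)%E.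
    by rewrite lee_fin powR_ge0.
  rewrite (ge0_integralD mu mO (pos _) (mh l f mf) (pos _) (mh r g mg)).
  exact: lte_add_pinfty.
apply: ge0_le_integral => //.
- by apply: mh; exact: measurable_lin.
- by apply: emeasurable_funD; exact: mh.
move=> x Ox; rewrite -EFinD lee_fin.
have e0 : 0 <= e x by rewrite (le_trans ler01) // e1.
have le : `|k * (a * f x + b * g x)| <= (`|l * f x| + `|r * g x|) / 2.
  rewrite normrM (ger0_norm (ltW k0)).
  apply: (@le_trans _ _ (k * `|a| * `|f x| + k * `|b| * `|g x|)).
    by rewrite -!mulrA -mulrDr ler_pM2l // -!normrM ler_normD.
  rewrite !normrM (gtr0_norm l0) (gtr0_norm r0).
  have A := ler_wpM2r (normr_ge0 (f x)) ka; have B := ler_wpM2r (normr_ge0 (g x)) kb.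
  lra.
apply: (@le_trans _ _ (((`|l * f x| + `|r * g x|) / 2) `^ e x)).
  by rewrite ge0_ler_powR ?nnegrE // divr_ge0 // addr_ge0.
apply: le_trans (powR_midpoint (normr_ge0 _) (normr_ge0 _) (e1 x Ox)) _.
by rewrite ler_pdivrMr // ler_peMr ?addr_ge0 ?powR_ge0 // ler1n.
Qed.

(** Seen as the constant exponent case, L^q inherits its linearity from [Lvar_lin]. *)
Lemma Lq_Lvar f : Lq Omega q f <-> Lvar Omega (cst q) f.
Proof.
split=> -[mf].
  move=> h; split; [exact: mf|exists 1; first exact: ltr01].
  rewrite [X in integral _ _ X](_ : _ = fun x => (`|f x| `^ q)%:E); first exact: h.
  by apply/funext => x; rewrite mul1r.
move=> [l l0 fl]; split; first exact: mf.
rewrite (_ : (\int[mu]_(x in Omega) _)%E = ((l `^ q)^-1%:E *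
    \int[mu]_(x in Omega) (`|l * f x| `^ q)%:E)%E).
  by apply: lte_mul_pinfty; [rewrite lee_fin invr_ge0 powR_ge0|by []|exact: fl].
have mlf : measurable_fun Omega (fun x => (`|l * f x| `^ q)%:E).
  apply: (@measurable_normr_powR (cst q)); first exact: measurable_cst.
  by apply: measurable_funM mf; exact: measurable_cst.
rewrite -(ge0_integralZl mu mO mlf); last 2 first.
- by move=> x _; rewrite lee_fin powR_ge0.
- by rewrite lee_fin invr_ge0 powR_ge0.
by apply: eq_integral => x _; rewrite -EFinM normrM (gtr0_norm l0) powRM ?(ltW l0) // mulKf // gt_eqF // powR_gt0.
Qed.

Lemma Lq_lin a b f g : Lq Omega q f -> Lq Omega q g ->
  Lq Omega q (fun x => a * f x + b * g x).
Proof.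
rewrite !Lq_Lvar => Lf Lg; apply: Lvar_lin => // x _; exact: ltW.
Qed.

Lemma Lvar_ae_eq e f g : measurable_fun Omega e -> measurable_fun Omega g ->
  ae_eq mu Omega f g -> Lvar Omega e f -> Lvar Omega e g.
Proof.
move=> me mg fg [mf [l l0 fl]]; split; first exact: mg.
exists l; first exact: l0.
have ml h : measurable_fun Omega h -> measurable_fun Omega (fun x => (`|l * h x| `^ e x)%:E).
  move=> mh; apply: measurable_normr_powR; first exact: me.
  by apply: measurable_funM mh; exact: measurable_cst.
rewrite -(ge0_ae_eq_integral mO (ml f mf) (ml g mg)); first exact: fl.
- by move=> x _; rewrite lee_fin powR_ge0.
- by move=> x _; rewrite lee_fin powR_ge0.
- by move: fg; apply: filterS => x h /h ->.
Qed.

Lemma sobolev_wgrad u : sobolev Omega p u -> is_weak_gradient Omega u (wgrad Omega u).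
Proof. by move=> [_ /wgradP]. Qed.

Lemma sobolev_measurable_field u : sobolev Omega p u -> measurable_field Omega (wgrad Omega u).
Proof. by move=> [_ _ LG] i; have [] := LG i. Qed.

Lemma sobolev_measurable u : sobolev Omega p u -> measurable_fun Omega u.
Proof. by move=> [[]]. Qed.

Lemma sobolev_lin a b u v : sobolev Omega p u -> sobolev Omega p v ->
  sobolev Omega p (fun x => a * u x + b * v x).
Proof.
move=> [Lu Gu Vu] [Lv Gv Vv]; split; first exact: Lq_lin.
  by exists (fun x => a *: wgrad Omega u x + b *: wgrad Omega v x);
     apply: is_weak_gradient_lin => //; exact: wgradP.
move=> i.
have wl := is_weak_gradient_lin oO a b (wgradP Gu) (wgradP Gv).
have [_ /(_ i)[mw _] _] := wgradP (ex_intro _ _ wl).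
apply: (@Lvar_ae_eq p (fun x => a * wgrad Omega u x ord0 i + b * wgrad Omega v x ord0 i)) => //.
  by have := wgrad_lin oO a b Gu Gv; apply: filterS => x h /h ->; rewrite !mxE.
apply: Lvar_lin => // x Ox; apply: ltW; exact: lt_le_trans q1 (pq Ox).
Qed.

Lemma sobolevD u v : sobolev Omega p u -> sobolev Omega p v -> sobolev Omega p (u \+ v).
Proof.
move=> su sv; have := sobolev_lin 1 1 su sv; congr sobolev.
by apply/funext => x /=; rewrite !mul1r.
Qed.

Lemma sobolevB u v : sobolev Omega p u -> sobolev Omega p v -> sobolev Omega p (u \- v).
Proof.
move=> su sv; have := sobolev_lin 1 (-1) su sv; congr sobolev.
by apply/funext => x /=; rewrite mul1r mulN1r.
Qed.

Lemma sobolevZ a u : sobolev Omega p u -> sobolev Omega p (fun x => a * u x).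
Proof.
move=> su; have := sobolev_lin a 0 su su; congr sobolev.
by apply/funext => x /=; rewrite mul0r addr0.
Qed.

Lemma dirichlet_lin a b u v : sobolev Omega p u -> sobolev Omega p v ->
  dirichlet Omega p (fun x => a * u x + b * v x) =
  energy Omega p (fun x => a *: wgrad Omega u x + b *: wgrad Omega v x).
Proof.
move=> su sv; have [_ Gu _] := su; have [_ Gv _] := sv.
apply: energy_ae_eq => //.
- exact: sobolev_measurable_field (sobolev_lin _ _ su sv).
- by apply: measurable_field_lin; exact: sobolev_measurable_field.
- exact: wgrad_lin.
Qed.

Lemma dirichletB u v : sobolev Omega p u -> sobolev Omega p v ->
  dirichlet Omega p (u \- v) =
  energy Omega p (fun x => 1 *: wgrad Omega u x + (-1) *: wgrad Omega v x).
Proof.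
move=> su sv; rewrite (_ : u \- v = fun x => 1 * u x + (-1) * v x); first exact: dirichlet_lin.
by apply/funext => x /=; rewrite mul1r mulN1r.
Qed.

Definition powq f : \bar R := (\int[mu]_(x in Omega) (`|f x| `^ q)%:E)%E.

Lemma powq_ge0 f : (0 <= powq f)%E.
Proof. by apply: integral_ge0 => x _; rewrite lee_fin powR_ge0. Qed.

Lemma measurable_powq f : measurable_fun Omega f ->
  measurable_fun Omega (fun x => (`|f x| `^ q)%:E).
Proof. by apply: (@measurable_normr_powR (cst q)); exact: measurable_cst. Qed.

Lemma powq_le f g : measurable_fun Omega f -> measurable_fun Omega g ->
  (forall x, Omega x -> `|f x| <= `|g x|) -> (powq f <= powq g)%E.
Proof.
move=> mf mg fg; apply: ge0_le_integral => //.
- exact: measurable_powq.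
- exact: measurable_powq.
- by move=> x Ox; rewrite lee_fin ge0_ler_powR ?nnegrE ?fg // ltW.
Qed.

(** Convexity at the half sum costs 2^q. This is affordable because q is a constant; the analogous
    factor 2^(p(x)) for the energy may be unbounded. *)
Lemma powq_quasi_triangle f g h : measurable_fun Omega f -> measurable_fun Omega g ->
  measurable_fun Omega h -> (forall x, Omega x -> `|h x| <= `|f x| + `|g x|) ->
  (powq h <= (2 `^ q)%:E * (powq f + powq g))%E.
Proof.
move=> mf mg mh hfg.
have mfq := measurable_powq mf; have mgq := measurable_powq mg.
have := @ge0_le_integral_lin _ _ _ mu Omega (fun x => (`|h x| `^ q)%:E) (cst 0%E)
  (fun x => (`|f x| `^ q)%:E) (fun x => (`|g x| `^ q)%:E) 0 (2 `^ q) mO (lexx _)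
  (powR_ge0 _ _) (measurable_powq mh) (measurable_cst _) mfq mgq.
rewrite mul0e adde0; apply; try by move=> x _; rewrite lee_fin ?powR_ge0.
move=> x Ox; rewrite mul0e adde0 -EFinD -EFinM lee_fin.
apply: (@le_trans _ _ ((2 * ((`|f x| + `|g x|) / 2)) `^ q)).
  rewrite ge0_ler_powR ?nnegrE ?(ltW q0) //.
  by rewrite mulrC divfK // hfg.
rewrite powRM ?divr_ge0 ?addr_ge0 // ler_wpM2l ?powR_ge0 //.
apply: le_trans (powR_midpoint (normr_ge0 _) (normr_ge0 _) (ltW q1)) _.
by rewrite ler_pdivrMr // ler_peMr ?addr_ge0 ?powR_ge0 // ler1n.
Qed.

End sobolev_space.

(** * Vector space structure and Poincaré inequality of the closure *)

Section modular_closure.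
Variables (R : realType) (n : nat) (Omega : set 'rV[R]_n) (p : 'rV[R]_n -> R).
Local Notation mu := (@lebesgue_rV R n).
Local Notation q := (pminus Omega p).
Hypotheses (oO : open Omega) (mp : measurable_fun Omega p) (q1 : 1 < q)
  (pq : forall x, Omega x -> q <= p x) (muO : (mu Omega < +oo)%E).
Variable S : set ('rV[R]_n -> R).
Hypothesis subS : sobolev_subspace Omega p S.
Implicit Types (u v w : 'rV[R]_n -> R) (C : set ('rV[R]_n -> R)) (a : R).

Local Notation W := (sobolev Omega p).
Local Notation cl := (modular_closure Omega p S).
Local Notation grad := (wgrad Omega).
Local Notation gradB u v := (fun x => 1 *: grad u x + (-1) *: grad v x)%R.

Let mO : measurable Omega := measurable_open_rV oO.
Let q0 : 0 < q. Proof. exact: lt_trans q1. Qed.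

(** Closedness through approximants for every e: each later use checks this criterion for a set
    defined by the property to be proved. *)
Lemma modular_closedP C : modular_closed Omega p C <-> C `<=` W /\
  forall w, W w ->
    (forall e : R, 0 < e -> exists2 v, C v & (modular Omega p (v \- w)%R < e%:E)%E) -> C w.
Proof.
split=> [[CW [_ oC]]|[CW clC]]; split => //.
  move=> w Ww lim; apply: contrapT => nCw.
  have [e e0 ball] := oC w (conj Ww nCw).
  have [v Cv vw] := lim e e0.
  by have [_] := ball v (CW _ Cv) vw.
split=> [u []//|u [Wu nCu]]; apply: contrapT => noball; apply: nCu.
apply: clC => // e e0; apply: contrapT => nov; apply: noball.
exists e => // v Wv vu; split => // nCv; apply: nov; exists v => //.
Qed.

Lemma sub_modular_closure : S `<=` cl.
Proof. exact: sub_gen_smallest. Qed.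

Lemma modular_closure_min C : modular_closed Omega p C -> S `<=` C -> cl `<=` C.
Proof. exact: smallest_sub. Qed.

Lemma modular_closure_sobolev : cl `<=` W.
Proof.
have [SW _ _ _ _] := subS.
by apply: modular_closure_min => //; apply/modular_closedP; split.
Qed.

Lemma modular_closure_limit w : W w ->
  (forall e : R, 0 < e -> exists2 v, cl v & (modular Omega p (v \- w)%R < e%:E)%E) -> cl w.
Proof.
move=> Ww lim C [cC SC]; have /modular_closedP[_] := cC; apply => // e e0.
by have [v clv vw] := lim e e0; exists v => //; exact: clv.
Qed.

Lemma modular_closure0 : cl (cst 0).
Proof. by apply: sub_modular_closure; case: subS. Qed.

Lemma dirichlet_contract a u : `|a| <= 1 -> W u ->
  (dirichlet Omega p (fun x => a * u x)%R <= dirichlet Omega p u)%E.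
Proof.
move=> a1 Wu.
rewrite (_ : (fun x => a * u x) = (fun x => a * u x + 0 * u x)); last first.
  by apply/funext => x; rewrite mul0r addr0.
rewrite (dirichlet_lin oO mp q1 pq a 0 Wu Wu).
rewrite (_ : (fun x => _ *: _ + _) = (fun x => a *: grad u x)); last first.
  by apply/funext => x; rewrite scale0r addr0.
exact: (energy_contract oO mp q1 pq a1 (sobolev_measurable_field Wu)).
Qed.

Lemma modular_contract a u : `|a| <= 1 -> W u ->
  (modular Omega p (fun x => a * u x)%R <= modular Omega p u)%E.
Proof.
move=> a1 Wu; apply: leeD; last exact: dirichlet_contract.
apply: (powq_le oO q1).
- exact: sobolev_measurable (sobolevZ oO mp q1 pq a Wu).
- exact: sobolev_measurable Wu.
- by move=> x _; rewrite normrM ler_piMl.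
Qed.

(** The v whose multiple a v lies in the closure form a closed set because such a scaling contracts
    the modular. For larger factors the modular may jump from finite to infinite and the argument
    fails. *)
Lemma modular_closureZ a u : `|a| <= 1 -> cl u -> cl (fun x => a * u x).
Proof.
move=> a1 clu; have [SW _ _ _ SZ] := subS.
suff: cl `<=` [set v | W v /\ cl (fun x => a * v x)] by move=> /(_ u clu)[].
apply: modular_closure_min; last first.
  by move=> v Sv; split; [exact: SW|by apply: sub_modular_closure; exact: SZ].
apply/modular_closedP; split=> [v []//|w Ww lim]; split => //.
apply: modular_closure_limit; first exact: (sobolevZ oO mp q1 pq).
move=> e e0; have [v [Wv clv] vw] := lim e e0.
exists (fun x => a * v x); first exact: clv.
  apply: le_lt_trans vw.
rewrite (_ : _ \- _ = fun x => a * (v \- w) x); last first.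
  by apply/funext => x /=; rewrite mulrBr.
exact: modular_contract a1 (sobolevB oO mp q1 pq Wv Ww).
Qed.

(** Translation preserves the modular distance, so for fixed w the v with w + v in the closure form
    a closed set. This is used twice: with w in [S], then with w in the closure. *)
Lemma modular_closureD u v : cl u -> cl v -> cl (u \+ v).
Proof.
have [SW _ _ SD _] := subS.
have step w : W w -> (forall v, S v -> cl (w \+ v)) -> forall v, cl v -> cl (w \+ v).
  move=> Ww Sw v0 clv0.
  suff: cl `<=` [set v | W v /\ cl (w \+ v)] by move=> /(_ v0 clv0)[].
  apply: modular_closure_min; last by move=> v' Sv'; split; [exact: SW|exact: Sw].
  apply/modular_closedP; split=> [v' []//|w' Ww' lim]; split => //.
  apply: modular_closure_limit; first exact: (sobolevD oO mp q1 pq).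
  move=> e e0; have [v' [Wv' clv'] vw] := lim e e0.
  exists (w \+ v'); first exact: clv'.
  rewrite (_ : _ \- _ = v' \- w'); first exact: vw.
  by apply/funext => x /=; ring.
move=> clu clv; apply: (step u _ _ v clv); first exact: modular_closure_sobolev.
move=> s Ss; rewrite (_ : u \+ s = s \+ u); last by apply/funext => x /=; rewrite addrC.
apply: (step s _ _ u clu); first exact: SW.
by move=> s' Ss'; apply: sub_modular_closure; exact: SD.
Qed.

Lemma modular_closureB u v : cl u -> cl v -> cl (u \- v).
Proof.
move=> clu clv; rewrite (_ : u \- v = u \+ (fun x => -1 * v x)).
  by apply: modular_closureD clu _; apply: modular_closureZ clv; rewrite normrN normr1.
by apply/funext => x /=; rewrite mulN1r.
Qed.

Lemma powq_euclid_norm (G : 'rV[R]_n -> 'rV[R]_n) :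
  powq Omega p (fun x => euclid_norm (G x)) =
  (\int[mu]_(x in Omega) (euclid_norm (G x) `^ q)%:E)%E.
Proof. by apply: eq_integral => x _; rewrite ger0_norm // euclid_norm_ge0. Qed.

Lemma measurable_euclid_norm_field (G : 'rV[R]_n -> 'rV[R]_n) :
  measurable_field Omega G -> measurable_fun Omega (fun x => euclid_norm (G x)).
Proof. exact: measurable_euclid_norm. Qed.

(* The approximation property is stable under modular limits, with only the
   quasi-triangle inequality of [powq] at hand; a Poincaré inequality with a fixed
   constant would not be, hence this detour. *)
Lemma modular_closure_approx u : cl u -> forall e : R, 0 < e -> exists2 v, S v &
  (powq Omega p (u \- v)%R <= e%:E)%E /\
  (powq Omega p (fun x => euclid_norm (gradB u v x)) <= e%:E)%E.
Proof.
have [SW _ _ _ _] := subS.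
move=> clu; pose D := [set u | W u /\ forall e : R, 0 < e -> exists2 v, S v &
  (powq Omega p (u \- v)%R <= e%:E)%E /\
  (powq Omega p (fun x => euclid_norm (gradB u v x)) <= e%:E)%E].
suff: cl `<=` D by move=> /(_ u clu)[].
apply: modular_closure_min; last first.
  move=> v Sv; split; first exact: SW.
  move=> e e0; exists v => //; split.
    rewrite /powq integral0_eq ?lee_fin ?(ltW e0) // => x _ /=.
    by rewrite subrr normr0 powR0 // gt_eqF.
  rewrite /powq integral0_eq ?lee_fin ?(ltW e0) // => x _ /=.
  by rewrite scale1r scaleN1r subrr euclid_norm0 normr0 powR0 // gt_eqF.
apply/modular_closedP; split=> [v []//|w Ww lim]; split => // e e0.
have T0 : 0 < 2 `^ q :> R by rewrite powR_gt0.
(* Two errors e', enlarged by the quasi-triangle factor 2^q, add up to e. *)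
pose e' := e / (2 * 2 `^ q); have e'0 : 0 < e' by rewrite divr_gt0 // mulr_gt0.
have [dl dl0 small] := energy_small_powR oO mp q1 pq muO e'0.
(* One modular bound serves the L^q part through e' and, by way of the energy, the gradient through
   [dl]. *)
have md0 : 0 < Num.min e' dl by rewrite lt_min e'0.
have [v [Wv apv] vw] := lim _ md0.
have [s Ss [vs gvs]] := apv _ e'0.
have Ws := SW _ Ss.
have fin (X Y Z : \bar R) : (X <= e'%:E)%E -> (Y <= e'%:E)%E ->
    (Z <= (2 `^ q)%:E * (X + Y))%E -> (Z <= e%:E)%E.
  move=> Xe Ye; move=> /le_trans; apply.
  apply: le_trans (lee_wpmul2l _ (leeD Xe Ye)) _; first by rewrite lee_fin ltW.
  rewrite -EFinD -EFinM lee_fin /e' le_eqVlt; apply/orP; left; apply/eqP; field.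
  by rewrite gt_eqF.
have dge0 : (0 <= dirichlet Omega p (v \- w)%R)%E := energy_ge0 q1 pq _.
have vwe : (powq Omega p (v \- w)%R <= e'%:E)%E.
  apply: (@le_trans _ _ (modular Omega p (v \- w)%R)); first by rewrite leeDl.
  by apply: le_trans (ltW vw) _; rewrite lee_fin ge_min lexx.
have vwd : (dirichlet Omega p (v \- w)%R <= dl%:E)%E.
  apply: (@le_trans _ _ (modular Omega p (v \- w)%R)); first by rewrite leeDr // powq_ge0.
  by apply: le_trans (ltW vw) _; rewrite lee_fin ge_min lexx orbT.
have mfB u1 u2 : W u1 -> W u2 -> measurable_field Omega (gradB u1 u2).
  move=> W1 W2; exact: (measurable_field_lin 1 (-1) (sobolev_measurable_field W1)
    (sobolev_measurable_field W2)).
have mB u1 u2 : W u1 -> W u2 -> measurable_fun Omega (u1 \- u2).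
  move=> W1 W2; exact: measurable_funB (sobolev_measurable W1) (sobolev_measurable W2).
have gvw : (powq Omega p (fun x => euclid_norm (gradB v w x)) <= e'%:E)%E.
  rewrite powq_euclid_norm; apply: small; first exact: mfB.
  by rewrite -(dirichletB oO mp q1 pq).
exists s => //; split.
  apply: (fin _ _ _ vwe vs); apply: (powq_quasi_triangle oO q1); try exact: mB.
  move=> x _ /=; rewrite distrC.
  by rewrite (_ : s x - w x = (v x - w x) - (v x - s x)) ?ler_normB //; ring.
apply: (fin _ _ _ gvw gvs); apply: (powq_quasi_triangle oO q1);
  try (apply: measurable_euclid_norm_field; exact: mfB).
move=> x _; rewrite !ger0_norm ?euclid_norm_ge0 //.
have -> : gradB w s x = (-1) *: gradB v w x + gradB v s x.
  by apply/rowP => i; rewrite !mxE; ring.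
by apply: le_trans (euclid_normD _ _) _; rewrite euclid_normZ normrN normr1 mul1r.
Qed.

(** The inequality is borrowed from an approximant v in [S]. Passing from u to v and from the
    gradient of v back to that of u costs 2^q each time. *)
Lemma modular_closure_poincare (C : R) : 0 <= C ->
  (forall v, S v -> (powq Omega p v <= C%:E * powq Omega p (fun x => euclid_norm (grad v x)))%E) ->
  forall u, cl u ->
  (powq Omega p u <= (2 `^ q * (C * 2 `^ q))%:E * powq Omega p (fun x => euclid_norm (grad u x)))%E.
Proof.
have [SW _ _ _ _] := subS.
move=> C0 PS u clu; have Wu := modular_closure_sobolev clu.
set K := 2 `^ q; have K0 : 0 <= K by rewrite powR_ge0.
set Y := powq _ _ (fun x => euclid_norm (grad u x)).
have Y0 : (0 <= Y)%E by exact: powq_ge0.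
apply/lee_addgt0Pr => e e0.
(* The two approximation errors end up as K e' and K C K e'; the summand 1 keeps the divisor
   positive. *)
pose e' := e / (K + K * (C * K) + 1).
have D0 : 0 < K + K * (C * K) + 1 by rewrite ltr_wpDl // addr_ge0 // !mulr_ge0.
have e'0 : 0 < e' by rewrite divr_gt0.
have e'E : e' * (K + K * (C * K) + 1) = e by rewrite /e' divfK // gt_eqF.
clearbody e'.
have [v Sv [uv guv]] := modular_closure_approx clu e'0.
have Wv := SW _ Sv.
have mu_ := sobolev_measurable Wu; have mv := sobolev_measurable Wv.
have muv : measurable_fun Omega (u \- v) := measurable_funB mu_ mv.
have h1 : (powq Omega p u <= K%:E * (powq Omega p (u \- v)%R + powq Omega p v))%E.
  apply: (powq_quasi_triangle oO q1) => // x _ /=.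
  by rewrite -{1}(subrK (v x) (u x)) ler_normD.
have mgu := sobolev_measurable_field Wu; have mgv := sobolev_measurable_field Wv.
have h2 : (powq Omega p (fun x => euclid_norm (grad v x)) <=
    K%:E * (powq Omega p (fun x => euclid_norm (gradB u v x)) + Y))%E.
  apply: (powq_quasi_triangle oO q1); try exact: measurable_euclid_norm_field.
    exact: measurable_euclid_norm_field (measurable_field_lin 1 (-1) mgu mgv).
  move=> x _; rewrite !ger0_norm ?euclid_norm_ge0 //.
  have E : grad v x = (-1) *: gradB u v x + grad u x.
    by apply/rowP => i; rewrite !mxE; ring.
  by rewrite {1}E; apply: le_trans (euclid_normD _ _) _; rewrite euclid_normZ normrN normr1 mul1r.
apply: le_trans h1 _.
apply: (@le_trans _ _ (K%:E * (e'%:E + C%:E * (K%:E * (e'%:E + Y)))))%E.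
  apply: lee_wpmul2l; first by rewrite lee_fin.
  apply: leeD => //; apply: le_trans (PS _ Sv) _; apply: lee_wpmul2l; first by rewrite lee_fin.
  apply: le_trans h2 _; apply: lee_wpmul2l; first by rewrite lee_fin.
  exact: leeD2r.
have e'0E : (0 <= e'%:E)%E by rewrite lee_fin ltW.
have KY : (0 <= K%:E * Y)%E by rewrite mule_ge0 // lee_fin.
have CKY : (0 <= C%:E * (K%:E * Y))%E by rewrite mule_ge0 // lee_fin.
have Ke0 : (0 <= (K * e')%:E)%E by rewrite lee_fin mulr_ge0 // ltW.
have CKe0 : (0 <= (e' + C * (K * e'))%:E)%E.
  by rewrite lee_fin addr_ge0 ?mulr_ge0 // ltW.
rewrite (ge0_muleDr _ e'0E Y0) -EFinM (ge0_muleDr _ Ke0 KY) -EFinM addeA -EFinD.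
rewrite (ge0_muleDr _ CKe0 CKY).
rewrite -EFinM addeC !muleA -!EFinM leeD //; first by rewrite -mulrA.
by rewrite lee_fin; have := ltW e'0; lra.
Qed.

End modular_closure.

(** * Completeness and the minimizer *)

Section ae_limit.
Context d (T : measurableType d) (R : realType).
Variables (mu : {measure set T -> \bar R}) (D : set T).
Hypothesis mD : measurable D.

(** The limit superior is a measurable representative defined everywhere; [fine] makes it real. *)
Lemma ae_limit (f_ : nat -> T -> R) : (forall k, measurable_fun D (f_ k)) ->
  {ae mu, forall x, D x -> cvgn (f_^~ x)} ->
  exists2 f : T -> R, measurable_fun D f & {ae mu, forall x, D x -> f_ k x @[k --> \oo] --> f x}.
Proof.
move=> mf cf; exists (fun x => fine (limn_esup (fun k => (f_ k x)%:E))).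
  apply: measurableT_comp => //; apply: measurable_fun_limn_esup => k.
  exact/measurable_EFinP.
move: cf; apply: filterS => x h Dx; have /cvg_ex[l fl] := h Dx.
have /cvg_limn_einf_sup[_ ->] // : (f_ k x)%:E @[k --> \oo] --> l%:E.
by apply: cvg_EFin => //; exact: nearW.
Qed.

End ae_limit.

Lemma euclid_norm_cvg (R : realType) n (v_ : nat -> 'rV[R]_n) (v : 'rV[R]_n) :
  (forall i, v_ k ord0 i @[k --> \oo] --> v ord0 i) ->
  euclid_norm (v_ k) @[k --> \oo] --> euclid_norm v.
Proof.
move=> vv; apply: (@continuous_cvg _ _ _ _ _ (fun k => \sum_(i < n) v_ k ord0 i ^+ 2)
  (@Num.sqrt R)); first exact: sqrt_continuous.
apply: (@cvg_big R _ +%R 0 predT _ _ _ _ (fun i k => v_ k ord0 i ^+ 2)).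
  exact: add_continuous.
by move=> i _; apply: cvgM; exact: vv.
Qed.

Section completeness.
Variables (R : realType) (n : nat) (Omega : set 'rV[R]_n) (p : 'rV[R]_n -> R).
Local Notation mu := (@lebesgue_rV R n).
Local Notation q := (pminus Omega p).
Hypotheses (oO : open Omega) (mp : measurable_fun Omega p) (q1 : 1 < q)
  (pq : forall x, Omega x -> q <= p x) (muO : (mu Omega < +oo)%E).
Variable S : set ('rV[R]_n -> R).
Hypothesis subS : sobolev_subspace Omega p S.
Implicit Types (f g u v w : 'rV[R]_n -> R) (G : 'rV[R]_n -> 'rV[R]_n).

Local Notation W := (sobolev Omega p).
Local Notation cl := (modular_closure Omega p S).
Local Notation grad := (wgrad Omega).

Let mO : measurable Omega := measurable_open_rV oO.
Let q0 : 0 < q. Proof. exact: lt_trans q1. Qed.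
Let p0 x : Omega x -> 0 < p x. Proof. by move=> /pq; exact: lt_le_trans. Qed.

Lemma L1loc_L1_close f g : L1loc Omega f -> measurable_fun Omega g ->
  (\int[mu]_(x in Omega) (`|f x - g x|)%:E < +oo)%E -> L1loc Omega g.
Proof.
move=> [mf lf] mg fg; split; first exact: mg.
move=> K cK KO; have mK := measurable_compact_rV cK.
have ifg : mu.-integrable Omega (EFin \o (fun x => f x - g x)).
  apply/integrableP; split; last exact: fg.
  by apply/measurable_EFinP; exact: measurable_funB mf mg.
have := integrableB mK (lf K cK KO) (integrableS mO mK KO ifg).
apply: eq_integrable; first exact: mK.
by move=> x _ /=; rewrite -EFinB; congr EFin; ring.
Qed.

Lemma energy_density_cvg (G_ : nat -> 'rV[R]_n -> 'rV[R]_n) G x : Omega x ->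
  (forall i, G_ k x ord0 i @[k --> \oo] --> G x ord0 i) ->
  (euclid_norm (G_ k x) `^ p x / p x)%:E @[k --> \oo] -->
  (euclid_norm (G x) `^ p x / p x)%:E.
Proof.
move=> Ox GG; apply: cvg_EFin; first exact: nearW.
apply: cvgM; last exact: cvg_cst.
apply: powR_cvg; [exact: p0|by move=> k; exact: euclid_norm_ge0|].
exact: euclid_norm_cvg.
Qed.

(* (t / 2)^p <= t^p / p, so finite energy gives membership with lambda = 1/2. *)
Lemma Lvar_energy G i : measurable_field Omega G -> (energy Omega p G < +oo)%E ->
  Lvar Omega p (fun x => G x ord0 i).
Proof.
move=> mG EG; split; first exact: mG.
exists 2^-1; first by rewrite invr_gt0.
apply: le_lt_trans EG; apply: ge0_le_integral.
- exact: mO.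
- by move=> x _; rewrite lee_fin powR_ge0.
- apply: (measurable_normr_powR oO mp).
  by apply: measurable_funM (mG i); exact: measurable_cst.
- exact: (measurable_energy_density oO mp q1 pq mG).
move=> x Ox; rewrite lee_fin.
have p1 : 1 <= p x by apply: ltW; exact: lt_le_trans q1 (pq Ox).
apply: le_trans (powR_half_le (euclid_norm_ge0 (G x)) p1).
rewrite ge0_ler_powR ?nnegrE ?(ltW (p0 Ox)) // ?divr_ge0 ?euclid_norm_ge0 //.
by rewrite normrM ger0_norm ?invr_ge0 // mulrC ler_wpM2r ?invr_ge0 // coord_le_euclid_norm.
Qed.

Hypothesis poincare : exists2 C : R, 0 <= C & forall v, S v ->
  (powq Omega p v <= C%:E * powq Omega p (fun x => euclid_norm (grad v x)))%E.

(** On the closure the energy alone controls all other quantities: it controls the L^q size of the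
    gradient, and the Poincaré inequality and the finite measure do the rest. *)
Lemma modular_closure_small (e : R) : 0 < e -> exists2 dl : R, 0 < dl &
  forall w, cl w -> (dirichlet Omega p w <= dl%:E)%E ->
  [/\ (powq Omega p w <= e%:E)%E, (\int[mu]_(x in Omega) (`|w x|)%:E <= e%:E)%E &
      forall i, (\int[mu]_(x in Omega) (`|grad w x ord0 i|)%:E <= e%:E)%E].
Proof.
move=> e0; have [C C0 PS] := poincare.
have PC := modular_closure_poincare oO mp q1 pq muO subS C0 PS.
set C' := 2 `^ q * (C * 2 `^ q) in PC.
have C'0 : 0 <= C' by rewrite !mulr_ge0 // powR_ge0.
clearbody C'.
have [d1 d10 L1] := powR_small_L1 oO q1 muO e0.
have D0 : 0 < C' + 1 by rewrite ltr_wpDl.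
have m0 : 0 < Num.min e d1 by rewrite lt_min e0.
(* Small enough for the gradient itself and also after multiplication by the Poincaré constant; [d1]
   is what L^1 smallness asks of the L^q integrals. *)
pose e1 := Num.min e d1 / (C' + 1).
have e10 : 0 < e1 by rewrite divr_gt0.
have e1E : e1 * (C' + 1) = Num.min e d1 by rewrite /e1 divfK // gt_eqF.
clearbody e1.
have [le1 le2] : Num.min e d1 <= e /\ Num.min e d1 <= d1 by rewrite !ge_min !lexx orbT.
have [dl dl0 small] := energy_small_powR oO mp q1 pq muO e10.
exists dl => // w clw dw.
have Ww := modular_closure_sobolev subS clw.
have mw := sobolev_measurable Ww; have mgw := sobolev_measurable_field Ww.
have gw : (powq Omega p (fun x => euclid_norm (grad w x)) <= e1%:E)%E.
  by rewrite powq_euclid_norm; exact: small mgw dw.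
have pw : (powq Omega p w <= (Num.min e d1)%:E)%E.
  apply: le_trans (PC w clw) _; apply: le_trans (lee_wpmul2l _ gw) _.
    by rewrite lee_fin.
  by rewrite -EFinM lee_fin -e1E; lra.
split.
- by apply: le_trans pw _; rewrite lee_fin.
- by apply: L1 mw _; apply: le_trans pw _; rewrite lee_fin.
move=> i; apply: L1 (mgw i) _.
apply: (@le_trans _ _ (powq Omega p (fun x => euclid_norm (grad w x)))).
  apply: (powq_le oO q1 (mgw i)); first exact: measurable_euclid_norm_field.
  by move=> x _; rewrite [leRHS]ger0_norm ?euclid_norm_ge0 // coord_le_euclid_norm.
by apply: le_trans gw _; rewrite lee_fin; nra.
Qed.

(** Along a fast subsequence v, Fatou's lemma in j with k fixed turns the bounds on v_k - v_j into
    bounds on v_k - w. In particular the modular of v_k - w tends to 0, which puts w in the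
    closure. *)
Lemma modular_closure_complete (w_ : nat -> 'rV[R]_n -> R) : (forall k, cl (w_ k)) ->
  (forall e : R, 0 < e -> exists N, forall j k, (N <= j)%N -> (N <= k)%N ->
    (dirichlet Omega p (w_ j \- w_ k)%R <= e%:E)%E) ->
  exists w (s : nat -> nat), [/\ cl w, forall k, (k <= s k)%N &
    {ae mu, forall x, Omega x ->
      forall i, grad (w_ (s k)) x ord0 i @[k --> \oo] --> grad w x ord0 i}].
Proof.
move=> clw cauchy.
(* The rate that [fast_L1_cauchy_cvg] asks for. *)
pose r (k : nat) : R := 1 / (2 ^ (k + 1))%:R.
have r0 k : 0 < r k by rewrite divr_gt0 // ltr0n expn_gt0.
have r_small (e : R) : 0 < e -> exists k, r k <= e.
  move=> e0; pose k := Num.truncn e^-1; exists k.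
  rewrite /r ler_pdivrMr ?ltr0n ?expn_gt0 // mulrC -ler_pdivrMr // mul1r.
  apply: ltW; apply: lt_le_trans (truncnS_gt _) _; rewrite ler_nat -/k.
  by rewrite addn1; exact: ltnW (ltn_expl _ _).
pose close (e : R) u v := [/\ (powq Omega p (u \- v)%R <= e%:E)%E,
  (dirichlet Omega p (u \- v)%R <= e%:E)%E,
  (\int[mu]_(x in Omega) (`|u x - v x|)%:E <= e%:E)%E &
  forall i, (\int[mu]_(x in Omega) (`|grad u x ord0 i - grad v x ord0 i|)%:E <= e%:E)%E].
have Ww k : W (w_ k) := modular_closure_sobolev subS (clw k).
have mB u v : measurable_fun Omega u -> measurable_fun Omega v ->
    measurable_fun Omega (fun x => (`|u x - v x|)%:E).
  move=> mu_ mv; apply/measurable_EFinP; apply: measurableT_comp => //.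
  exact: measurable_funB.
have /choice[N HN] : forall k, exists N, forall i j, (N <= i)%N -> (N <= j)%N ->
    close (r k) (w_ i) (w_ j).
  move=> k; have [dl dl0 small] := modular_closure_small (r0 k).
  have md0 : 0 < Num.min dl (r k) by rewrite lt_min dl0 r0.
  have [N HN] := cauchy _ md0; exists N => i j Ni Nj.
  have dij := HN i j Ni Nj.
  have clij := modular_closureB oO mp q1 pq subS (clw i) (clw j).
  have [|h1 h2 h3] := small _ clij.
    by apply: le_trans dij _; rewrite lee_fin ge_min lexx.
  split; [exact: h1| |exact: h2|].
    by apply: le_trans dij _; rewrite lee_fin ge_min lexx orbT.
  move=> l; apply: le_trans (h3 l); rewrite le_eqVlt; apply/orP; left; apply/eqP.
  have mgi := sobolev_measurable_field (Ww i) l.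
  have mgj := sobolev_measurable_field (Ww j) l.
  have Wij := sobolevB oO mp q1 pq (Ww i) (Ww j).
  have mgij := sobolev_measurable_field Wij l.
  apply: (ge0_ae_eq_integral mO (mB _ _ mgi mgj)).
  - by apply/measurable_EFinP; apply: measurableT_comp mgij.
  - by move=> x _; rewrite lee_fin.
  - by move=> x _; rewrite lee_fin.
  have [_ Gi _] := Ww i; have [_ Gj _] := Ww j.
  have := wgrad_lin oO 1 (-1) Gi Gj.
  rewrite (_ : (fun x => 1 * _ + _) = w_ i \- w_ j); last first.
    by apply/funext => x /=; rewrite mul1r mulN1r.
  by apply: filterS => x h /h ->; rewrite !mxE mul1r mulN1r.
(* nondecreasing, at least k and at least N k *)
pose s (k : nat) := (k + \sum_(i < k.+1) N i)%N.
have sk k : (k <= s k)%N by rewrite leq_addr.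
have sN k i : (k <= i)%N -> (N k <= s i)%N.
  move=> ki; rewrite /s (bigD1 (Ordinal (ki : (k < i.+1)%N))) //= addnCA.
  by rewrite leq_addr.
pose v k := w_ (s k).
have Pv k i j : (k <= i)%N -> (k <= j)%N -> close (r k) (v i) (v j).
  by move=> ki kj; apply: HN; exact: sN.
have Wv k : W (v k) := Ww _.
have mv k : measurable_fun Omega (v k) := sobolev_measurable (Wv k).
have mgv k : measurable_field Omega (grad (v k)) := sobolev_measurable_field (Wv k).
have [w mw vw] := ae_limit mv (fast_L1_cauchy_cvg mO mv
  (fun k => let: And4 _ _ h _ := Pv k k.+1 k (leqnSn k) (leqnn k) in h)).
have /choice[G_ HG_] : forall i, exists g : 'rV[R]_n -> R, measurable_fun Omega g /\
    {ae mu, forall x, Omega x -> grad (v k) x ord0 i @[k --> \oo] --> g x}.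
  move=> i; have [g mg vg] := ae_limit (fun k => mgv k i)
    (fast_L1_cauchy_cvg mO (fun k => mgv k i)
      (fun k => let: And4 _ _ _ h := Pv k k.+1 k (leqnSn k) (leqnn k) in h i)).
  by exists g.
pose G (x : 'rV[R]_n) : 'rV[R]_n := \row_i G_ i x.
have mG : measurable_field Omega G.
  move=> i; rewrite (_ : (fun x => _) = G_ i); first by have [] := HG_ i.
  by apply/funext => x; rewrite mxE.
have vG : {ae mu, forall x, Omega x -> forall i,
    grad (v k) x ord0 i @[k --> \oo] --> G x ord0 i}.
  have : {ae mu, forall x, forall i, Omega x ->
      grad (v k) x ord0 i @[k --> \oo] --> G_ i x}.
    apply: (@filter_forall _ _ (fun i x => Omega x ->
      grad (v k) x ord0 i @[k --> \oo] --> G_ i x)) => i.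
    by have [] := HG_ i.
  by apply: filterS => x h Ox i; rewrite mxE; exact: h.
clearbody G.
have L1lim (f_ : nat -> 'rV[R]_n -> R) f k : (forall j, measurable_fun Omega (f_ j)) ->
    measurable_fun Omega f ->
    {ae mu, forall x, Omega x -> f_ j x @[j --> \oo] --> f x} ->
    (forall j, (k <= j)%N -> (\int[mu]_(x in Omega) (`|f_ k x - f_ j x|)%:E <= (r k)%:E)%E) ->
    (\int[mu]_(x in Omega) (`|f_ k x - f x|)%:E <= (r k)%:E)%E.
  move=> mf_ mf ff bnd.
  apply: (fatou_bound mO (fun j => mB _ _ (mf_ k) (mf_ j)) _ (mB _ _ (mf_ k) mf)).
  - by move=> j x _; rewrite lee_fin.
  - by move=> x _; rewrite lee_fin.
  - move: ff; apply: filterS => x h Ox; apply: cvg_EFin; first exact: nearW.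
    by apply: cvg_norm; apply: cvgB; [exact: cvg_cst|exact: h].
  - by exists k => // j /=; exact: bnd.
have wL1 k : (\int[mu]_(x in Omega) (`|v k x - w x|)%:E <= (r k)%:E)%E.
  by apply: L1lim => // j kj; have [] := Pv k k j (leqnn k) kj.
have GL1 k i : (\int[mu]_(x in Omega) (`|grad (v k) x ord0 i - G x ord0 i|)%:E <= (r k)%:E)%E.
  apply: (L1lim (fun k x => grad (v k) x ord0 i) (fun x => G x ord0 i)).
  - by move=> j; exact: mgv.
  - exact: mG.
  - by move: vG; apply: filterS => x h Ox; exact: h.
  - by move=> j kj; have [_ _ _ h] := Pv k k j (leqnn k) kj; exact: h.
have wP k : (powq Omega p (v k \- w)%R <= (r k)%:E)%E.
  have mq f g : measurable_fun Omega f -> measurable_fun Omega g ->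
      measurable_fun Omega (fun x => (`|(f \- g)%R x| `^ q)%:E).
    move=> mf mg; exact: (measurable_powq p oO (measurable_funB mf mg)).
  apply: (fatou_bound mO (fun j => mq _ _ (mv k) (mv j)) _ (mq _ _ (mv k) mw)).
  - by move=> j x _; rewrite lee_fin powR_ge0.
  - by move=> x _; rewrite lee_fin powR_ge0.
  - move: vw; apply: filterS => x h Ox; apply: cvg_EFin; first exact: nearW.
    apply: powR_cvg q0 _ _; first by move=> j; exact: normr_ge0.
    by apply: cvg_norm; apply: cvgB; [exact: cvg_cst|exact: h].
  - by exists k => // j /= kj; have [] := Pv k k j (leqnn k) kj.
pose dG k (H : 'rV[R]_n -> 'rV[R]_n) x := 1 *: grad (v k) x + (-1) *: H x.
have mdG k H : measurable_field Omega H -> measurable_field Omega (dG k H).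
  by move=> mH; exact: (measurable_field_lin 1 (-1) (mgv k) mH).
have GE k : (energy Omega p (dG k G) <= (r k)%:E)%E.
  have me H := @measurable_energy_density _ _ _ _ oO mp q1 pq H.
  apply: (fatou_bound mO (fun j => me _ (mdG k _ (mgv j))) _ (me _ (mdG k _ mG))).
  - by move=> j x; exact: energy_density_ge0.
  - by move=> x; exact: energy_density_ge0.
  - move: vG; apply: filterS => x h Ox.
    apply: (energy_density_cvg (G_ := fun j => dG k (grad (v j)))) => // i.
    rewrite (_ : (fun j => _) = (fun j => 1 * grad (v k) x ord0 i + -1 * grad (v j) x ord0 i)).
      rewrite /dG !mxE; apply: cvgD; first exact: cvg_cst.
      by apply: cvgM; [exact: cvg_cst|exact: (h Ox i)].
    by apply/funext => j; rewrite !mxE.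
  - exists k => // j /= kj; have [_ + _ _] := Pv k k j (leqnn k) kj.
    by rewrite (dirichletB oO mp q1 pq (Wv k) (Wv j)).
have lty (X : \bar R) k : (X <= (r k)%:E)%E -> (X < +oo)%E.
  by move=> h; apply: le_lt_trans h _; rewrite ltry.
have wg : is_weak_gradient Omega w G.
  apply: (is_weak_gradient_limit oO (u_ := v) (G_ := fun k => grad (v k))).
  - by move=> k; exact: sobolev_wgrad (Wv k).
  - have [lv _ _] := sobolev_wgrad (Wv 0%N).
    exact: L1loc_L1_close lv mw (lty _ _ (wL1 0%N)).
  - move=> i; have [_ lG _] := sobolev_wgrad (Wv 0%N).
    exact: L1loc_L1_close (lG i) (mG i) (lty _ _ (GL1 0%N i)).
  - move=> e e0; have [k ke] := r_small e e0.
    by exists k; split => [|i]; [apply: le_trans (wL1 k) _|apply: le_trans (GL1 k i) _];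
       rewrite lee_fin.
have gwG : ae_eq mu Omega (grad w) G := wgrad_unique oO wg.
have [_ lgw _] := wgradP (ex_intro _ G wg).
have mgw : measurable_field Omega (grad w) by move=> i; have [] := lgw i.
(* Each membership is shown for v_0 - w and passed to w by linearity: v_0 - w has finite energy,
   whereas the energy of w itself may be infinite. *)
have Ww' : W w.
  split; [|by exists G|move=> i].
    have L0 : Lq Omega q (v 0%N \- w).
      by split; [exact: measurable_funB|exact: lty (wP 0%N)].
    have [Lv _ _] := Wv 0%N.
    have := Lq_lin oO q1 1 (-1) Lv L0; congr Lq.
    by apply/funext => x /=; ring.
  apply: (Lvar_ae_eq oO mp (f := fun x => G x ord0 i) (mgw i)).
    by move: gwG; apply: filterS => x h /h ->.
  have [_ _ LG] := Wv 0%N.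
  have := Lvar_lin oO 1 (-1) mp _ (LG i) (Lvar_energy i (mdG 0%N G mG) (lty _ _ (GE 0%N))).
  rewrite (_ : (fun x => _) = fun x => G x ord0 i); last first.
    by apply/funext => x /=; rewrite !mxE; ring.
  by apply => x Ox; apply: ltW; exact: lt_le_trans q1 (pq Ox).
exists w, s; split; [|exact: sk|].
  apply: modular_closure_limit => // e e0.
  (* Two terms of at most e / 3 leave the sum strictly below e. *)
  have [k ke] := r_small _ (divr_gt0 e0 (ltr0n R 3) : 0 < e / 3%:R).
  exists (v k); first exact: clw.
  apply: le_lt_trans (leeD (wP k) _) _.
  - rewrite (dirichletB oO mp q1 pq (Wv k) Ww'); apply: le_trans (GE k).
    rewrite le_eqVlt; apply/orP; left; apply/eqP.
    apply: (energy_ae_eq oO mp q1 pq (mdG k _ mgw) (mdG k _ mG)).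
    by move: gwG; apply: filterS => x h Ox; rewrite /dG h.
  - by rewrite -EFinD lte_fin; lra.
move: vG; apply: filterS2 gwG => x gx h Ox i.
by rewrite gx //; exact: h.
Qed.

End completeness.

(** * Existence and uniqueness of the minimizer *)

Section minimizer.
Variables (R : realType) (n : nat) (Omega : set 'rV[R]_n) (p : 'rV[R]_n -> R).
Local Notation mu := (@lebesgue_rV R n).
Local Notation q := (pminus Omega p).
Hypotheses (oO : open Omega) (mp : measurable_fun Omega p) (q1 : 1 < q)
  (pq : forall x, Omega x -> q <= p x) (muO : (mu Omega < +oo)%E).
Variables (S : set ('rV[R]_n -> R)) (phi : 'rV[R]_n -> R).
Hypotheses (subS : sobolev_subspace Omega p S) (Wphi : sobolev Omega p phi)
  (Dphi : (dirichlet Omega p phi < +oo)%E).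
Hypothesis poincare : exists2 C : R, 0 <= C & forall v, S v ->
  (powq Omega p v <= C%:E * powq Omega p (fun x => euclid_norm (wgrad Omega v x)))%E.
Implicit Types (u v w : 'rV[R]_n -> R).

Local Notation W := (sobolev Omega p).
Local Notation cl := (modular_closure Omega p S).
Local Notation grad := (wgrad Omega).
Local Notation F u := (dirichlet Omega p (u \- phi)%R).
Local Notation half u := (fun x => 2^-1 * u x)%R.

Let mO : measurable Omega := measurable_open_rV oO.

Lemma half_norm_le1 : `|2^-1 : R| <= 1.
Proof. by rewrite ger0_norm ?invr_ge0 // invf_le1 // ler1n. Qed.

Lemma modular_closure_half u : cl u -> cl (half u).
Proof. exact: (modular_closureZ oO mp q1 pq subS half_norm_le1). Qed.

(** Applied to u - phi and v - phi: phi cancels in the half difference and survives unscaled in the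
    midpoint. *)
Lemma dirichlet_uniform_convexity (e : R) : 0 < e <= 1 ->
  exists2 K : R, 0 <= K & forall u v, W u -> W v ->
    (dirichlet Omega p (half u \- half v)%R + K%:E * F (half u \+ half v)%R <=
     ((K + e) / 2)%:E * (F u + F v))%E.
Proof.
move=> e01; have [K K0 UC] := energy_uniform_convexity oO mp q1 pq e01.
exists K => // u v Wu Wv.
have Wu' := sobolevB oO mp q1 pq Wu Wphi; have Wv' := sobolevB oO mp q1 pq Wv Wphi.
have := UC _ _ (sobolev_measurable_field Wu') (sobolev_measurable_field Wv').
rewrite -(dirichlet_lin oO mp q1 pq _ _ Wu' Wv') -(dirichlet_lin oO mp q1 pq _ _ Wu' Wv').
rewrite (_ : (fun x => _ + - 2^-1 * _) = half u \- half v); last first.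
  by apply/funext => x /=; ring.
rewrite (_ : (fun x => _ + 2^-1 * _) = (half u \+ half v) \- phi); last first.
  by apply/funext => x /=; field.
exact.
Qed.

(** The midpoint lies in the closure, so its value is at least m, and the finite quantity K m can be
    subtracted. The estimate serves both for the Cauchy property of a minimizing sequence and for
    uniqueness. *)
Lemma near_minimizers_close (m e : R) : 0 <= m -> (forall w, cl w -> (m%:E <= F w)%E) ->
  0 < e -> exists2 dl : R, 0 < dl & forall u v, cl u -> cl v ->
    (F u <= (m + dl)%:E)%E -> (F v <= (m + dl)%:E)%E ->
    (dirichlet Omega p (half u \- half v)%R <= e%:E)%E.
Proof.
move=> m0 mF e0.
(* The final bound is (K + e1)(m + dl) - K m = e1 m + (K + e1) dl. First e1 makes e1 m at most e /
   2; K depends on e1, and [dl] on K. *)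
pose e1 := Num.min 1 (e / (2 * (m + 1))).
have m10 : 0 < 2 * (m + 1) by rewrite mulr_gt0 // ltr_wpDl.
have e10 : 0 < e1 by rewrite lt_min ltr01 divr_gt0.
have e11 : e1 <= 1 by rewrite ge_min lexx.
have e1m : e1 * (m + 1) <= e / 2.
  have h : e1 <= e / (2 * (m + 1)) by rewrite /e1 ge_min lexx orbT.
  apply: le_trans (ler_wpM2r (ltW (_ : 0 < m + 1)) h) _; first by rewrite ltr_wpDl.
  by rewrite le_eqVlt; apply/orP; left; apply/eqP; field; lra.
clearbody e1.
have [K K0 UC] := dirichlet_uniform_convexity (introT andP (conj e10 e11)).
have K10 : 0 < K + 1 by rewrite ltr_wpDl.
pose dl := e / (2 * (K + 1)).
have dl0 : 0 < dl by rewrite divr_gt0 // mulr_gt0.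
have dlK : dl * (K + 1) = e / 2 by rewrite /dl; field; lra.
clearbody dl.
exists dl => // u v clu clv Fu Fv.
have Wu := modular_closure_sobolev subS clu; have Wv := modular_closure_sobolev subS clv.
have clm := modular_closureD oO mp q1 pq subS (modular_closure_half clu) (modular_closure_half clv).
have h : (dirichlet Omega p (half u \- half v)%R + (K * m)%:E <= ((K + e1) * (m + dl))%:E)%E.
  apply: (@le_trans _ _ (dirichlet Omega p (half u \- half v)%R +
      K%:E * F (half u \+ half v)%R)%E).
    by apply: leeD2l; rewrite EFinM; apply: lee_wpmul2l; [rewrite lee_fin|exact: mF].
  apply: le_trans (UC u v Wu Wv) _.
  apply: le_trans (lee_wpmul2l _ (leeD Fu Fv)) _.
    by rewrite lee_fin divr_ge0 // addr_ge0 // ltW.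
  rewrite -EFinD -EFinM lee_fin le_eqVlt; apply/orP; left; apply/eqP; by field.
move: h; rewrite -leeBrDr // => /le_trans; apply.
rewrite -EFinB lee_fin.
have : e1 * dl <= dl by rewrite ler_piMl // ltW.
nra.
Qed.

Lemma dirichlet_minimizer : exists u, is_minimizer (fun u => F u) cl u /\
  forall v, is_minimizer (fun u => F u) cl v -> eq_on Omega u v.
Proof.
have Fge0 u : (0 <= F u)%E by exact: (energy_ge0 q1 pq).
have cl0 : cl (cst 0) := modular_closure0 subS.
(* The competitor 0 makes the infimum finite, by the finite energy of phi. *)
have F0 : (F (cst 0)%R < +oo)%E.
  apply: le_lt_trans Dphi.
  rewrite (_ : cst 0 \- phi = fun x => -1 * phi x); last first.
    by apply/funext => x /=; rewrite sub0r mulN1r.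
  by apply: (dirichlet_contract oO mp q1 pq) => //; rewrite normrN normr1.
pose M := ereal_inf [set F u | u in cl].
have MF u : cl u -> (M <= F u)%E by move=> clu; apply: ereal_inf_lbound; exists u.
have M0 : (0 <= M)%E by apply: le_ereal_inf_tmp => _ [u _ <-].
have Mfin : M \is a fin_num by rewrite ge0_fin_numE //; exact: le_lt_trans (MF _ cl0) F0.
pose m := fine M; have mM : m%:E = M by rewrite /m fineK.
have m0 : 0 <= m by rewrite /m fine_ge0.
have mF w : cl w -> (m%:E <= F w)%E by rewrite mM; exact: MF.
have /choice[u_ Hu] : forall k : nat, exists u, cl u /\ (F u <= (m + k.+1%:R^-1)%:E)%E.
  move=> k; have : (M < (m + k.+1%:R^-1)%:E)%E by rewrite -mM lte_fin ltrDl invr_gt0.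
  by move=> /ereal_inf_lt[_ [u clu <-] /ltW Fu]; exists u.
have clu k : cl (u_ k) by have [] := Hu k.
have Fu k : (F (u_ k) <= (m + k.+1%:R^-1)%:E)%E by have [] := Hu k.
have small (e : R) : 0 < e -> exists N, forall k, (N <= k)%N -> k.+1%:R^-1 <= e.
  move=> e0; exists (Num.truncn e^-1) => k Nk.
  rewrite -[leRHS]invrK lef_pV2 ?posrE ?invr_gt0 //.
  by apply: ltW; apply: lt_le_trans (truncnS_gt _) _; rewrite ler_nat ltnS.
have clh k : cl (half (u_ k)) := modular_closure_half (clu k).
have [|w [s [clw sk gw]]] := modular_closure_complete oO mp q1 pq muO subS poincare clh.
  move=> e e0; have [dl dl0 close] := near_minimizers_close m0 mF e0.
  have [N HN] := small dl dl0; exists N => j k Nj Nk.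
  by apply: close => //; [apply: le_trans (Fu j) _|apply: le_trans (Fu k) _];
     rewrite lee_fin lerD2l HN.
(* A sum rather than a multiple, as [modular_closureZ] covers only factors of absolute value at most
   1. *)
pose u := w \+ w.
have clu' : cl u := modular_closureD oO mp q1 pq subS clw clw.
have Ww : W w := modular_closure_sobolev subS clw.
have Wh k : W (half (u_ k)) := modular_closure_sobolev subS (clh k).
(* The field of 2 v - phi in terms of the gradient of v, since it is the gradients of the halves
   that converge. *)
pose G v x := 2 *: grad v x + (-1) *: grad phi x.
have mG v : W v -> measurable_field Omega (G v).
  by move=> Wv; exact: (measurable_field_lin 2 (-1) (sobolev_measurable_field Wv)
    (sobolev_measurable_field Wphi)).
have FG v v' : W v -> v' = (fun x => 2 * v x) -> F v' = energy Omega p (G v).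
  move=> Wv ->; rewrite -(dirichlet_lin oO mp q1 pq _ _ Wv Wphi).
  rewrite (_ : _ \- phi = (fun x => 2 * v x + -1 * phi x)) //.
  by apply/funext => x /=; rewrite mulN1r.
have Fm : (F u <= m%:E)%E.
  apply/lee_addgt0Pr => e e0.
  rewrite (FG w u Ww); last by apply/funext => x; rewrite /u /= mulr_natl mulr2n.
  have me v (Wv : W v) := measurable_energy_density oO mp q1 pq (mG v Wv).
  apply: (fatou_bound mO (fun k => me _ (Wh (s k))) _ (me _ Ww)).
  - by move=> k x; exact: energy_density_ge0.
  - by move=> x; exact: energy_density_ge0.
  - move: gw; apply: filterS => x h Ox.
    apply: (energy_density_cvg q1 pq (G_ := fun k => G (half (u_ (s k))))) => // i.
    rewrite (_ : (fun k => _) = (fun k => 2 * grad (half (u_ (s k))) x ord0 i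
      + -1 * grad phi x ord0 i)).
      rewrite /G !mxE; apply: cvgD; last exact: cvg_cst.
      by apply: cvgM; [exact: cvg_cst|exact: h].
    by apply/funext => k; rewrite /G !mxE.
  - have [N HN] := small e e0; exists N => // k /= Nk.
    have E : F (u_ (s k)) = energy Omega p (G (half (u_ (s k)))).
      by apply: FG (Wh _) _; apply/funext => x; rewrite mulVKf.
    apply: (@le_trans _ _ (F (u_ (s k)))); first by rewrite E.
    apply: le_trans (Fu (s k)) _; rewrite -EFinD lee_fin lerD2l.
    by apply: HN; exact: leq_trans Nk (sk k).
exists u; split; first by split; [exact: clu'|move=> v clv; exact: le_trans Fm (mF v clv)].
move=> v [clv Fv].
have Fvm : (F v <= m%:E)%E by apply: le_trans (Fv u clu') Fm.
have clB := modular_closureB oO mp q1 pq subS (modular_closure_half clu') (modular_closure_half clv).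
(* Two minimizers are near minimizers for every [dl], so the energy of their half difference is
   below every [d1] and its L^1 norm below every e. *)
have zero : (\int[mu]_(x in Omega) (`|(half u \- half v) x|)%:E = 0)%E.
  apply/eqP; rewrite eq_le integral_ge0 ?andbT; last by move=> x _; rewrite lee_fin.
  apply/lee_addgt0Pr => e e0; rewrite add0e.
  have [d1 d10 sm] := modular_closure_small oO mp q1 pq muO subS poincare e0.
  have [dl dl0 close] := near_minimizers_close m0 mF d10.
  have mdl : (m%:E <= (m + dl)%:E)%E by rewrite lee_fin lerDl ltW.
  have dd := close u v clu' clv (le_trans Fm mdl) (le_trans Fvm mdl).
  by have [_ + _] := sm _ clB dd.
have mB := sobolev_measurable (modular_closure_sobolev subS clB).
have mB' : measurable_fun Omega (EFin \o (half u \- half v)) by exact/measurable_EFinP.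
have /(ae_eq_integral_abs mu mO mB') := zero.
apply: filterS => x h Ox.
by have [] := h Ox; lra.
Qed.

End minimizer.

Theorem theorem7p3 (R : realType) (n : nat) (Omega : set 'rV[R]_n)
    (p : 'rV[R]_n -> R) (phi : 'rV[R]_n -> R) (S : set ('rV[R]_n -> R)) :
  (0 < n)%N ->
  bounded_C1_domain Omega ->
  (forall x, Omega x -> 1 < p x) ->
  {within Omega, continuous p} ->
  1 < pminus Omega p ->
  sobolev Omega p phi ->
  (dirichlet Omega p phi < +oo)%E ->
  sobolev_subspace Omega p S ->
  (forall u, S u -> compactly_supported Omega u) ->
  let F := fun u => dirichlet Omega p (u \- phi) in
  exists u, is_minimizer F (modular_closure Omega p S) u /\
    forall v, is_minimizer F (modular_closure Omega p S) v -> eq_on Omega u v.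
Proof.
(* The Poincaré inequality integrates along the first coordinate, so the dimension is put in
   successor form. *)
case: n Omega p phi S => [//|n] Omega p phi S _ [_ oO _ bO _] p1 cp q1 Wphi Dphi subS cS F.
have mO := measurable_open_rV oO.
have mp := measurable_fun_within_open oO cp.
have pq x : Omega x -> pminus Omega p <= p x.
  move=> Ox; apply: ge_inf; last by exists x.
  (* [inf] is a lower bound only for a set that is bounded below; 1 bounds the values of p. *)
  by exists 1 => _ [y Oy <-]; exact: ltW (p1 y Oy).
have muO := lebesgue_rV_bounded_lty mO bO.
apply: (dirichlet_minimizer oO mp q1 pq muO subS Wphi Dphi).
have [C C0 PC] := poincare_compact_support oO bO q1.
exists C => // v Sv.
have Wv : sobolev Omega p v by have [SW _ _ _ _] := subS; exact: SW.
apply: le_trans (PC v _ (sobolev_wgrad Wv) (cS v Sv)) _.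
apply: lee_wpmul2l; first by rewrite lee_fin.
have mg := sobolev_measurable_field Wv.
(* The inequality obtained involves only the first component of the gradient, which the Euclidean
   norm dominates. *)
apply: (powq_le oO q1 (mg ord0)); first exact: measurable_euclid_norm_field.
by move=> x _; rewrite [leRHS]ger0_norm ?euclid_norm_ge0 // coord_le_euclid_norm.
Qed.
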